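(* Let $(M,g,\nabla,\nabla^* )$ be a dually flat manifold. Then $M$ forms a pair of Monge--Ampère manifolds, one in the $\nabla$-affine coordinates $\eta$ and one in the dual $\nabla^*$-affine coordinates $\eta^*$. That is, everywhere locally on $M$ there are mutually dual affine coordinate systems $\eta=(\eta^i)$ and $\eta^*=(\eta^*_i)$ and smooth potential functions $\psi(\eta)$ and $\psi^*(\eta^* )$ of the metric such that $\psi$ satisfies a Monge--Ampère equation $\det\left(\frac{\partial^2\psi}{\partial\eta^i\partial\eta^j}\right)=f$ in the coordinates $\eta$, and $\psi^*$ satisfies a Monge--Ampère equation $\det\left(\frac{\partial^2\psi^*}{\partial\eta^*_i\partial\eta^*_j}\right)=f^*$ in the coordinates $\eta^*$.
   Context: A dually flat manifold $(M,g,\nabla,\nabla^* )$ is a smooth manifold $M$ with a Riemannian metric $g$ and two flat torsion-free affine connections $\nabla,\nabla^*$ that are dual with respect to $g$: $X g(Y,Z)=g(\nabla_XY,Z)+g(Y,\nabla^*_XZ)$ for all vector fields $X,Y,Z$. A local coordinate system is $\nabla$-affine if its coordinate vector fields are $\nabla$-parallel (similarly for $\nabla^*$). A $\nabla$-affine system $\eta=(\eta^i)$ and a $\nabla^*$-affine system $\eta^*=(\eta^*_i)$ are mutually dual if their natural bases are biorthogonal: $g(\partial/\partial\eta^i,\partial/\partial\eta^*_j)=\delta_i^j$. Potential functions of the metric are functions $\psi(\eta)$ and $\psi^*(\eta^* )$ with $g_{ij}=\frac{\partial^2\psi}{\partial\eta^i\partial\eta^j}$ and $g^{ij}=\frac{\partial^2\psi^*}{\partial\eta^*_i\partial\eta^*_j}$,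 where $g_{ij}=g(\partial/\partial\eta^i,\partial/\partial\eta^j)$ and $(g^{ij})$ is the inverse matrix. A Monge--Ampère equation is an equation $\det\mathrm{Hess}(\Phi)=f$ for a smooth convex function $\Phi$ on a domain, with $f$ a nonnegative function; no boundary condition is imposed. A Monge--Ampère manifold is a manifold on which, everywhere locally, there is a smooth potential function $\Phi$ satisfying a Monge--Ampère equation. *)

(* Defs.v *)
From HB Require Import structures.
From mathcomp Require Import all_boot all_order all_algebra.
From mathcomp Require Import all_classical all_reals all_analysis.

Set Implicit Arguments.
Unset Strict Implicit.
Unset Printing Implicit Defensive.

Import Order.TTheory GRing.Theory Num.Theory.
Import numFieldNormedType.Exports.

Local Open Scope classical_set_scope.
Local Open Scope ring_scope.

Section Euclidean.
Context {R : realType} {n : nat}.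

Definition partial {V : normedModType R} (i : 'I_n) (f : 'rV[R]_n -> V) :
    'rV[R]_n -> V :=
  fun x => 'D_(delta_mx 0 i) f x.

(* C^oo on the open set D: all iterated partial derivatives, including f itself
   (s = [::]), are Frechet differentiable at every point of D. *)
Definition smooth_on {V : normedModType R} (D : set 'rV[R]_n)
    (f : 'rV[R]_n -> V) : Prop :=
  forall (s : seq 'I_n) (x : 'rV[R]_n),
    D x -> differentiable (foldr partial f s) x.

Definition hessian (f : 'rV[R]_n -> R) (x : 'rV[R]_n) : 'M[R]_n :=
  \matrix_(i, j) partial i (partial j f) x.

Definition domain (D : set 'rV[R]_n) : Prop :=
  [/\ D !=set0, open D & connected D].

(* A domain need not be convex, so Jensen's inequality is required along the
   segments contained in D; for convex D this is [convex_function D f]. *)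
Definition convex_on (D : set 'rV[R]_n) (f : 'rV[R]_n -> R) : Prop :=
  forall C : set (convex_lmodType 'rV[R]_n),
    convex_set C -> C `<=` D -> convex_function C f.

Definition Monge_Ampere (D : set 'rV[R]_n) (Phi f : 'rV[R]_n -> R) : Prop :=
  [/\ domain D, smooth_on D Phi, convex_on D Phi,
      forall x, D x -> 0 <= f x
    & forall x, D x -> \det (hessian Phi x) = f x].

End Euclidean.

(* [chart_map] and [chart_inv] are total functions, meaningful only on
   [chart_dom] and on [chart_map @` chart_dom] respectively. *)
Record chart (R : realType) (n : nat) (M : topologicalType) := Chart {
  chart_dom : set M;
  chart_map : M -> 'rV[R]_n;
  chart_inv : 'rV[R]_n -> M;
  chart_dom_open : open chart_dom;
  chart_img_open : open (chart_map @` chart_dom);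
  chartK : {in chart_dom, cancel chart_map chart_inv};
  chart_continuous : {in chart_dom, continuous chart_map};
  chart_inv_continuous : {in chart_map @` chart_dom, continuous chart_inv}
}.

Definition compatible (R : realType) (n : nat) (M : topologicalType)
    (phi psi : chart R n M) : Prop :=
  smooth_on (chart_map phi @` (chart_dom phi `&` chart_dom psi))
            (chart_map psi \o chart_inv phi) /\
  smooth_on (chart_map psi @` (chart_dom phi `&` chart_dom psi))
            (chart_map phi \o chart_inv psi).

Record manifold (R : realType) (n : nat) := Manifold {
  carrier :> topologicalType;
  carrier_hausdorff : hausdorff_space carrier;
  carrier_second_countable : @second_countable carrier;
  atlas : set (chart R n carrier);
  atlas_cover : forall p : carrier, exists2 phi, atlas phi & chart_dom phi p;
  atlas_compatible : forall phi psi,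
    atlas phi -> atlas psi -> compatible phi psi
}.

Section Manifold.
Context {R : realType} {n : nat} (M : manifold R n).

(* The elements of the maximal smooth atlas. *)
Definition coordinate_system (phi : chart R n M) : Prop :=
  forall psi, atlas psi -> compatible phi psi.

Definition smooth_fun (U : set M) (f : M -> R) : Prop :=
  forall phi, atlas phi ->
    smooth_on (chart_map phi @` (U `&` chart_dom phi)) (f \o chart_inv phi).

Definition smooth_near (p : M) (f : M -> R) : Prop :=
  exists2 U, open_nbhs p U & smooth_fun U f.

(* A tangent vector at p acts on functions by directional derivation.  Only the
   functions smooth near p matter; all tangent vectors send the other ones to
   0, so that equality of tangent vectors is equality in this type. *)
Definition functional := (M -> R) -> R.

(* Vector fields on an open set are total maps of this type, with irrelevant
   values outside of that set. *)
Definition vfield := M -> functional.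

Definition coord_field (phi : chart R n M) (i : 'I_n) : vfield :=
  fun p f => if `[< smooth_near p f >]
             then partial i (f \o chart_inv phi) (chart_map phi p) else 0.

(* The tangent space at p, as the span of a coordinate basis. *)
Definition tangent (p : M) (v : functional) : Prop :=
  exists phi : chart R n M,
    [/\ coordinate_system phi, chart_dom phi p
      & exists a : 'rV[R]_n, v = \sum_(i < n) a 0 i *: coord_field phi i p].

Definition derive_along (X : vfield) (f : M -> R) : M -> R := fun p => X p f.

Definition vector_field (U : set M) (X : vfield) : Prop :=
  (forall p, U p -> tangent p (X p)) /\
  (forall V f, open V -> V `<=` U -> smooth_fun V f ->
     smooth_fun V (derive_along X f)).

Definition bracket (X Y : vfield) : vfield :=
  fun p f => if `[< smooth_near p f >]
             then X p (derive_along Y f) - Y p (derive_along X f) else 0.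

Definition metric := forall p : M, functional -> functional -> R.

Definition pairing (g : metric) (X Y : vfield) : M -> R :=
  fun p => g p (X p) (Y p).

Record riemannian (g : metric) : Prop := Riemannian {
  metric_sym : forall p u v, tangent p u -> tangent p v -> g p u v = g p v u;
  metric_linear : forall p a u v w, tangent p u -> tangent p v ->
    tangent p w -> g p (a *: u + v) w = a * g p u w + g p v w;
  metric_pos : forall p v, tangent p v -> v != 0 -> 0 < g p v v;
  metric_smooth : forall U X Y, open U -> vector_field U X ->
    vector_field U Y -> smooth_fun U (pairing g X Y)
}.

(* Coordinate fields are only locally defined, so a connection is given on the
   vector fields over every open set, compatibly with restriction: by
   [connection_local] and the totality of [vfield]s, nabla X Y on U depends only
   on X and Y on U.  This determines and is determined by its values on global
   fields. *)
Record affine_connection (nabla : vfield -> vfield -> vfield) : Prop :=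
  AffineConnection {
  connection_field : forall U X Y, open U -> vector_field U X ->
    vector_field U Y -> vector_field U (nabla X Y);
  connection_local : forall U X X' Y Y', open U ->
    vector_field U X -> vector_field U Y ->
    {in U, X =1 X'} -> {in U, Y =1 Y'} -> {in U, nabla X Y =1 nabla X' Y'};
  connection_linear : forall U f X X' Y, open U -> smooth_fun U f ->
    vector_field U X -> vector_field U X' -> vector_field U Y ->
    {in U, nabla (fun p => f p *: X p + X' p) Y =1
           fun p => f p *: nabla X Y p + nabla X' Y p};
  connection_additive : forall U X Y Y', open U ->
    vector_field U X -> vector_field U Y -> vector_field U Y' ->
    {in U, nabla X (fun p => Y p + Y' p) =1
           fun p => nabla X Y p + nabla X Y' p};
  connection_Leibniz : forall U f X Y, open U -> smooth_fun U f ->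
    vector_field U X -> vector_field U Y ->
    {in U, nabla X (fun p => f p *: Y p) =1
           fun p => derive_along X f p *: Y p + f p *: nabla X Y p}
}.

Definition torsion_free (nabla : vfield -> vfield -> vfield) : Prop :=
  forall U X Y, open U -> vector_field U X -> vector_field U Y ->
    {in U, forall p, nabla X Y p - nabla Y X p = bracket X Y p}.

(* Flatness is the vanishing of the curvature tensor. *)
Definition flat (nabla : vfield -> vfield -> vfield) : Prop :=
  forall U X Y Z, open U ->
    vector_field U X -> vector_field U Y -> vector_field U Z ->
    {in U, forall p, nabla X (nabla Y Z) p - nabla Y (nabla X Z) p
                       - nabla (bracket X Y) Z p = 0}.

Definition dual_connections (g : metric)
    (nabla nabla' : vfield -> vfield -> vfield) : Prop :=
  forall U X Y Z, open U ->
    vector_field U X -> vector_field U Y -> vector_field U Z ->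
    {in U, forall p, derive_along X (pairing g Y Z) p =
                       pairing g (nabla X Y) Z p + pairing g Y (nabla' X Z) p}.

Record dually_flat (g : metric) (nabla nabla' : vfield -> vfield -> vfield) :
  Prop := DuallyFlat {
  dually_flat_metric : riemannian g;
  dually_flat_connection : affine_connection nabla;
  dually_flat_connection' : affine_connection nabla';
  dually_flat_torsion : torsion_free nabla;
  dually_flat_torsion' : torsion_free nabla';
  dually_flat_flat : flat nabla;
  dually_flat_flat' : flat nabla';
  dually_flat_dual : dual_connections g nabla nabla'
}.

Definition parallel (nabla : vfield -> vfield -> vfield) (U : set M)
    (Y : vfield) : Prop :=
  forall X, vector_field U X -> {in U, forall p, nabla X Y p = 0}.

Definition affine_system (nabla : vfield -> vfield -> vfield)
    (eta : chart R n M) : Prop :=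
  coordinate_system eta /\
  forall i, parallel nabla (chart_dom eta) (coord_field eta i).

Definition mutually_dual (g : metric) (eta eta' : chart R n M) : Prop :=
  chart_dom eta = chart_dom eta' /\
  forall p, chart_dom eta p -> forall i j,
    g p (coord_field eta i p) (coord_field eta' j p) = (i == j)%:R.

Definition gram (g : metric) (eta : chart R n M) (p : M) : 'M[R]_n :=
  \matrix_(i, j) g p (coord_field eta i p) (coord_field eta j p).

Definition potential_functions (g : metric) (eta eta' : chart R n M)
    (psi psi' : 'rV[R]_n -> R) : Prop :=
  (forall p, chart_dom eta p -> gram g eta p = hessian psi (chart_map eta p)) /\
  (forall p, chart_dom eta p ->
     invmx (gram g eta p) = hessian psi' (chart_map eta' p)).

End Manifold.

(* Main.v *)
(* Around a point, a coframe parallel for the flat connection nabla solves a total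
   differential system whose integrability is the vanishing of the curvature; as
   nabla is torsion-free this coframe is closed, and its primitives are affine
   coordinates eta.  In these coordinates the derivatives of the metric satisfy
   the Codazzi equations because nabla' is torsion-free, so that two applications
   of the Poincare lemma give psi with Hess psi = (g_ij) on a ball.  The gradient
   eta' of psi is injective with an invertible differential since Hess psi is
   positive definite; as a chart it is biorthogonal to eta, and duality of the
   connections then makes it nabla'-affine.  The Legendre transform of psi is the
   dual potential, its Hessian being the inverse of that of psi.  Both Hessians are
   positive definite, so both potentials are convex with positive Hessian
   determinants, which serve as the right-hand sides. *)
From HB Require Import structures.
Require Import Defs.
From mathcomp Require Import all_boot all_order all_algebra.
From mathcomp Require Import all_classical all_reals all_analysis.
From mathcomp Require Import ring lra.

Set Implicit Arguments.
Unset Strict Implicit.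
Unset Printing Implicit Defensive.

Import Order.TTheory GRing.Theory Num.Theory.
Import numFieldNormedType.Exports.

Local Open Scope classical_set_scope.
Local Open Scope ring_scope.

(** * Differential calculus *)

(** All estimates use the sup norm of the entries: mean value arguments run entry by entry, and the
    factors [n%:R], [m%:R] come from linear combinations and matrix products. Solutions of
    differential systems and inverse maps are first controlled by a first order estimate, which
    yields the Frechet differential together with the partials; they are then smooth because these
    partials are expressed through the object itself. Working on balls serves three purposes: a
    total differential system is solved along rays from the centre; a map whose Jacobian has a
    positive quadratic form is injective on a convex set, which inverts both the affine coordinates
    and the gradient of the potential on a whole ball; and a ball is connected, as the domain of a
    Monge-Ampere equation must be. Fields, charts and functions are total with irrelevant values
    outside their domains, so most identities hold only on an open set and are transported by the
    locality of derivatives and of connections. *)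

Lemma differentiable_bigsum {R : realType} {V W : normedModType R} (I : Type)
    (r : seq I) (P : pred I) (f : I -> V -> W) x :
  (forall i, P i -> differentiable (f i) x) ->
  differentiable (fun y => \sum_(i <- r | P i) f i y) x.
Proof.
move=> df; elim: r => [|i r IHr].
  by under eq_fun do rewrite big_nil; exact: differentiable_cst.
case Pi: (P i); under eq_fun do rewrite big_cons Pi; last by [].
by apply: differentiableD => //; exact: df.
Qed.

Section Calculus.
Context {R : realType} {n : nat}.
Implicit Types (D : set 'rV[R]_n) (x h : 'rV[R]_n).

Lemma differential_partial {W : normedModType R} (f : 'rV[R]_n -> W) x h :
  differentiable f x -> 'd f x h = \sum_(i < n) h 0 i *: partial i f x.
Proof.
move=> df; rewrite [in LHS](row_sum_delta h) linear_sum; apply: eq_bigr => i _.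
by rewrite linearZ /partial deriveE.
Qed.

Lemma derive_partial {W : normedModType R} (f : 'rV[R]_n -> W) x h :
  differentiable f x -> 'D_h f x = \sum_(i < n) h 0 i *: partial i f x.
Proof. by move=> df; rewrite deriveE// differential_partial. Qed.

(** The estimate is the little-o condition for the linear map with coefficients [G], continuous in
    finite dimension; uniqueness of the differential then identifies the partials. Solutions of
    total differential systems and inverse maps get their differentiability from here. *)
Lemma differentiable_of_expansion {W : normedModType R} (f : 'rV[R]_n -> W) x
    (G : 'I_n -> W) :
  (forall e : R, 0 < e -> \forall h \near (0 : 'rV[R]_n),
     `|f (h + x) - f x - \sum_(i < n) h 0 i *: G i| <= e * `|h|) ->
  differentiable f x /\ forall i, partial i f x = G i.
Proof.
move=> H.
pose L (h : 'rV[R]_n) := \sum_(i < n) h 0 i *: G i.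
have Llin : linear L.
  move=> a u v; rewrite /L scaler_sumr -big_split; apply: eq_bigr => i _ /=.
  by rewrite !mxE scalerDl scalerA.
pose Lm := GRing.isLinear.Build R 'rV[R]_n W *:%R L Llin.
pose LL : {linear 'rV[R]_n -> W} := HB.pack L Lm.
have Lc : continuous LL.
  move=> y; apply: differentiable_continuous.
  apply: (@differentiable_bigsum R) => i _.
  by apply: (@differentiableZl _ _ _ (fun h : 'rV[R]_n => h 0 i)); exact: differentiable_coord.
have E : f \o shift x = cst (f x) + LL +o_ (0 : 'rV[R]_n) id.
  apply/eqaddoP => e e0; near=> h; rewrite /= opprD addrA.
  by near: h; exact: H.
have dE := diff_unique Lc E.
have df : differentiable f x by apply/diff_locallyP; rewrite dE.
split => // i; rewrite /partial deriveE// dE /LL /= /L (bigD1 i)//= !mxE !eqxx scale1r.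
rewrite big1 ?addr0// => j ji; rewrite mxE (negbTE ji) andbF scale0r//.
Unshelve. all: by end_near. Qed.

Lemma is_derive_line {W : normedModType R} (f : 'rV[R]_n -> W) y h t :
  differentiable f (y + t *: h) ->
  is_derive t 1 (fun s : R => f (y + s *: h))
    (\sum_(i < n) h 0 i *: partial i f (y + t *: h)).
Proof.
move=> df.
have E : (fun s : R => s^-1 *: (((fun s : R => f (y + s *: h)) \o shift t) (s *: 1)
             - f (y + t *: h))) =
         (fun s : R => s^-1 *: ((f \o shift (y + t *: h)) (s *: h) - f (y + t *: h))).
  apply/funext => s /=; congr (_ *: (f _ - _)).
  by rewrite [s *: 1]mulr1 scalerDl addrCA.
rewrite -derive_partial//; split; last by rewrite /derive E.
by rewrite /derivable E; exact: diff_derivable.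
Qed.

Lemma MVT_line (f : 'rV[R]_n -> R) y h :
  (forall t : R, 0 <= t <= 1 -> differentiable f (y + t *: h)) ->
  exists2 t : R, 0 < t < 1 &
    f (y + h) - f y = \sum_(i < n) h 0 i * partial i f (y + t *: h).
Proof.
move=> df.
have [||t] := @MVT R (fun s => f (y + s *: h))
   (fun t => \sum_(i < n) h 0 i * partial i f (y + t *: h)) 0 1 ltr01.
- move=> t /[!in_itv]/= /andP[t0 t1]; apply: is_derive_line; apply: df.
  by rewrite !ltW.
- apply: derivable_within_continuous => t /[!in_itv]/= t01.
  by have [] := is_derive_line (df t t01).
by rewrite in_itv/= scale1r scale0r addr0 subr0 mulr1; exists t.
Qed.

End Calculus.

(** * Smooth functions *)

Section SmoothFunctions.
Context {R : realType}.

Lemma partial_comp {n m} {W : normedModType R} (g : 'rV[R]_n -> 'rV[R]_m)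
    (f : 'rV[R]_m -> W) x i :
  differentiable g x -> differentiable f (g x) ->
  partial i (f \o g) x =
  \sum_(j < m) partial i (fun y => g y 0 j) x *: partial j f (g x).
Proof.
move=> dg df; rewrite {1}/partial deriveE; last exact: differentiable_comp.
rewrite diff_comp//= -(@deriveE _ _ _ g)// differential_partial// derive_mx ?mxE//; last exact: diff_derivable.
by apply: eq_bigr => j _; rewrite mxE.
Qed.

Lemma norm_mx_le {m p} (A : 'M[R]_(m, p)) (e : R) : 0 <= e ->
  (forall i j, `|A i j| <= e) -> `|A| <= e.
Proof.
move=> e0 Ae; rewrite [leLHS]/Num.Def.normr/= mx_normrE.
by apply: bigmax_le => // -[i j] _; exact: Ae.
Qed.

Lemma norm_mx_entry {m p} (A : 'M[R]_(m, p)) i j : `|A i j| <= `|A|.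
Proof.
rewrite [leRHS]/Num.Def.normr/= mx_normrE.
exact: (le_bigmax _ (fun ij => `|A ij.1 ij.2|) (i, j)).
Qed.

Lemma norm_delta_mx {m p} (i : 'I_m) (j : 'I_p) :
  `|delta_mx i j : 'M[R]_(m, p)| <= 1.
Proof.
by apply: norm_mx_le => // k l; rewrite mxE; case: (_ && _); rewrite ?normr1 ?normr0.
Qed.

Lemma norm_mulmx {m p q} (A : 'M[R]_(m, p)) (B : 'M[R]_(p, q)) :
  `|A *m B| <= p%:R * (`|A| * `|B|).
Proof.
apply: norm_mx_le => [|i j]; first by rewrite !mulr_ge0.
rewrite mxE (le_trans (ler_norm_sum _ _ _))//.
rewrite -[p in p%:R]card_ord mulr_natl -sumr_const ler_sum// => k _.
by rewrite normrM ler_pM// norm_mx_entry.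
Qed.

Lemma partial_shift {n} {W : normedModType R} (f : 'rV[R]_n -> W) i (v x : 'rV[R]_n) :
  partial i (fun y => f (y + v)) x = partial i f (x + v).
Proof.
rewrite /partial /derive; set F := fun h : R => _; set F' := fun h : R => _.
by rewrite (_ : F = F')//; apply/funext => h; rewrite /F /F' /= addrA.
Qed.

Lemma differentiable_shift {n} {W : normedModType R} (f : 'rV[R]_n -> W) (v x : 'rV[R]_n) :
  differentiable f (x + v) -> differentiable (fun y => f (y + v)) x.
Proof. by move=> df; apply: (differentiable_comp (f := fun y => y + v)). Qed.

Lemma sum_delta_mx {n} {W : lmodType R} (F : 'I_n -> W) (s : R) i :
  \sum_(k < n) (s *: delta_mx 0 i : 'rV[R]_n) 0 k *: F k = s *: F i.
Proof.
rewrite (bigD1 i)//= !mxE !eqxx mulr1 big1 ?addr0// => k ki.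
by rewrite !mxE (negbTE ki) andbF mulr0 scale0r.
Qed.

Let second_difference (a b c d u v s e : R) :
  `|a - b - c + d - s * u| <= s * (e / 2) ->
  `|a - c - b + d - s * v| <= s * (e / 2) -> `|s * (v - u)| <= s * e.
Proof. by rewrite !ler_norml; lra. Qed.

Let second_difference' (a b c d p q s e : R) :
  a - b - (c - d) = s *: (s *: q) -> `|p - q| <= e ->
  `|a - b - c + d - s ^+ 2 * p| <= s ^+ 2 * e.
Proof.
move=> E pq; rewrite (_ : _ - _ = s ^+ 2 * (q - p)).
  by rewrite normrM ger0_norm ?sqr_ge0// distrC ler_wpM2l ?sqr_ge0.
have {}E : a - b - (c - d) = s * (s * q) := E.
by rewrite mulrBr expr2 -!mulrA -E; ring.
Qed.

Lemma partialD {n} {W : normedModType R} (f g : 'rV[R]_n -> W) i x :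
  differentiable f x -> differentiable g x ->
  partial i (fun y => f y + g y) x = partial i f x + partial i g x.
Proof. by move=> df dg; rewrite /partial deriveD//; exact: diff_derivable. Qed.

Lemma partialB {n} {W : normedModType R} (f g : 'rV[R]_n -> W) i x :
  differentiable f x -> differentiable g x ->
  partial i (fun y => f y - g y) x = partial i f x - partial i g x.
Proof. by move=> df dg; rewrite /partial deriveB//; exact: diff_derivable. Qed.

Lemma partialM {n} (f g : 'rV[R]_n -> R) i x :
  differentiable f x -> differentiable g x ->
  partial i (fun y => f y * g y) x = f x * partial i g x + g x * partial i f x.
Proof. by move=> df dg; rewrite /partial deriveM//; exact: diff_derivable. Qed.

Lemma partial_sum {n} {W : normedModType R} (I : Type) (r : seq I) (P : pred I)
    (f : I -> 'rV[R]_n -> W) i x :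
  (forall k, P k -> differentiable (f k) x) ->
  partial i (fun y => \sum_(k <- r | P k) f k y) x =
  \sum_(k <- r | P k) partial i (f k) x.
Proof.
move=> df; elim: r => [|k r IHr].
  by under eq_fun do rewrite big_nil; rewrite big_nil /partial derive_cst.
rewrite big_cons -IHr; case Pk: (P k); under eq_fun do rewrite big_cons Pk; last by [].
by rewrite partialD//; [exact: df|exact: differentiable_bigsum].
Qed.

Lemma near_eq_partial {n} {W : normedModType R} (f g : 'rV[R]_n -> W) i x :
  (\near x, f x = g x) -> partial i f x = partial i g x.
Proof. exact: near_eq_derive. Qed.

Lemma near_eq_differentiable {n} {W : normedModType R} (f g : 'rV[R]_n -> W) (x : 'rV[R]_n) :
  (\near x, f x = g x) -> differentiable f x -> differentiable g x.
Proof.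
move=> fg df; have gx : f x = g x by exact: nbhs_singleton fg.
suff [] : differentiable g x /\ forall i, partial i g x = partial i f x by [].
apply: differentiable_of_expansion => e e0.
have [_ E] := (diff_locallyP _ _).1 df.
have /eqaddoP := E => /(_ e e0) H.
have : \forall h \near (0 : 'rV[R]_n), f (h + x) = g (h + x).
  have /nbhs_ballP[r /= r0 rfg] := fg.
  apply/nbhs_ballP; exists r => //= h hr; apply: rfg; move: hr.
  by rewrite -!ball_normE /ball_/= sub0r opprD addrCA subrr addr0.
apply: filterS2 H => h /= Hh fgh.
rewrite -fgh -gx -differential_partial//.
by move: Hh; rewrite opprD addrA.
Qed.

(* Schwarz' theorem, from the two mean value expansions of a second difference. *)
Lemma partialC {n} (D : set 'rV[R]_n) (f : 'rV[R]_n -> R) i j (x : 'rV[R]_n) :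
  open D -> (forall y, D y -> differentiable f y) ->
  (forall k y, D y -> differentiable (partial k f) y) ->
  (forall k l, differentiable (partial k (partial l f)) x) -> D x ->
  partial i (partial j f) x = partial j (partial i f) x.
Proof.
move=> oD df ddf dddf Dx.
(* The second difference is symmetric in [k] and [l], so this one approximation, used in both
   orders, puts the two mixed partials within any [e] of each other. *)
suff H (k l : 'I_n) (e : R) : 0 < e -> exists2 d : R, 0 < d & forall s, 0 < s < d ->
    `|f (x + s *: delta_mx 0 k + s *: delta_mx 0 l) - f (x + s *: delta_mx 0 k)
      - f (x + s *: delta_mx 0 l) + f x - s ^+ 2 * partial l (partial k f) x|
    <= s ^+ 2 * e.
  apply/eqP; rewrite -subr_eq0 -normr_eq0 eq_le normr_ge0 andbT.
  apply/ler_addgt0Pl => e e0; rewrite addr0.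
  have e2 : 0 < e / 2 by rewrite divr_gt0.
  have [d1 d10 H1] := H i j _ e2; have [d2 d20 H2] := H j i _ e2.
  have d0 : 0 < Num.min d1 d2 by rewrite lt_min d10.
  pose s := Num.min d1 d2 / 2.
  have s0 : 0 < s by rewrite divr_gt0.
  have : s < Num.min d1 d2 by rewrite ltr_pdivrMr// ltr_pMr// ltr1n.
  rewrite lt_min => /andP[sd1 sd2].
  have {}H1 := H1 s (introT andP (conj s0 sd1)).
  have {}H2 := H2 s (introT andP (conj s0 sd2)).
  have s2 : 0 < s ^+ 2 by rewrite exprn_gt0.
  rewrite -(ler_pM2l s2) -[X in X * `|_|]gtr0_norm// -normrM.
  rewrite [X in f X](addrAC x) in H2.
  exact: second_difference H1 H2.
move=> e0.
have /nbhs_ballP[r /= r0 rD] : \forall y \near x, D y /\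
    `|partial l (partial k f) x - partial l (partial k f) y| <= e.
  near=> y; split; near: y; first exact: open_nbhs_nbhs.
  have cij := differentiable_continuous (dddf l k).
  exact: (cvgr_dist_le _ _ cij).
(* With half the radius, the far corner of the square of side [s] stays in the ball of radius
   [r]. *)
exists (r / 2) => [|s /andP[s0 sr2]]; first by rewrite divr_gt0.
have sr : s + s < r by rewrite (splitr r) ltrD.
have inD (a b : R) : 0 <= a <= s -> 0 <= b <= s ->
   D (x + a *: delta_mx 0 k + b *: delta_mx 0 l) /\
   `|partial l (partial k f) x
      - partial l (partial k f) (x + a *: delta_mx 0 k + b *: delta_mx 0 l)| <= e.
  move=> /andP[a0 as_] /andP[b0 bs]; apply: rD.
  rewrite -ball_normE /ball_/= opprD addrA opprD addrA subrr sub0r.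
  apply: le_lt_trans sr; rewrite -opprD normrN (le_trans (ler_normD _ _))//.
  rewrite !normrZ !ger0_norm// lerD//.
    by rewrite (le_trans _ as_)// ler_piMr// norm_delta_mx.
  by rewrite (le_trans _ bs)// ler_piMr// norm_delta_mx.
have s01 (t : R) : 0 <= t <= 1 -> 0 <= t * s <= s.
  by move=> /andP[t0 t1]; rewrite mulr_ge0// ?ler_piMl// ltW.
(* The second difference is the increment of [G] along direction [k]: a mean value step gives
   [partial k G], itself an increment of [partial k f] along [l], to which a second mean value step
   applies. *)
pose G y := f (y + s *: delta_mx 0 l) - f y.
have [t t01|t t01] := @MVT_line _ _ G x (s *: delta_mx 0 k).
  rewrite scalerA; apply: differentiableB; first apply: differentiable_shift; apply: df.
    by apply: (inD _ _ _ _).1; [exact: s01 | rewrite lexx ltW].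
  rewrite -[X in D X]addr0 -(scale0r (delta_mx 0 l)).
  by apply: (inD _ _ _ _).1; [exact: s01|rewrite lexx ltW].
have t01' : 0 <= t <= 1 by case/andP: t01 => ? ?; rewrite !ltW.
rewrite (sum_delta_mx (fun k => partial k G _)) => EG.
have dG : partial k G (x + t *: (s *: delta_mx 0 k)) =
   partial k f (x + (t * s) *: delta_mx 0 k + s *: delta_mx 0 l)
    - partial k f (x + (t * s) *: delta_mx 0 k).
  rewrite scalerA partialB.
  - by rewrite partial_shift.
  - apply: differentiable_shift; apply: df.
    by apply: (inD _ _ _ _).1; [exact: s01 | rewrite lexx ltW].
  - apply: df.
    rewrite -[X in D X]addr0 -(scale0r (delta_mx 0 l)).
    by apply: (inD _ _ _ _).1; [exact: s01|rewrite lexx ltW].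
have [u u01|u u01] := @MVT_line _ _ (partial k f) (x + (t * s) *: delta_mx 0 k)
   (s *: delta_mx 0 l).
  by rewrite scalerA; apply: ddf; apply: (inD _ _ _ _).1; exact: s01.
rewrite (sum_delta_mx (fun l => partial l (partial k f) _)) scalerA => Ek.
have u01' : 0 <= u <= 1 by case/andP: u01 => ? ?; rewrite !ltW.
have := (inD _ _ (s01 t t01') (s01 u u01')).2.
move: EG; rewrite dG Ek /G => {}EG Hle.
exact: second_difference' EG Hle.
Unshelve. all: by end_near. Qed.

(** [Ck 0] already asks for differentiability, so [Ck k] makes all iterated partials of order at
    most [k] differentiable. The recursion peels off the derivative taken first, which is the last
    entry of the list in [smooth_on]. Induction on [k] suits products, composites and inverses,
    whose derivatives involve the functions themselves. *)
Fixpoint Ck {n} {W : normedModType R} (k : nat) (D : set 'rV[R]_n)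
    (f : 'rV[R]_n -> W) : Prop :=
  if k is k'.+1 then
    (forall x, D x -> differentiable f x) /\ forall i, Ck k' D (partial i f)
  else forall x, D x -> differentiable f x.

Lemma CkP {n} {W : normedModType R} (D : set 'rV[R]_n) (f : 'rV[R]_n -> W) :
  smooth_on D f <-> forall k, Ck k D f.
Proof.
split=> [sf k|Cf s].
  elim: k f sf => [|k IHk] f sf /=; first exact: (sf [::]).
  split=> [|i]; first exact: (sf [::]).
  by apply: IHk => s x Dx; have := sf (rcons s i) x Dx; rewrite foldr_rcons.
elim/last_ind: s f Cf => [|s i IHs] f Cf x Dx; first exact: (Cf 0).
by rewrite foldr_rcons; apply: IHs => // k; exact: (Cf k.+1).2.
Qed.

Lemma smooth_differentiable {n} {W : normedModType R} (D : set 'rV[R]_n)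
    (f : 'rV[R]_n -> W) x :
  smooth_on D f -> D x -> differentiable f x.
Proof. by move=> /(_ [::] x). Qed.

Lemma smooth_partial {n} {W : normedModType R} (D : set 'rV[R]_n)
    (f : 'rV[R]_n -> W) i :
  smooth_on D f -> smooth_on D (partial i f).
Proof. by move=> sf s x Dx; have := sf (rcons s i) x Dx; rewrite foldr_rcons. Qed.

Lemma smooth_sub {n} {W : normedModType R} (D D' : set 'rV[R]_n)
    (f : 'rV[R]_n -> W) : D' `<=` D -> smooth_on D f -> smooth_on D' f.
Proof. by move=> DD' sf s x /DD'; exact: sf. Qed.

Lemma near_open {n} {W : Type} (D : set 'rV[R]_n) (f g : 'rV[R]_n -> W) (x : 'rV[R]_n) :
  open D -> {in D, f =1 g} -> D x -> \near x, f x = g x.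
Proof.
move=> oD fg Dx; near=> y; apply: fg; rewrite inE.
by near: y; exact: open_nbhs_nbhs.
Unshelve. all: by end_near. Qed.

Lemma Ck_ext {n} {W : normedModType R} k (D : set 'rV[R]_n)
    (f g : 'rV[R]_n -> W) : open D -> {in D, f =1 g} -> Ck k D f -> Ck k D g.
Proof.
move=> oD; elim: k f g => [|k IHk] f g fg /=.
  by move=> df x Dx; apply: near_eq_differentiable (df x Dx); exact: (near_open oD).
move=> [df Cf]; split=> [x Dx|i].
  by apply: near_eq_differentiable (df x Dx); exact: (near_open oD).
apply: (IHk (partial i f)) => // x /[!inE] Dx.
by apply: near_eq_partial; exact: (near_open oD).
Qed.

Lemma smooth_ext {n} {W : normedModType R} (D : set 'rV[R]_n)
    (f g : 'rV[R]_n -> W) :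
  open D -> {in D, f =1 g} -> smooth_on D f -> smooth_on D g.
Proof. by move=> oD fg /CkP Cf; apply/CkP => k; exact: Ck_ext (Cf k). Qed.

(** [smooth_on] is tested at each point separately, on the germ of a total function, so [D'] need
    not be a neighbourhood of [x]. *)
Lemma smooth_local {n} {W : normedModType R} (D : set 'rV[R]_n)
    (f : 'rV[R]_n -> W) :
  (forall x, D x -> exists2 D', D' x & smooth_on D' f) -> smooth_on D f.
Proof. by move=> H s x /H[D' D'x]; apply. Qed.

Lemma Ck_cst {n} {W : normedModType R} k (D : set 'rV[R]_n) (c : W) :
  Ck k D (cst c).
Proof.
elim: k c => [|k IHk] c /=; first by move=> *; exact: differentiable_cst.
split=> [x _|i]; first exact: differentiable_cst.
rewrite (_ : partial i (cst c) = cst 0)//.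
by apply/funext => x; rewrite /partial derive_cst.
Qed.

Lemma CkD {n} {W : normedModType R} k (D : set 'rV[R]_n)
    (f g : 'rV[R]_n -> W) :
  open D -> Ck k D f -> Ck k D g -> Ck k D (fun x => f x + g x).
Proof.
move=> oD; elim: k f g => [|k IHk] f g /=.
  by move=> df dg x Dx; apply: differentiableD; [exact: df|exact: dg].
move=> [df Cf] [dg Cg]; split=> [x Dx|i].
  by apply: differentiableD; [exact: df|exact: dg].
apply: Ck_ext (IHk _ _ (Cf i) (Cg i)) => // x /[!inE] Dx.
by rewrite partialD//; [exact: df|exact: dg].
Qed.

Lemma Ck_sum {n} {W : normedModType R} k (D : set 'rV[R]_n) (I : Type)
    (r : seq I) (P : pred I) (f : I -> 'rV[R]_n -> W) :
  open D -> (forall i, P i -> Ck k D (f i)) ->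
  Ck k D (fun x => \sum_(i <- r | P i) f i x).
Proof.
move=> oD Cf; elim: r => [|i r IHr].
  by under eq_fun do rewrite big_nil; exact: Ck_cst.
case Pi: (P i); under eq_fun do rewrite big_cons Pi; last by [].
by apply: CkD => //; exact: Cf.
Qed.

Lemma CkS {n} {W : normedModType R} k (D : set 'rV[R]_n) (f : 'rV[R]_n -> W) :
  Ck k.+1 D f -> Ck k D f.
Proof.
elim: k f => [|k IHk] f [df pf] //=; split=> // i.
by apply: IHk; exact: pf.
Qed.

Lemma CkM {n} k (D : set 'rV[R]_n) (f g : 'rV[R]_n -> R) :
  open D -> Ck k D f -> Ck k D g -> Ck k D (fun x => f x * g x).
Proof.
move=> oD; elim: k f g => [|k IHk] f g.
  by move=> df dg x Dx; apply: differentiableM; [exact: df|exact: dg].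
move=> Cf Cg; have [df pf] := Cf; have [dg pg] := Cg; split=> [x Dx|i].
  by apply: differentiableM; [exact: df|exact: dg].
apply: Ck_ext (CkD oD (IHk _ _ (CkS Cf) (pg i)) (IHk _ _ (CkS Cg) (pf i))) => //.
by move=> x /[!inE] Dx; rewrite partialM//; [exact: df|exact: dg].
Qed.

Lemma CkV {n} k (D : set 'rV[R]_n) (f : 'rV[R]_n -> R) :
  open D -> (forall x, D x -> f x != 0) -> Ck k D f ->
  Ck k D (fun x => (f x)^-1).
Proof.
move=> oD f0; elim: k => [|k IHk].
  by move=> df x Dx; apply: differentiableV; [exact: df|exact: f0].
move=> Cf; have [df pf] := Cf; split=> [x Dx|i].
  by apply: differentiableV; [exact: df|exact: f0].
have Cfk := IHk (CkS Cf).
suff : Ck k D (fun x => -1 * ((f x)^-1 * (f x)^-1 * partial i f x)).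
  apply: Ck_ext => // x /[!inE] Dx; rewrite {2}/partial deriveV ?f0//=; last first.
    by apply: diff_derivable; exact: df.
  by rewrite /GRing.scale/= mulN1r mulNr -exprVn expr2.
by apply: CkM => //; [exact: Ck_cst|apply: CkM => //; [exact: CkM|exact: pf]].
Qed.

Lemma Ck_prod {n} k (D : set 'rV[R]_n) (I : Type) (r : seq I)
    (f : I -> 'rV[R]_n -> R) :
  open D -> (forall i, Ck k D (f i)) -> Ck k D (fun x => \prod_(i <- r) f i x).
Proof.
move=> oD Cf; elim: r => [|i r IHr].
  by under eq_fun do rewrite big_nil; exact: Ck_cst.
by under eq_fun do rewrite big_cons; exact: CkM.
Qed.

Lemma differentiable_entry {V : normedModType R} {m p} (f : V -> 'M[R]_(m, p)) x i j :
  differentiable f x -> differentiable (fun y => f y i j) x.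
Proof.
move=> df.
exact: (differentiable_comp df (differentiable_coord (f x) i j)).
Qed.

Lemma differentiable_mx {V : normedModType R} {m p} (f : V -> 'M[R]_(m, p)) x :
  (forall i j, differentiable (fun y => f y i j) x) -> differentiable f x.
Proof.
move=> df.
have -> : f = fun y => \sum_(i < m) \sum_(j < p) f y i j *: delta_mx i j.
  by apply/funext => y; exact: matrix_sum_delta.
apply: (@differentiable_bigsum R) => i _; apply: (@differentiable_bigsum R) => j _.
by apply: (@differentiableZl _ _ _ (fun y => f y i j)); exact: df.
Qed.

Lemma partial_entry {n m p} (f : 'rV[R]_n -> 'M[R]_(m, p)) x k i j :
  differentiable f x -> partial k (fun y => f y i j) x = partial k f x i j.
Proof.
by move=> df; rewrite /partial derive_mx ?mxE//; exact: diff_derivable.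
Qed.

Lemma Ck_entry {n m p} k (D : set 'rV[R]_n) (f : 'rV[R]_n -> 'M[R]_(m, p)) i j :
  open D -> Ck k D f -> Ck k D (fun x => f x i j).
Proof.
move=> oD; elim: k f => [|k IHk] f.
  by move=> df x Dx; apply: differentiable_entry; exact: df.
move=> [df pf]; split=> [x Dx|l]; first by apply: differentiable_entry; exact: df.
apply: Ck_ext (IHk _ (pf l)) => // x /[!inE] Dx.
by rewrite partial_entry//; exact: df.
Qed.

Lemma Ck_mx {n m p} k (D : set 'rV[R]_n) (f : 'rV[R]_n -> 'M[R]_(m, p)) :
  open D -> (forall i j, Ck k D (fun x => f x i j)) -> Ck k D f.
Proof.
move=> oD; elim: k f => [|k IHk] f Cf.
  by move=> x Dx; apply: differentiable_mx => i j; exact: Cf.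
have df x : D x -> differentiable f x.
  by move=> Dx; apply: differentiable_mx => i j; have [+ _] := Cf i j; exact.
split=> // l; apply: IHk => i j.
have [_ /(_ l)] := Cf i j; apply: Ck_ext => // x /[!inE] Dx.
by rewrite partial_entry//; exact: df.
Qed.

Lemma Ck_comp {n m} k (D : set 'rV[R]_n) (E : set 'rV[R]_m)
    (g : 'rV[R]_n -> 'rV[R]_m) (f : 'rV[R]_m -> R) :
  open D -> (forall x, D x -> E (g x)) -> Ck k D g -> Ck k E f ->
  Ck k D (f \o g).
Proof.
move=> oD gE; elim: k f g gE => [|k IHk] f g gE.
  by move=> dg df x Dx; apply: differentiable_comp; [exact: dg|apply: df; exact: gE].
move=> Cg Cf; have [dg pg] := Cg; have [df pf] := Cf; split=> [x Dx|i].
  by apply: differentiable_comp; [exact: dg|apply: df; exact: gE].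
suff : Ck k D (fun x => \sum_(j < m) partial i (fun y => g y 0 j) x *
                          (partial j f \o g) x).
  apply: Ck_ext => // x /[!inE] Dx; rewrite partial_comp//; first exact: dg.
  by apply: df; exact: gE.
apply: Ck_sum => // j _; apply: CkM => //.
  by have [_ +] := Ck_entry 0 j oD Cg; exact.
by apply: IHk gE (CkS Cg) (pf j).
Qed.

Lemma partial_coord {n} i j (x : 'rV[R]_n) :
  partial i (fun y : 'rV[R]_n => y 0 j) x = (i == j)%:R.
Proof.
by rewrite partial_entry// /partial derive_id mxE eqxx eq_sym.
Qed.

Lemma smooth_cst {n} {W : normedModType R} (D : set 'rV[R]_n) (c : W) :
  smooth_on D (cst c).
Proof. by apply/CkP => k; exact: Ck_cst. Qed.

Lemma smooth_id {n} (D : set 'rV[R]_n) : smooth_on D id.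
Proof.
apply/CkP => -[|k] /=; first by [].
split=> [//|i].
rewrite (_ : partial i id = cst (delta_mx 0 i)); first exact: Ck_cst.
by apply/funext => x; rewrite /partial derive_id.
Qed.

Lemma smooth_entry {n m p} (D : set 'rV[R]_n) (f : 'rV[R]_n -> 'M[R]_(m, p)) i j :
  open D -> smooth_on D f -> smooth_on D (fun x => f x i j).
Proof. by move=> oD /CkP Cf; apply/CkP => k; exact: Ck_entry. Qed.

Lemma smooth_mx {n m p} (D : set 'rV[R]_n) (f : 'rV[R]_n -> 'M[R]_(m, p)) :
  open D -> (forall i j, smooth_on D (fun x => f x i j)) -> smooth_on D f.
Proof.
move=> oD Cf; apply/CkP => k; apply: Ck_mx => // i j.
by have /CkP := Cf i j; exact.
Qed.

Lemma smoothD {n} {W : normedModType R} (D : set 'rV[R]_n)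
    (f g : 'rV[R]_n -> W) :
  open D -> smooth_on D f -> smooth_on D g -> smooth_on D (fun x => f x + g x).
Proof. by move=> oD /CkP Cf /CkP Cg; apply/CkP => k; exact: CkD. Qed.

Lemma smoothM {n} (D : set 'rV[R]_n) (f g : 'rV[R]_n -> R) :
  open D -> smooth_on D f -> smooth_on D g -> smooth_on D (fun x => f x * g x).
Proof. by move=> oD /CkP Cf /CkP Cg; apply/CkP => k; exact: CkM. Qed.

Lemma smoothB {n} (D : set 'rV[R]_n) (f g : 'rV[R]_n -> R) :
  open D -> smooth_on D f -> smooth_on D g -> smooth_on D (fun x => f x - g x).
Proof.
move=> oD sf sg; under eq_fun do rewrite -mulN1r.
by apply: smoothD => //; apply: smoothM => //; exact: smooth_cst.
Qed.

Lemma smooth_sum {n} {W : normedModType R} (D : set 'rV[R]_n) (I : Type)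
    (r : seq I) (P : pred I) (f : I -> 'rV[R]_n -> W) :
  open D -> (forall i, P i -> smooth_on D (f i)) ->
  smooth_on D (fun x => \sum_(i <- r | P i) f i x).
Proof.
move=> oD sf; apply/CkP => k; apply: Ck_sum => // i /sf sfi.
by move: k; apply/CkP.
Qed.

Lemma smooth_comp {n m} (D : set 'rV[R]_n) (E : set 'rV[R]_m)
    (g : 'rV[R]_n -> 'rV[R]_m) (f : 'rV[R]_m -> R) :
  open D -> (forall x, D x -> E (g x)) -> smooth_on D g -> smooth_on E f ->
  smooth_on D (f \o g).
Proof.
by move=> oD gE /CkP Cg /CkP Cf; apply/CkP => k; exact: Ck_comp (Cg k) (Cf k).
Qed.

Lemma smooth_det {n m} (D : set 'rV[R]_n) (A : 'rV[R]_n -> 'M[R]_m) :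
  open D -> (forall i j, smooth_on D (fun x => A x i j)) ->
  smooth_on D (fun x => \det (A x)).
Proof.
move=> oD sA; rewrite /determinant; apply: smooth_sum => // s _.
apply: smoothM => //; first exact: smooth_cst.
apply/CkP => k; apply: Ck_prod => // i.
by move: k; apply/CkP; exact: sA.
Qed.

(** Cramer's rule writes the entries of the inverse as cofactors divided by the determinant. *)
Lemma smooth_invmx {n m} (D : set 'rV[R]_n) (A : 'rV[R]_n -> 'M[R]_m) :
  open D -> (forall x, D x -> A x \in unitmx) ->
  (forall i j, smooth_on D (fun x => A x i j)) ->
  forall i j, smooth_on D (fun x => invmx (A x) i j).
Proof.
move=> oD uA sA i j.
suff : smooth_on D (fun x => (\det (A x))^-1 * cofactor (A x) j i).
  by apply: smooth_ext => // x /[!inE] Dx; rewrite /invmx uA// !mxE.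
apply: smoothM => //.
  apply/CkP => k; apply: CkV => //; last by have /CkP := smooth_det oD sA; exact.
  by move=> x Dx; rewrite -unitfE -unitmxE uA.
apply: smoothM => //; first exact: smooth_cst.
by apply: smooth_det => // k l; under eq_fun do rewrite !mxE; exact: sA.
Qed.

End SmoothFunctions.

(** * Linear differential equations *)

Section LinearODE.
Context {R : realType}.

(** The retraction of the line onto [0, 1]. Composing with it extends data on [0, 1] to continuous
    functions on the line and makes bounds on [0, 1] valid for all times. *)
Definition clamp (t : R) : R := Num.max 0 (Num.min t 1).

Lemma cvg_mx {T : Type} (F : set_system T) {FF : Filter F} {m p}
    (f : T -> 'M[R]_(m, p)) (l : 'M[R]_(m, p)) :
  (forall i j, (fun x => f x i j) @ F --> l i j) -> f @ F --> l.
Proof.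
move=> H; apply/cvgrPdist_le => /= e e0; near=> x.
apply: norm_mx_le => [|i j]; first exact: ltW.
rewrite !mxE; move: i j; near: x.
apply: filter_forall => i; apply: filter_forall => j.
exact: (cvgr_dist_le _ _ (H i j)).
Unshelve. all: by end_near. Qed.

Lemma continuous_entry {T : topologicalType} {m p} (f : T -> 'M[R]_(m, p)) i j (x : T) :
  {for x, continuous f} -> {for x, continuous (fun y => f y i j)}.
Proof.
move=> cf; apply: (@continuous_comp _ _ _ f (fun A : 'M[R]_(m, p) => A i j)) => //.
exact: coord_continuous.
Qed.

Lemma continuous_mulmx {T : topologicalType} {m p q} (f : T -> 'M[R]_(m, p))
    (g : T -> 'M[R]_(p, q)) (x : T) :
  {for x, continuous f} -> {for x, continuous g} ->
  {for x, continuous (fun y => f y *m g y)}.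
Proof.
move=> cf cg; apply: cvg_mx => i j; rewrite mxE.
under eq_fun do rewrite mxE.
apply: cvg_big => [|k _]; first exact: add_continuous.
apply: cvgM.
  exact: (continuous_entry (i := i) (j := k) cf).
exact: (continuous_entry (i := k) (j := j) cg).
Qed.

Lemma is_derive_mx {m p} (u : R -> 'M[R]_(m, p)) (t : R) (v : 'M[R]_(m, p)) :
  is_derive t 1 u v <-> forall i j, is_derive t 1 (fun s => u s i j) (v i j).
Proof.
split=> [[du <-] i j|H].
  by split; [exact: (derivable_mxP u t 1).1|rewrite derive_mx// mxE].
have du : derivable u t 1 by apply/derivable_mxP => i j; have [] := H i j.
split=> //; rewrite derive_mx//; apply/matrixP => i j; rewrite mxE.
by have [_ ->] := H i j.
Qed.

Lemma is_derive_mulmx {m p q} (f : R -> 'M[R]_(m, p)) (g : R -> 'M[R]_(p, q))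
    (t : R) df dg :
  is_derive t 1 f df -> is_derive t 1 g dg ->
  is_derive t 1 (fun s => f s *m g s) (df *m g t + f t *m dg).
Proof.
move=> /is_derive_mx Hf /is_derive_mx Hg; apply/is_derive_mx => i j.
under eq_fun do rewrite mxE; rewrite !mxE -big_split/=.
have H k : is_derive t 1 (fun s => f s i k * g s k j) (df i k * g t k j + f t i k * dg k j).
  have := Hf i k; have := Hg k j => Hgk Hfk.
  by apply: is_derive_eq; rewrite /GRing.scale/= addrC mulrC.
rewrite -(@fct_sumE _ _ _ _ _ (fun k s => f s i k * g s k j)).
exact: is_derive_sum.
Qed.

(** The scalar mean value theorem is applied to each entry; in the sup norm this costs no
    constant. *)
Lemma mean_value_bound01 {m p} (F dF : R -> 'M[R]_(m, p)) (C : R) :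
  (forall t : R, 0 <= t <= 1 -> {for t, continuous F}) -> F 0 = 0 -> 0 <= C ->
  (forall t : R, 0 < t < 1 -> is_derive t 1 F (dF t)) ->
  (forall t : R, 0 < t < 1 -> `|dF t| <= C) ->
  forall t : R, 0 <= t <= 1 -> `|F t| <= C.
Proof.
move=> cF F0 C0 HF dFC t /andP[t0 t1]; apply: norm_mx_le => // i j.
move: t0; rewrite le_eqVlt => /predU1P[<-|t0]; first by rewrite F0 mxE normr0.
have [||s] := @MVT R (fun s => F s i j) (fun s => dF s i j) 0 t t0.
- move=> s /[!in_itv]/= /andP[s0 st].
  by apply: (is_derive_mx _ _ _).1; apply: HF; rewrite s0 (lt_le_trans st).
- apply: continuous_in_subspaceT => s; rewrite inE/= in_itv/= => /andP[s0 st].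
  by apply: (continuous_entry (i := i) (j := j)); apply: cF; rewrite s0 (le_trans st).
rewrite in_itv/= => /andP[s0 st] E.
have s01 : 0 < s < 1 by rewrite s0 (lt_le_trans st).
move: E; rewrite F0 mxE !subr0 => ->; rewrite normrM.
rewrite -[leRHS]mulr1 ler_pM//; first exact: le_trans (norm_mx_entry _ i j) (dFC s s01).
by rewrite ger0_norm// ltW.
Qed.

Lemma clamp_ge0 t : 0 <= clamp t.
Proof. by rewrite /clamp le_max lexx. Qed.

Lemma clamp_le1 t : clamp t <= 1.
Proof. by rewrite /clamp ge_max ler01/= ge_min lexx orbT. Qed.

Lemma clamp_id t : 0 <= t <= 1 -> clamp t = t.
Proof. by move=> /andP[t0 t1]; rewrite /clamp min_l// max_r. Qed.

Lemma clamp_continuous : continuous clamp.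
Proof.
apply: (@max_fun_continuous _ _ R (cst 0)); first exact: cst_continuous.
by apply: (@min_fun_continuous _ _ R id (cst 1)); [move=> t; exact: cvg_id|exact: cst_continuous].
Qed.

Lemma scalar_primitive (f : R -> R) : continuous f ->
  exists F : R -> R, [/\ F 0 = 0, continuous F, forall t, F (clamp t) = F t
    & forall t : R, 0 < t < 1 -> is_derive t 1 F (f t)].
Proof.
move=> cf.
(* Integrating from -1, with 2 as right end below, puts all of [0, 1] in the interior, so [G] has
   two-sided derivatives also at 0 and 1. *)
pose G (x : R) : R := (\int[lebesgue_measure]_(t in `[-1, x]) f t)%R.
have dG (x : R) : 0 <= x <= 1 -> is_derive x 1 G (f x).
  move=> /andP[x0 x1].
  have [||||dGx Gx] := @continuous_FTC1_closed R f (-1) x 2.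
  - by rewrite (le_lt_trans x1)// ltr1n.
  - apply: continuous_compact_integrable; first exact: segment_compact.
    exact: continuous_subspaceT.
  - by rewrite (lt_le_trans _ x0)// ltrN10.
  - exact: cf.
  apply: DeriveDef; first exact: dGx.
  by rewrite -derive1E; exact: Gx.
exists (fun t => G (clamp t) - G 0); split.
- by rewrite clamp_id ?subrr// lexx ler01.
- move=> t; apply: cvgB; last exact: cvg_cst.
  apply: (@continuous_comp _ _ _ clamp G); first exact: clamp_continuous.
  apply: differentiable_continuous; apply/derivable1_diffP.
  by have [] := dG (clamp t); rewrite ?clamp_ge0 ?clamp_le1.
- by move=> t; rewrite (clamp_id (t := clamp t)) ?clamp_ge0 ?clamp_le1.
move=> t t01.
have dGt : is_derive t 1 G (f t) by apply: dG; case/andP: t01 => ? ?; rewrite !ltW.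
have : is_derive t 1 (fun s => G s - G 0) (f t).
  by apply: is_derive_eq; rewrite subr0.
apply: near_eq_is_derive.
have : \forall s \near t, s \in `]0, 1[.
  by apply: near_in_itvoo; rewrite in_itv.
apply: filterS => s; rewrite in_itv/= => /andP[s0 s1].
by rewrite clamp_id// !ltW.
Qed.

Lemma primitive01 {m p} (f : R -> 'M[R]_(m, p)) : continuous f ->
  exists F : R -> 'M[R]_(m, p),
    [/\ F 0 = 0, continuous F, forall t, F (clamp t) = F t
    & forall t : R, 0 < t < 1 -> is_derive t 1 F (f t)].
Proof.
move=> cf.
have H i j : exists F : R -> R, [/\ F 0 = 0, continuous F, forall t, F (clamp t) = F t
    & forall t : R, 0 < t < 1 -> is_derive t 1 F (f t i j)].
  apply: scalar_primitive => t.
  exact: (continuous_entry (i := i) (j := j) (cf t)).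
have {}H := fun ij => H ij.1 ij.2.
have [F HF] := choice H.
exists (fun t => \matrix_(i, j) F (i, j) t); split.
- by apply/matrixP => i j; rewrite !mxE; have [] := HF (i, j).
- move=> t; apply: cvg_mx => i j; rewrite mxE; under eq_fun do rewrite mxE.
  by have [_ + _ _] := HF (i, j); exact.
- by move=> t; apply/matrixP => i j; rewrite !mxE; have [_ _ + _] := HF (i, j); exact.
- move=> t t01; apply/is_derive_mx => i j; under eq_fun do rewrite mxE.
  by have [_ _ _] := HF (i, j); exact.
Qed.

(** Picard iteration. The bound on [N] makes the integral operator a contraction of ratio 1/2 in the
    uniform norm over the whole unit interval, so no short-time solutions have to be glued; the
    bound is later secured by shrinking a ball. *)
Lemma linear_ode {m p} (N : R -> 'M[R]_m) (A0 : 'M[R]_(m, p)) :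
  continuous N ->
  (forall (t : R) (B : 'M[R]_(m, p)), 0 < t < 1 -> `|N t *m B| <= `|B| / 2) ->
  exists u : R -> 'M[R]_(m, p), [/\ u 0 = A0, continuous u
    & forall t : R, 0 < t < 1 -> is_derive t 1 u (N t *m u t)].
Proof.
move=> cN NB.
(* [v] is [A0] plus the primitive of [N u], frozen outside [0, 1]. The operator [T] obtained by
   choice is unspecified on discontinuous [u]. *)
pose P (u v : R -> 'M[R]_(m, p)) := continuous u -> [/\ v 0 = A0, continuous v,
    forall t, v (clamp t) = v t
  & forall t : R, 0 < t < 1 -> is_derive t 1 v (N t *m u t)].
have /choice[T HT] u : exists v, P u v.
  have [cu|ncu] := pselect (continuous u); last by exists u.
  have [F [F0 cF Fc dF]] : exists F : R -> 'M[R]_(m, p),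
    [/\ F 0 = 0, continuous F, forall t, F (clamp t) = F t
    & forall t : R, 0 < t < 1 -> is_derive t 1 F (N t *m u t)].
    by apply: primitive01 => t; apply: continuous_mulmx; [exact: cN|exact: cu].
  exists (fun t => A0 + F t) => _; split.
  - by rewrite F0 addr0.
  - by move=> t; apply: cvgD; [exact: cvg_cst|exact: cF].
  - by move=> t; rewrite Fc.
  - by move=> t t01; have := dF t t01 => ?; apply: is_derive_eq; rewrite add0r.
have contr (v w : R -> 'M[R]_(m, p)) (C : R) : continuous v -> continuous w -> 0 <= C ->
    (forall t, `|v t - w t| <= C) -> forall t, `|T v t - T w t| <= C / 2.
  move=> cv cw C0 vw t.
  have [v0 cTv Tvc dTv] := HT v cv; have [w0 cTw Twc dTw] := HT w cw.
  rewrite -Tvc -Twc.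
  apply: (mean_value_bound01 (F := fun t => T v t - T w t)
     (dF := fun t => N t *m (v t - w t))); last by rewrite clamp_ge0 clamp_le1.
  - by move=> s _; apply: cvgB; [exact: cTv|exact: cTw].
  - by rewrite v0 w0 subrr.
  - by rewrite divr_ge0.
  - move=> s s01; have := dTv s s01; have := dTw s s01 => ? ?.
    by apply: is_derive_eq; rewrite mulmxBr.
  - by move=> s s01; rewrite (le_trans (NB _ _ s01))// ler_pM2r// invr_gt0.
pose u k := iter k T (cst A0).
have cu k : continuous (u k).
  elim: k => [|k IHk]; first exact: cst_continuous.
  by have [] := HT _ IHk.
(* The first correction has derivative [N t *m A0], of norm at most half that of [A0]; each later
   correction is halved. *)
pose C : R := `|A0| / 2.
have u1 t : `|u 1 t - u 0 t| <= C.
  have [T0 cT Tc dT] := HT _ (cu 0); rewrite /u/= -Tc.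
  apply: (mean_value_bound01 (F := fun t => T (cst A0) t - A0)
     (dF := fun t => N t *m A0)); last by rewrite clamp_ge0 clamp_le1.
  - by move=> s _; apply: cvgB; [exact: cT|exact: cvg_cst].
  - by rewrite T0 subrr.
  - by rewrite divr_ge0.
  - move=> s s01; have := dT s s01 => ?.
    by apply: is_derive_eq; rewrite subr0.
  - by move=> s s01; exact: NB.
have C0 : 0 <= C by rewrite divr_ge0.
have step k t : `|u k.+1 t - u k t| <= C / 2 ^+ k.
  elim: k t => [|k IHk] t; first by rewrite expr0 divr1.
  rewrite exprSr invfM mulrA.
  apply: (contr (u k.+1) (u k)) => //.
  by rewrite divr_ge0// exprn_ge0.
(* The tail from [k] of the geometric series of the bounds in [step] sums to this constant. *)
have dist k j t : `|u (j + k)%N t - u k t| <= 2 * C / 2 ^+ k.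
  elim: j k => [|j IHj] k.
    by rewrite subrr normr0 divr_ge0// ?mulr_ge0// exprn_ge0.
  rewrite addSnnS -(subrKA (u k.+1 t)) (le_trans (ler_normD _ _))//.
  apply: (le_trans (lerD (IHj k.+1) (step k t))).
  rewrite exprSr invfM mulrA; set a := 2 ^+ k; lra.
have small (e : R) : 0 < e -> exists k, 2 * C / 2 ^+ k < e.
  move=> e0; have z1 : `|2^-1 : R| < 1 by rewrite ger0_norm ?invr_ge0// invf_lt1// ltr1n.
  have [k _ /(_ k (leqnn k))] := (cvgrPdist_lt _ _).1 (cvg_geometric (2 * C) z1) e e0.
  rewrite /= sub0r normrN ger0_norm ?mulr_ge0 ?exprn_ge0 ?invr_ge0// exprVn.
  by exists k.
have cvu t : cvgn (fun k => u k t).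
  apply: cauchy_cvg; apply: cauchy_exP => e e0; have [k ke] := small e e0.
  exists (u k t); exists k => // l /= kl; rewrite -ball_normE /ball_/= distrC.
  by rewrite -(subnK kl); exact: le_lt_trans (dist k (l - k)%N t) ke.
pose v (t : R) : 'M[R]_(m, p) := limn (fun k => u k t).
have dv k t : `|v t - u k t| <= 2 * C / 2 ^+ k.
  apply/ler_addgt0Pl => e e0.
  have [l _ Hl] := (cvgrPdist_le _ _).1 (cvu t) e e0.
  have := Hl (l + k)%N (leq_addr _ _) => /= vu.
  rewrite -(subrKA (u (l + k)%N t)) (le_trans (ler_normD _ _))// lerD//.
have cv : continuous v.
  move=> t; apply/cvgrPdist_le => e e0.
  have e3 : 0 < e / 3 by rewrite divr_gt0.
  have [k ke] := small _ e3.
  near=> s.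
  have Hs : `|u k t - u k s| <= e / 3.
    by near: s; exact: (cvgrPdist_le _ _).1 (cu k t) (e / 3) e3.
  have := dv k t; have := dv k s; rewrite (distrC (v s)) => H1 H2.
  rewrite (_ : e = e / 3 + (e / 3 + e / 3)); last by lra.
  apply: (le_trans (ler_distD (u k t) _ _)); apply: lerD.
    exact: le_trans H2 (ltW ke).
  apply: (le_trans (ler_distD (u k s) _ _)); apply: lerD => //.
  exact: le_trans H1 (ltW ke).
have [Tv0 cTv _ dTv] := HT v cv.
(* By contraction [T v] is close to [T (u k)], which is [u k.+1] and is close to [v]; limits and
   integrals need not be exchanged. *)
have E : T v = v.
  apply/funext => t; apply/eqP; rewrite -subr_eq0 -normr_eq0 eq_le normr_ge0 andbT.
  apply/ler_addgt0Pl => e e0; rewrite addr0.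
  have [k ke] := small e e0.
  have B0 j : 0 <= 2 * C / 2 ^+ j by rewrite divr_ge0 ?mulr_ge0// exprn_ge0.
  rewrite -(subrKA (u k.+1 t)) (le_trans (ler_normD _ _))//.
  have H1 := contr v (u k) _ cv (cu k) (B0 k) (dv k) t.
  have := dv k.+1 t; rewrite distrC => H2.
  apply: (le_trans (lerD H1 H2)); apply: le_trans (ltW ke).
  rewrite exprSr invfM mulrA; set a := 2 ^+ k; lra.
by exists v; split=> // [|t t01]; rewrite -{1}E//; exact: dTv.
Unshelve. all: by end_near. Qed.

End LinearODE.

(** * Integrable total differential systems *)

Section TotalDifferential.
Context {R : realType}.

(** The maximum of the norm on [0, 1] is at most half of itself plus [C], and the half is absorbed;
    no exponential appears because the growth rate is at most 1/2. *)
Lemma gronwall01 {m p} (F dF : R -> 'M[R]_(m, p)) (C : R) :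
  (forall t : R, 0 <= t <= 1 -> {for t, continuous F}) -> F 0 = 0 -> 0 <= C ->
  (forall t : R, 0 < t < 1 -> is_derive t 1 F (dF t)) ->
  (forall t : R, 0 < t < 1 -> `|dF t| <= `|F t| / 2 + C) ->
  forall t : R, 0 <= t <= 1 -> `|F t| <= 2 * C.
Proof.
move=> cF F0 C0 HF dFC.
have [||c c01 cmax] := @EVT_max R (fun t => `|F t|) 0 1.
- exact: ler01.
- apply: continuous_in_subspaceT => t; rewrite inE/= in_itv/= => t01.
  by apply: (@continuous_comp _ _ _ F (fun A => `|A|)); [exact: cF|exact: norm_continuous].
have {}cmax (t : R) : 0 <= t <= 1 -> `|F t| <= `|F c|.
  by move=> t01; apply: cmax; rewrite in_itv.
have Hc : `|F c| <= `|F c| / 2 + C.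
  apply: (mean_value_bound01 cF F0 _ HF); last by rewrite in_itv in c01.
  - by rewrite addr_ge0// divr_ge0.
  - move=> t t01; rewrite (le_trans (dFC t t01))// lerD2r ler_pM2r ?invr_gt0//.
    by apply: cmax; case/andP: t01 => ? ?; rewrite !ltW.
by move=> t /cmax tc; apply: (le_trans tc); lra.
Qed.

Let eq_leq_norm (a b : R) : a = b -> `|a| <= `|b|.
Proof. by move->. Qed.

Let eq_le (a b : R) : a = b -> a <= b.
Proof. by move->. Qed.

Lemma norm_lincomb {n m p} (h : 'rV[R]_n) (F : 'I_n -> 'M[R]_(m, p)) (C : R) :
  (forall a, `|F a| <= C) -> `|\sum_(a < n) h 0 a *: F a| <= n%:R * (`|h| * C).
Proof.
move=> FC; rewrite (le_trans (ler_norm_sum _ _ _))//.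
rewrite -[n in n%:R]card_ord mulr_natl -sumr_const ler_sum// => a _.
by rewrite normrZ ler_pM// norm_mx_entry.
Qed.

Lemma ball_segment {n} (c y k : 'rV[R]_n) (r t : R) :
  ball c r y -> ball c r (y + k) -> 0 <= t <= 1 -> ball c r (y + t *: k).
Proof.
rewrite -!ball_normE /ball_/= => yr ykr /andP[t0 t1].
have -> : c - (y + t *: k) = (1 - t) *: (c - y) + t *: (c - (y + k)).
  by rewrite !scalerBr !scalerBl !scale1r scalerDr; apply/matrixP => i j; rewrite !mxE; ring.
rewrite (le_lt_trans (ler_normD _ _))// !normrZ !ger0_norm ?subr_ge0//.
have [->|tn0] := eqVneq t 0; first by rewrite mul0r addr0 subr0 mul1r.
have A : (1 - t) * `|c - y| <= (1 - t) * r by rewrite ler_wpM2l ?subr_ge0// ltW.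
have B : t * `|c - (y + k)| < t * r by rewrite ltr_pM2l// lt_neqAle eq_sym tn0.
by apply: (lt_le_trans (ler_ltD A B)); rewrite mulrBl mul1r subrK.
Qed.

Lemma lipschitz_segment {n m p} (F : 'rV[R]_n -> 'M[R]_(m, p)) (y k : 'rV[R]_n) (K : R) :
  (forall t : R, 0 <= t <= 1 -> differentiable F (y + t *: k)) ->
  (forall (t : R) a, 0 <= t <= 1 -> `|partial a F (y + t *: k)| <= K) ->
  `|F (y + k) - F y| <= n%:R * (`|k| * K).
Proof.
move=> dF FK.
have C0 : 0 <= n%:R * (`|k| * K).
  (* For [n = 0] there is no partial to force [K] to be nonnegative, but the constant vanishes. *)
  case: n F y k dF FK => [|n] F y k dF FK; first by rewrite mul0r.
  have := FK 0 0; rewrite lexx ler01 => /(_ isT) K0.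
  by rewrite !mulr_ge0// (le_trans _ K0).
apply: norm_mx_le => // i j; rewrite !mxE.
have [t t01|t /andP[t0 t1] ->] := @MVT_line _ _ (fun x => F x i j) y k.
  by apply: differentiable_entry; exact: dF.
have t01 : 0 <= t <= 1 by rewrite !ltW.
have := norm_lincomb k (F := fun a => partial a F (y + t *: k)) (fun a => FK t a t01).
apply: le_trans; apply: le_trans (norm_mx_entry _ i j).
rewrite summxE; apply: eq_leq_norm; apply: eq_bigr => a _.
by rewrite mxE partial_entry//; exact: dF.
Qed.

(** A mean value step expresses the increment by the partials at an intermediate point, and their
    Lipschitz bound brings them back to [y]. *)
Lemma taylor_segment {n m p} (F : 'rV[R]_n -> 'M[R]_(m, p)) (y k : 'rV[R]_n) (K : R) :
  (forall t : R, 0 <= t <= 1 -> differentiable F (y + t *: k)) ->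
  (forall (t : R) a, 0 <= t <= 1 -> differentiable (partial a F) (y + t *: k)) ->
  (forall (t : R) a b, 0 <= t <= 1 -> `|partial a (partial b F) (y + t *: k)| <= K) ->
  `|F (y + k) - F y - \sum_(a < n) k 0 a *: partial a F y| <=
    n%:R * (`|k| * (n%:R * (`|k| * K))).
Proof.
move=> dF ddF FK.
have C0 : 0 <= n%:R * (`|k| * (n%:R * (`|k| * K))).
  case: n F y k dF ddF FK => [|n] F y k dF ddF FK; first by rewrite mul0r.
  have := FK 0 0 0; rewrite lexx ler01 => /(_ isT) K0.
  by rewrite !mulr_ge0// (le_trans _ K0).
apply: norm_mx_le => // i j; rewrite 3!mxE.
have [t t01|t /andP[t0 t1] ->] := @MVT_line _ _ (fun x => F x i j) y k.
  by apply: differentiable_entry; exact: dF.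
have t01 : 0 <= t <= 1 by rewrite !ltW.
have lip a : `|partial a F (y + t *: k) - partial a F y| <= n%:R * (`|k| * K).
  have st (s : R) : 0 <= s <= 1 -> 0 <= s * t <= 1.
    by move=> /andP[s0 s1]; rewrite mulr_ge0 ?mulr_ile1// ltW.
  apply: (@le_trans _ _ (n%:R * (`|t *: k| * K))).
    apply: lipschitz_segment => [s s01|s b s01]; rewrite scalerA; [apply: ddF|apply: FK]; exact: st.
  have K0 : 0 <= K by rewrite (le_trans _ (FK 0 a a _))// lexx ler01.
  rewrite ler_wpM2l// ler_wpM2r// normrZ ger0_norm; last exact: ltW.
  by rewrite ler_piMl// ltW.
have := norm_lincomb k (F := fun a => partial a F (y + t *: k) - partial a F y) lip.
apply: le_trans; apply: le_trans (norm_mx_entry _ i j).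
rewrite [in leLHS]mxE !summxE -sumrB; apply: eq_leq_norm; apply: eq_bigr => a _.
by rewrite !mxE partial_entry; [rewrite mulrBr|exact: dF].
Qed.

Lemma locally_bounded {n} {W : normedModType R} (I : finType)
    (F : I -> 'rV[R]_n -> W) (c : 'rV[R]_n) :
  (forall i, {for c, continuous (F i)}) ->
  exists K r : R, [/\ 0 <= K, 0 < r & forall i x, ball c r x -> `|F i x| <= K].
Proof.
move=> cF.
have : \forall x \near c, forall i, `|F i c - F i x| <= 1.
  near=> x; near: x; apply: filter_forall => i.
  exact: (cvgrPdist_le _ _).1 (cF i) 1 ltr01.
move=> /nbhs_ballP[r /= r0 Hr].
exists (\sum_i (`|F i c| + 1)), r; split=> // [|i x /Hr /(_ i) Hi].
  by apply: sumr_ge0 => i _; rewrite addr_ge0.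
rewrite (bigD1 i)//= -[leLHS]addr0 lerD//; last first.
  by apply: sumr_ge0 => j _; rewrite addr_ge0.
rewrite -(subrK (F i c) (F i x)) (le_trans (ler_normD _ _))// addrC lerD2l.
by rewrite distrC.
Unshelve. all: by end_near. Qed.

(** Origin of the smallness condition: [n] terms of size at most [r * K], and a factor [m] for the
    matrix product. It supplies the ratio 1/2 required by [linear_ode] and [gronwall01]. *)
Lemma norm_lincomb_half {n m p} (h : 'rV[R]_n) (F : 'I_n -> 'M[R]_m) (r K : R)
    (B : 'M[R]_(m, p)) :
  0 <= K -> `|h| <= r -> (forall a, `|F a| <= K) ->
  m%:R * (n%:R * (r * K)) <= 1 / 2 ->
  `|(\sum_(a < n) h 0 a *: F a) *m B| <= `|B| / 2.
Proof.
move=> K0 hr FK small; rewrite (le_trans (norm_mulmx _ _))// mulrCA mulrA mulrC ler_wpM2l//.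
rewrite mulrC -[leRHS]mul1r; apply: le_trans small; rewrite ler_wpM2l//.
by rewrite (le_trans (norm_lincomb _ FK))// ler_wpM2l// ler_wpM2r.
Qed.

(** Along the ray from [c] in direction [h] the system is a linear equation; clamping the time keeps
    the ray in the ball, so its coefficient is continuous on the line. The Gronwall bound on
    [U h t - A0] gives the factor 2, uniformly in [h]. *)
Lemma total_differential_radial {n m p} (M : 'I_n -> 'rV[R]_n -> 'M[R]_m)
    (c : 'rV[R]_n) (r K : R) (A0 : 'M[R]_(m, p)) :
  0 < r <= 1 -> 0 <= K ->
  (forall a (x : 'rV[R]_n), ball c r x -> `|M a x| <= K) ->
  m%:R * (n%:R * (r * K)) <= 1 / 2 ->
  (forall a (x : 'rV[R]_n), ball c r x -> {for x, continuous (M a)}) ->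
  exists U : 'rV[R]_n -> R -> 'M[R]_(m, p), forall h : 'rV[R]_n, `|h| < r ->
    [/\ U h 0 = A0, continuous (U h),
      forall t : R, 0 < t < 1 ->
        is_derive t 1 (U h) ((\sum_(a < n) h 0 a *: M a (c + t *: h)) *m U h t)
    & forall t : R, 0 <= t <= 1 -> `|U h t| <= 2 * `|A0|].
Proof.
move=> /andP[r0 r1] K0 MK small cM.
pose P (h : 'rV[R]_n) (U : R -> 'M[R]_(m, p)) := `|h| < r -> 
    [/\ U 0 = A0, continuous U,
      forall t : R, 0 < t < 1 ->
        is_derive t 1 U ((\sum_(a < n) h 0 a *: M a (c + t *: h)) *m U t)
    & forall t : R, 0 <= t <= 1 -> `|U t| <= 2 * `|A0|].
suff /choice[U HU] h : exists U, P h U by exists U.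
have [hr|rh] := ltP `|h| r; last by exists (cst 0) => /lt_geF; rewrite rh.
have inb (t : R) : 0 <= t <= 1 -> ball c r (c + t *: h).
  move=> t01; apply: ball_segment => //; first exact: ballxx.
  by rewrite -ball_normE /ball_/= opprD addrA subrr sub0r normrN.
pose N (t : R) := \sum_(a < n) h 0 a *: M a (c + clamp t *: h).
have c01 (t : R) : 0 <= clamp t <= 1 by rewrite clamp_ge0 clamp_le1.
have NB (t : R) q (B : 'M[R]_(m, q)) : `|N t *m B| <= `|B| / 2.
  by apply: norm_lincomb_half K0 (ltW hr) _ small => a; exact: MK (inb _ (c01 t)).
have cN : continuous N.
  move=> t; apply: cvg_big => [|a _]; first exact: add_continuous.
  apply: cvgZr.
  apply: (@continuous_comp _ _ _ (fun t => c + clamp t *: h) (M a)); last exact: cM (inb _ (c01 t)).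
  apply: cvgD; first exact: cvg_cst.
  by apply: cvgZl; exact: clamp_continuous.
have [U [U0 cU dU]] := linear_ode A0 cN (fun t B _ => NB t _ B).
exists U => _; split=> //.
  by move=> t t01; have := dU t t01; rewrite /N clamp_id//; case/andP: t01 => ? ?; rewrite !ltW.
move=> t t01.
have : `|U t - A0| <= 2 * (`|A0| / 2).
  apply: (gronwall01 (F := fun t => U t - A0) (dF := fun t => N t *m U t)) => //.
  - by move=> s _; apply: cvgB; [exact: cU|exact: cvg_cst].
  - by rewrite U0 subrr.
  - by move=> s s01; have := dU s s01 => ?; apply: is_derive_eq; rewrite subr0.
  move=> s s01; rewrite (le_trans (NB _ _ _))// -mulrDl ler_pM2r ?invr_gt0//.
  by rewrite -[X in `|X| <= _](subrK A0) ler_normD.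
rewrite -[X in _ -> `|X| <= _](subrK A0) => H.
by rewrite (le_trans (ler_normD _ _))//; lra.
Qed.

Lemma is_derive_bigsum {V W : normedModType R} n (f : 'I_n -> V -> W) (x v : V)
    (df : 'I_n -> W) :
  (forall i, is_derive x v (f i) (df i)) ->
  is_derive x v (fun y => \sum_(i < n) f i y) (\sum_(i < n) df i).
Proof. by move=> H; rewrite -(@fct_sumE _ _ _ _ _ f); exact: is_derive_sum. Qed.

Lemma is_derive_id_scale {m p} (A : R -> 'M[R]_(m, p)) (t : R) dA :
  is_derive t 1 A dA -> is_derive t 1 (fun s => s *: A s) (A t + t *: dA).
Proof.
move=> /is_derive_mx H; apply/is_derive_mx => i j; rewrite !mxE.
under eq_fun do rewrite mxE.
have := H i j => ?; apply: is_derive_eq; rewrite /GRing.scale/=; ring.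
Qed.

Let regroup {m p} (a1 a2 a3 a4 a5 : 'M[R]_(m, p)) :
  a1 + a2 - a3 - a4 - a5 = a1 - a3 - a5 + (a2 - a4).
Proof. by apply/matrixP => i j; rewrite !mxE; ring. Qed.

Lemma mulmx_lincomb {n m} (x y : 'rV[R]_n) (F G : 'I_n -> 'M[R]_m) :
  (\sum_(a < n) x 0 a *: F a) *m (\sum_(b < n) y 0 b *: G b) =
  \sum_(a < n) \sum_(b < n) (x 0 a * y 0 b) *: (F a *m G b).
Proof.
rewrite mulmx_suml; apply: eq_bigr => a _; rewrite mulmx_sumr; apply: eq_bigr => b _.
by rewrite -scalemxAl -scalemxAr scalerA.
Qed.

Let lincomb2_eq {n m} (h k : 'rV[R]_n) (P T : 'I_n -> 'I_n -> 'M[R]_m) :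
  (forall a b, P a b + T b a = P b a + T a b) ->
  \sum_(a < n) \sum_(b < n) (h 0 a * k 0 b) *: P a b
    + \sum_(a < n) \sum_(b < n) (k 0 b * h 0 a) *: T b a =
  \sum_(a < n) \sum_(b < n) (h 0 a * k 0 b) *: P b a
    + \sum_(a < n) \sum_(b < n) (h 0 a * k 0 b) *: T a b.
Proof.
move=> PT; rewrite -!big_split; apply: eq_bigr => a _ /=; rewrite -!big_split.
by apply: eq_bigr => b _ /=; rewrite [k 0 b * _]mulrC -!scalerDr PT.
Qed.

(** The place where integrability acts. [U] and [U'] are solutions on neighbouring rays and
    [t *: Mk *m U] is the predicted first variation. The left side is the time derivative of the
    defect of this prediction; integrability, contracted with the two directions, turns it into [N]
    applied to the defect plus terms of second order. *)
Let variation_identity {m p} (N N' Mk Q Q' : 'M[R]_m) (U U' : 'M[R]_(m, p)) (t : R) :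
  Q + Mk *m N = Q' + N *m Mk ->
  N' *m U' - N *m U - ((Mk + t *: Q) *m U + (t *: Mk) *m (N *m U)) =
  N *m (U' - U - (t *: Mk) *m U) +
    ((N' - N) *m (U' - U) + (N' - N - Mk - t *: Q') *m U).
Proof.
move=> E; have -> : Q' = Q + Mk *m N - N *m Mk by rewrite E addrK.
rewrite !(mulmxDl, mulmxDr, mulNmx, mulmxN, scalerDr, scalerN).
rewrite -!scalemxAl -!scalemxAr !mulmxA.
move: (N' *m U') (N *m U) (Mk *m U) (Q *m U) (Mk *m N *m U) (N *m U')
  (N *m Mk *m U) (N' *m U) => a1 a2 a3 a4 a5 a6 a7 a8.
apply/matrixP => i j; rewrite !mxE; ring.
Qed.

(** The defect of the first variation vanishes at time 0 and obeys the linear equation of the ray up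
    to an error quadratic in [k], so [gronwall01] bounds it; at time 1 this is a first order
    expansion whose coefficients are those prescribed by the system. *)
Lemma total_differential_expansion {n m p} (M : 'I_n -> 'rV[R]_n -> 'M[R]_m)
    (c : 'rV[R]_n) (r K : R) (A0 : 'M[R]_(m, p)) (U : 'rV[R]_n -> R -> 'M[R]_(m, p)) :
  0 < r <= 1 -> 0 <= K ->
  (forall a (x : 'rV[R]_n), ball c r x -> `|M a x| <= K) ->
  (forall a b (x : 'rV[R]_n), ball c r x -> `|partial a (M b) x| <= K) ->
  (forall a b d (x : 'rV[R]_n), ball c r x ->
    `|partial d (partial a (M b)) x| <= K) ->
  m%:R * (n%:R * (r * K)) <= 1 / 2 ->
  (forall a (x : 'rV[R]_n), ball c r x -> differentiable (M a) x) ->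
  (forall a b (x : 'rV[R]_n), ball c r x -> differentiable (partial a (M b)) x) ->
  (forall a b (x : 'rV[R]_n), ball c r x ->
    partial a (M b) x + M b x *m M a x = partial b (M a) x + M a x *m M b x) ->
  (forall h : 'rV[R]_n, `|h| < r ->
    [/\ U h 0 = A0, continuous (U h),
      forall t : R, 0 < t < 1 ->
        is_derive t 1 (U h) ((\sum_(a < n) h 0 a *: M a (c + t *: h)) *m U h t)
    & forall t : R, 0 <= t <= 1 -> `|U h t| <= 2 * `|A0|]) ->
  exists2 C : R, 0 <= C & forall h k : 'rV[R]_n, `|h| < r -> `|h + k| < r ->
    `|U (h + k) 1 - U h 1 - (\sum_(a < n) k 0 a *: M a (c + h)) *m U h 1| <=
      C * `|k| ^+ 2.
Proof.
move=> /andP[r0 r1] K0 MK pMK ppMK small dM ddM integr HU.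
(* [C1] and [C2] are Lipschitz constants in [k] for the coefficient and the solution, [C3] bounds
   the second order error of the coefficient, and [C4] collects the quadratic terms of
   [variation_identity]. *)
pose C1 := n%:R * K + n%:R * (n%:R * K).
pose C2 := 2 * (m%:R * (C1 * (2 * `|A0|))).
pose C3 := n%:R * (n%:R * (n%:R * K)) + n%:R * (n%:R * K).
pose C4 := m%:R * (C1 * C2) + m%:R * (C3 * (2 * `|A0|)).
have C1_ge0 : 0 <= C1 by rewrite addr_ge0// !mulr_ge0.
have C2_ge0 : 0 <= C2 by rewrite !mulr_ge0.
have C3_ge0 : 0 <= C3 by rewrite addr_ge0// !mulr_ge0.
have C4_ge0 : 0 <= C4 by rewrite addr_ge0// !mulr_ge0.
exists (2 * C4) => [|h k hr hkr]; first by rewrite mulr_ge0.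
have inb (t : R) l : `|l| < r -> 0 <= t <= 1 -> ball c r (c + t *: l).
  move=> lr t01; apply: ball_segment => //; first exact: ballxx.
  by rewrite -ball_normE /ball_/= opprD addrA subrr sub0r normrN.
have [U0 cU dU BU] := HU h hr; have [U0' cU' dU' BU'] := HU _ hkr.
pose N (t : R) := \sum_(a < n) h 0 a *: M a (c + t *: h).
pose N' (t : R) := \sum_(a < n) (h + k) 0 a *: M a (c + t *: (h + k)).
pose Mk (t : R) := \sum_(a < n) k 0 a *: M a (c + t *: h).
(* [Q] is the time derivative of [Mk] along the ray; [Q'] differentiates the matrices [M a] inside
   [N] in the direction [k]. Integrability is what relates them. *)
pose Q (t : R) := \sum_(a < n) k 0 a *: \sum_(b < n) h 0 b *: partial b (M a) (c + t *: h).
pose Q' (t : R) := \sum_(a < n) h 0 a *: \sum_(b < n) k 0 b *: partial b (M a) (c + t *: h).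
have yk (t : R) : c + t *: (h + k) = c + t *: h + t *: k by rewrite scalerDr addrA.
have seg (t s : R) : 0 <= t <= 1 -> 0 <= s <= 1 -> ball c r (c + t *: h + s *: (t *: k)).
  by move=> t01 s01; apply: ball_segment => //; rewrite -?yk; exact: inb.
have tk (t : R) : 0 <= t <= 1 -> `|t *: k| <= `|k|.
  by move=> /andP[t0 t1]; rewrite normrZ ger0_norm// ler_piMl.
have lip (t : R) a : 0 <= t <= 1 ->
    `|M a (c + t *: (h + k)) - M a (c + t *: h)| <= n%:R * (`|k| * K).
  move=> t01; rewrite yk; apply: (@le_trans _ _ (n%:R * (`|t *: k| * K))).
    by apply: lipschitz_segment => [s s01|s b s01]; [apply: dM|apply: pMK]; exact: seg.
  by rewrite ler_wpM2l// ler_wpM2r// tk.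
have tay (t : R) a : 0 <= t <= 1 ->
    `|M a (c + t *: (h + k)) - M a (c + t *: h)
      - t *: \sum_(b < n) k 0 b *: partial b (M a) (c + t *: h)|
      <= n%:R * (`|k| * (n%:R * (`|k| * K))).
  move=> t01; rewrite yk.
  have -> : t *: \sum_(b < n) k 0 b *: partial b (M a) (c + t *: h) =
            \sum_(b < n) (t *: k) 0 b *: partial b (M a) (c + t *: h).
    by rewrite scaler_sumr; apply: eq_bigr => b _; rewrite scalerA mxE.
  apply: (@le_trans _ _ (n%:R * (`|t *: k| * (n%:R * (`|t *: k| * K))))).
    apply: taylor_segment => [s s01|s b s01|s b d s01]; [apply: dM|apply: ddM|apply: ppMK]; exact: seg.
  rewrite ler_wpM2l// ler_pM ?mulr_ge0// ?tk// ler_wpM2l// ler_wpM2r// tk//.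
have dN (t : R) : 0 <= t <= 1 -> `|N' t - N t| <= C1 * `|k|.
  move=> t01.
  have -> : N' t - N t = \sum_(a < n) k 0 a *: M a (c + t *: (h + k)) +
     \sum_(a < n) h 0 a *: (M a (c + t *: (h + k)) - M a (c + t *: h)).
    rewrite -sumrB -big_split; apply: eq_bigr => a _ /=.
    by rewrite mxE scalerDl scalerBr addrCA addrA.
  rewrite (le_trans (ler_normD _ _))// mulrDl lerD//.
    rewrite (le_trans (norm_lincomb _ (C := K) _))// => [a|]; first exact: MK (inb _ _ hkr t01).
    by rewrite -mulrA [K * _]mulrC.
  rewrite (le_trans (norm_lincomb _ (C := n%:R * (`|k| * K)) _))// => [a|]; first exact: lip.
  rewrite -!mulrA [K * _]mulrC ler_wpM2l// ler_piMl ?mulr_ge0//.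
  by rewrite (le_trans (ltW hr)).
have dE (t : R) : 0 <= t <= 1 -> `|N' t - N t - Mk t - t *: Q' t| <= C3 * `|k| ^+ 2.
  move=> t01.
  have -> : N' t - N t - Mk t - t *: Q' t =
     \sum_(a < n) h 0 a *: (M a (c + t *: (h + k)) - M a (c + t *: h)
         - t *: \sum_(b < n) k 0 b *: partial b (M a) (c + t *: h)) +
     \sum_(a < n) k 0 a *: (M a (c + t *: (h + k)) - M a (c + t *: h)).
    rewrite /N' /N /Mk /Q' scaler_sumr -!sumrB -big_split; apply: eq_bigr => a _ /=.
    rewrite mxE scalerDl !scalerBr [t *: (h 0 a *: _)]scalerA [h 0 a *: (t *: _)]scalerA [t * _]mulrC.
    exact: regroup.
  rewrite (le_trans (ler_normD _ _))// mulrDl lerD//.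
    rewrite (le_trans (norm_lincomb _ (C := n%:R * (`|k| * (n%:R * (`|k| * K)))) _))// => [a|]; first exact: tay.
    rewrite -mulrA ler_wpM2l//.
    apply: (@le_trans _ _ (n%:R * (`|k| * (n%:R * (`|k| * K))))); last by apply: eq_le; ring.
    by rewrite ler_piMl ?mulr_ge0// (le_trans (ltW hr)).
  rewrite (le_trans (norm_lincomb _ (C := n%:R * (`|k| * K)) _))// => [a|]; first exact: lip.
  by apply: eq_le; ring.
have NB (t : R) (B : 'M[R]_(m, p)) : 0 <= t <= 1 -> `|N t *m B| <= `|B| / 2.
  move=> t01; apply: norm_lincomb_half K0 (ltW hr) _ small => a.
  exact: MK (inb _ _ hr t01).
have oc (t : R) : 0 < t < 1 -> 0 <= t <= 1 by case/andP => ? ?; rewrite !ltW.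
have dU1 (t : R) : 0 <= t <= 1 -> `|U (h + k) t - U h t| <= C2 * `|k|.
  rewrite /C2 -mulrA.
  apply: (gronwall01 (F := fun t => U (h + k) t - U h t)
    (dF := fun t => N' t *m U (h + k) t - N t *m U h t)).
  - by move=> s _; apply: cvgB; [exact: cU'|exact: cU].
  - by rewrite U0 U0' subrr.
  - by rewrite !mulr_ge0.
  - by move=> s s01; have := dU s s01; have := dU' s s01 => ? ?; exact: is_deriveB.
  move=> s s01; have -> : N' s *m U (h + k) s - N s *m U h s =
     N s *m (U (h + k) s - U h s) + (N' s - N s) *m U (h + k) s.
    by rewrite mulmxBr mulmxBl [RHS]addrC addrA subrK.
  rewrite (le_trans (ler_normD _ _))// lerD//; first exact: NB (oc _ s01).
  rewrite (le_trans (norm_mulmx _ _))// -mulrA ler_wpM2l// mulrAC.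
  by rewrite ler_pM ?mulr_ge0//; [exact: dN (oc _ s01)|exact: BU' (oc _ s01)].
have HQ (t : R) : 0 <= t <= 1 -> Q t + Mk t *m N t = Q' t + N t *m Mk t.
  move=> t01; rewrite /Mk /N !mulmx_lincomb.
  rewrite [X in _ + X = _]exchange_big /=.
  have -> : Q t = \sum_(a < n) \sum_(b < n) (h 0 a * k 0 b) *: partial a (M b) (c + t *: h).
    rewrite exchange_big; apply: eq_bigr => a _ /=; rewrite scaler_sumr.
    by apply: eq_bigr => b _; rewrite scalerA mulrC.
  have -> : Q' t = \sum_(a < n) \sum_(b < n) (h 0 a * k 0 b) *: partial b (M a) (c + t *: h).
    by apply: eq_bigr => a _; rewrite scaler_sumr; apply: eq_bigr => b _; rewrite scalerA.
  exact: (lincomb2_eq h k (fun a b => integr a b _ (inb _ _ hr t01))).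
have dMk (t : R) : 0 <= t <= 1 -> is_derive t 1 Mk (Q t).
  move=> t01; apply: is_derive_bigsum => a.
  have := is_derive_line (h := h) (dM a _ (inb _ _ hr t01)) => ?.
  exact: is_deriveZ.
have one01 : 0 <= (1 : R) <= 1 by rewrite ler01 lexx.
suff H (t : R) : 0 <= t <= 1 ->
    `|U (h + k) t - U h t - (t *: Mk t) *m U h t| <= 2 * (C4 * `|k| ^+ 2).
  by have := H 1 one01; rewrite scale1r /Mk scale1r mulrA.
move: t; apply: (gronwall01 (F := fun t => U (h + k) t - U h t - (t *: Mk t) *m U h t)
  (dF := fun t => N' t *m U (h + k) t - N t *m U h t
     - ((Mk t + t *: Q t) *m U h t + (t *: Mk t) *m (N t *m U h t)))
  (C := C4 * `|k| ^+ 2)).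
- move=> t t01.
  have cMU : {for t, continuous (fun s : R => (s *: Mk s) *m U h s)}.
    apply: continuous_mulmx; last exact: cU.
    apply: differentiable_continuous; apply/derivable1_diffP.
    by have [] := is_derive_id_scale (dMk t t01).
  by apply: cvgB; [apply: cvgB; [exact: cU'|exact: cU]|exact: cMU].
- by rewrite U0 U0' subrr scale0r mul0mx subrr.
- by rewrite mulr_ge0// sqr_ge0.
- move=> t t01; have := dU t t01; have := dU' t t01 => H1 H2.
  have H3 := is_derive_mulmx (is_derive_id_scale (dMk t (oc t t01))) H2.
  by apply: is_deriveB; exact: is_deriveB.
- move=> t t01; have t01' := oc t t01.
  rewrite (variation_identity _ _ _ _ (HQ t t01')).
  rewrite (le_trans (ler_normD _ _))// lerD//; first exact: NB.
  rewrite (le_trans (ler_normD _ _))// mulrDl lerD//.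
    rewrite (le_trans (norm_mulmx _ _))// -mulrA ler_wpM2l//.
    rewrite (le_trans (ler_pM _ _ (dN t t01') (dU1 t t01')))//.
    by apply: eq_le; ring.
  rewrite (le_trans (norm_mulmx _ _))// -mulrA ler_wpM2l//.
  rewrite (le_trans (ler_pM _ _ (dE t t01') (BU t t01')))//.
  by apply: eq_le; ring.
Qed.

(** Bootstrapping: the system expresses the partials of [u] through [u], so each order of regularity
    yields the next. *)
Lemma total_differential_smooth {n m p} (D : set 'rV[R]_n)
    (M : 'I_n -> 'rV[R]_n -> 'M[R]_m) (u : 'rV[R]_n -> 'M[R]_(m, p)) :
  open D -> (forall a, smooth_on D (M a)) ->
  (forall x, D x -> differentiable u x) ->
  (forall a x, D x -> partial a u x = M a x *m u x) -> smooth_on D u.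
Proof.
move=> oD sM du pu; apply/CkP; elim=> [|k IHk]; first exact: du.
split=> // a; apply: Ck_mx => // i j.
suff : Ck k D (fun x => \sum_l M a x i l * u x l j).
  by apply: Ck_ext => // x /[!inE] Dx; rewrite pu// mxE.
apply: Ck_sum => // l _; apply: CkM => //; last exact: Ck_entry.
by apply: Ck_entry => //; have /CkP := sM a; exact.
Qed.

(* The solution at x is the value at time 1 of the linear equation obtained by
   restricting the system to the segment from c to x; integrability is what makes
   this value depend on x with the prescribed partial derivatives. *)
Theorem total_differential {n m p} (W : set 'rV[R]_n) (c : 'rV[R]_n)
    (M : 'I_n -> 'rV[R]_n -> 'M[R]_m) (A0 : 'M[R]_(m, p)) :
  open W -> W c -> (forall a, smooth_on W (M a)) ->
  (forall a b x, W x ->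
    partial a (M b) x + M b x *m M a x = partial b (M a) x + M a x *m M b x) ->
  exists (r : R) (u : 'rV[R]_n -> 'M[R]_(m, p)),
    [/\ 0 < r, ball c r `<=` W, u c = A0, smooth_on (ball c r) u
      & forall a x, ball c r x -> partial a u x = M a x *m u x].
Proof.
move=> oW Wc sM integr.
have cW (W' : normedModType R) (f : 'rV[R]_n -> W') (x : 'rV[R]_n) :
    smooth_on W f -> W x -> {for x, continuous f}.
  by move=> sf Wx; apply: differentiable_continuous; exact: smooth_differentiable sf Wx.
have [K1 [r1 [K10 r10 HK1]]] := locally_bounded (fun a => cW _ _ c (sM a) Wc).
have [K2 [r2 [K20 r20 HK2]]] := locally_bounded
  (F := fun ab : 'I_n * 'I_n => partial ab.1 (M ab.2))
  (fun ab => cW _ _ c (smooth_partial ab.1 (sM ab.2)) Wc).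
have [K3 [r3 [K30 r30 HK3]]] := locally_bounded
  (F := fun abd : 'I_n * 'I_n * 'I_n => partial abd.2 (partial abd.1.1 (M abd.1.2)))
  (fun abd => cW _ _ c (smooth_partial abd.2 (smooth_partial abd.1.1 (sM abd.1.2))) Wc).
have /nbhs_ballP[r4 /= r40 HW] : nbhs c W by exact: open_nbhs_nbhs.
pose K := K1 + K2 + K3.
have K0 : 0 <= K by rewrite !addr_ge0.
(* This radius secures the bound 1/2 in [small]; the [+ 1] avoids a zero denominator. The cap 1 in
   [r] removes the norm of [h] from the constants of the expansion. *)
pose r5 := 1 / 2 / (m%:R * (n%:R * K) + 1).
have r50 : 0 < r5 by rewrite !divr_gt0// ltr_wpDl// !mulr_ge0.
pose r := Num.min 1 (Num.min r1 (Num.min r2 (Num.min r3 (Num.min r4 r5)))).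
have r0 : 0 < r by rewrite !lt_min ltr01 r10 r20 r30 r40.
have : r <= r by [].
rewrite {2}/r !le_min => /andP[rr1 /and5P[rr2 rr3 rr4 rr5 rr6]].
have bW x : ball c r x -> W x by move=> /(le_ball rr5) /HW.
have small : m%:R * (n%:R * (r * K)) <= 1 / 2.
  apply: (@le_trans _ _ (r5 * (m%:R * (n%:R * K)))).
    have -> : m%:R * (n%:R * (r * K)) = r * (m%:R * (n%:R * K)) by ring.
    by rewrite ler_wpM2r ?mulr_ge0.
  rewrite /r5 -mulrA ler_piMr// mulrC ler_pdivrMr ?ltr_wpDl ?mulr_ge0//.
  by rewrite mul1r lerDl.
have MK a (x : 'rV[R]_n) : ball c r x -> `|M a x| <= K.
  by move=> /(le_ball rr2) /HK1 /le_trans; apply; rewrite /K -addrA lerDl addr_ge0.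
have pMK a b (x : 'rV[R]_n) : ball c r x -> `|partial a (M b) x| <= K.
  move=> /(le_ball rr3) xb; have := HK2 (a, b) x xb => /le_trans; apply.
  by rewrite /K addrAC lerDr addr_ge0.
have ppMK a b d (x : 'rV[R]_n) : ball c r x -> `|partial d (partial a (M b)) x| <= K.
  move=> /(le_ball rr4) xb; have := HK3 (a, b, d) x xb => /le_trans; apply.
  by rewrite /K lerDr addr_ge0.
have r01 : 0 < r <= 1 by rewrite r0.
have cM a (x : 'rV[R]_n) : ball c r x -> {for x, continuous (M a)}.
  by move=> /bW; exact: cW.
have dM a (x : 'rV[R]_n) : ball c r x -> differentiable (M a) x.
  by move=> /bW; exact: smooth_differentiable.
have ddM a b (x : 'rV[R]_n) : ball c r x -> differentiable (partial a (M b)) x.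
  by move=> /bW; apply: smooth_differentiable; exact: smooth_partial.
have [U HU] := total_differential_radial A0 r01 K0 MK small cM.
have [C C0 HC] := total_differential_expansion r01 K0 MK pMK ppMK small dM ddM
  (fun a b x xb => integr a b x (bW x xb)) HU.
pose u (x : 'rV[R]_n) := U (x - c) 1.
have normB (x : 'rV[R]_n) : ball c r x -> `|x - c| < r.
  by rewrite -ball_normE /ball_/= distrC.
have key (x : 'rV[R]_n) : ball c r x ->
    differentiable u x /\ forall a, partial a u x = M a x *m u x.
  move=> xb; apply: differentiable_of_expansion => e e0.
  have /nbhs_ballP[s /= s0 Hs] : nbhs x (ball c r).
    by apply: open_nbhs_nbhs; split => //; exact: ball_open.
  apply/nbhs_ballP; exists (Num.min s (e / (C + 1))).
    by rewrite /= lt_min s0 divr_gt0// ltr_wpDl.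
  move=> k; rewrite -ball_normE /ball_/= sub0r normrN lt_min => /andP[ks ke].
  have xk : `|x - c + k| < r.
    rewrite addrAC; apply: normB; apply: Hs.
    by rewrite -ball_normE /ball_/= opprD addrA subrr sub0r normrN.
  have := HC (x - c) k (normB _ xb) xk.
  have -> : x - c + k = k + x - c by rewrite addrC addrA.
  have -> : c + (x - c) = x by rewrite addrC subrK.
  rewrite mulmx_suml.
  rewrite (eq_bigr (fun a => k 0 a *: (M a x *m U (x - c) 1))); last first.
    by move=> a _; rewrite -scalemxAl.
  move/le_trans; apply; rewrite expr2 mulrA ler_wpM2r//.
  rewrite (le_trans _ (_ : (C + 1) * (e / (C + 1)) <= e))//.
    by rewrite ler_pM ?lerDl// ltW.
  by rewrite mulrC divfK// gt_eqF// ltr_wpDl.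
exists r, u; split=> //.
(* At the centre the ray is constant and its equation has coefficient 0, so the solution keeps its
   initial value. *)
- rewrite /u subrr.
  have n0 : `|0 : 'rV[R]_n| < r by rewrite normr0.
  have [U0 cU dU _] := HU 0 n0.
  have one01 : 0 <= (1 : R) <= 1 by rewrite ler01 lexx.
  apply/eqP; rewrite -subr_eq0 -normr_le0.
  apply: (mean_value_bound01 (F := fun t => U 0 t - A0) (dF := fun=> 0)) one01 => //.
  + by move=> s _; apply: cvgB; [exact: cU|exact: cvg_cst].
  + by rewrite U0 subrr.
  + move=> s s01; have := dU s s01; rewrite big1 => [|a _]; last by rewrite mxE scale0r.
    by rewrite mul0mx => ?; apply: is_derive_eq; rewrite subr0.
  + by move=> s _; rewrite normr0.
- apply: total_differential_smooth (ball_open c r) _ _ _.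
  + by move=> a; exact: smooth_sub bW (sM a).
  + by move=> x /key[].
  + by move=> a x /key[_].
- by move=> a x /key[_].
Qed.

(* The equations df = w_a dx_a are the nilpotent case M a = w_a N, N^2 = 0, of a
   linear total differential system, solved by the vector (f, 1). *)
Lemma poincare {n} (W : set 'rV[R]_n) (c : 'rV[R]_n) (w : 'I_n -> 'rV[R]_n -> R) :
  open W -> W c -> (forall a, smooth_on W (w a)) ->
  (forall a b x, W x -> partial a (w b) x = partial b (w a) x) ->
  exists (r : R) (f : 'rV[R]_n -> R), [/\ 0 < r, ball c r `<=` W,
    smooth_on (ball c r) f & forall a x, ball c r x -> partial a f x = w a x].
Proof.
move=> oW Wc sw cw.
pose N : 'M[R]_2 := delta_mx 0 1.
pose M a x := w a x *: N.
have sM a : smooth_on W (M a).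
  apply: smooth_mx => // i j; under eq_fun do rewrite mxE.
  by apply: smoothM => //; exact: smooth_cst.
have pM a b x : W x -> partial a (M b) x = partial a (w b) x *: N.
  move=> Wx; apply/matrixP => i j; rewrite -partial_entry; last first.
    exact: smooth_differentiable (sM b) Wx.
  under eq_fun do rewrite mxE; rewrite partialM ?mxE//; last first.
    exact: smooth_differentiable (sw b) Wx.
  by rewrite {1}/partial derive_cst mulr0 add0r mulrC.
have MM a b x : M a x *m M b x = 0.
  by rewrite -scalemxAl -scalemxAr mul_delta_mx_0 ?scaler0.
have M0 a x (v : 'cV[R]_2) : (M a x *m v) 0 0 = w a x * v 1 0.
  rewrite mxE !big_ord_recl big_ord0 !mxE/= mulr0 mul0r add0r addr0 mulr1.
  by congr (_ * v _ _); apply/val_inj.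
have M1 a x (v : 'cV[R]_2) : (M a x *m v) 1 0 = 0.
  by rewrite mxE !big_ord_recl big_ord0 !mxE/= mulr0 !mul0r !addr0.
have [|r [u [r0 bW uc su pu]]] := @total_differential n 2 1 W c M (delta_mx 1 0) oW Wc sM.
  by move=> a b x Wx; rewrite !pM// !MM cw.
have du x : ball c r x -> differentiable u x by exact: smooth_differentiable.
(* The lower component has zero partials, hence keeps the value 1 it has at [c]; the partials of the
   upper one are then exactly the [w a]. *)
have u1 x : ball c r x -> u x 1 0 = 1.
  move=> xb; have seg (t : R) : 0 <= t <= 1 -> ball c r (c + t *: (x - c)).
    move=> t01; apply: ball_segment => //; first exact: ballxx.
    by rewrite addrC subrK.
  have [t t01|t /andP[t0 t1]] := @MVT_line _ _ (fun x => u x 1 0) c (x - c).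
    by apply: differentiable_entry; apply: du; exact: seg.
  have tb : ball c r (c + t *: (x - c)) by apply: seg; rewrite !ltW.
  have -> : c + (x - c) = x by rewrite addrC subrK.
  rewrite uc big1 => [|a _].
    by rewrite mxE => /eqP; rewrite subr_eq0 => /eqP.
  rewrite partial_entry ?pu//; last exact: du.
  by rewrite M1 mulr0.
exists r, (fun x => u x 0 0); split=> //.
  by apply: smooth_entry => //; exact: ball_open.
move=> a x xb; rewrite partial_entry ?pu//; last exact: du.
by rewrite M0 u1// mulr1.
Qed.

Lemma poincare_family {n} (J : finType) (W : set 'rV[R]_n) (c : 'rV[R]_n)
    (w : J -> 'I_n -> 'rV[R]_n -> R) :
  open W -> W c -> (forall j a, smooth_on W (w j a)) ->
  (forall j a b x, W x -> partial a (w j b) x = partial b (w j a) x) ->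
  exists (r : R) (f : J -> 'rV[R]_n -> R), [/\ 0 < r, ball c r `<=` W,
    forall j, smooth_on (ball c r) (f j)
  & forall j a x, ball c r x -> partial a (f j) x = w j a x].
Proof.
move=> oW Wc sw cw.
have H j : exists rf : R * ('rV[R]_n -> R), [/\ 0 < rf.1, ball c rf.1 `<=` W,
    smooth_on (ball c rf.1) rf.2 & forall a x, ball c rf.1 x -> partial a rf.2 x = w j a x].
  by have [r [f Hf]] := poincare oW Wc (sw j) (cw j); exists (r, f).
have [rf Hrf] := choice H.
have /nbhs_ballP[s /= s0 sW] : nbhs c W by exact: open_nbhs_nbhs.
pose r := \big[Num.min/s]_j (rf j).1.
have rj j : ball c r `<=` ball c (rf j).1.
  by apply: le_ball; exact: bigmin_le_cond.
exists r, (fun j => (rf j).2); split.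
- by apply/lt_bigmin => // j _; have [] := Hrf j.
- by apply: subset_trans sW; apply: le_ball; exact: bigmin_le_id.
- by move=> j; have [_ _ sf _] := Hrf j; exact: smooth_sub (rj j) sf.
- by move=> j a x xb; have [_ _ _ pf] := Hrf j; apply: pf; exact: rj.
Qed.

End TotalDifferential.

(** * Inverse functions *)

Section InverseFunction.
Context {R : realType} {n : nat}.
Implicit Types (D : set 'rV[R]_n) (f : 'rV[R]_n -> 'rV[R]_n).

Lemma partial_cst {W : normedModType R} i (c : W) (x : 'rV[R]_n) :
  partial i (fun=> c) x = 0.
Proof. exact: derive_cst. Qed.

(** The transpose of the usual Jacobian matrix: the row index is the direction of differentiation,
    so that the differential acts on row vectors by multiplication on the right. *)
Definition jacmx f (x : 'rV[R]_n) : 'M[R]_n :=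
  \matrix_(i, j) partial i (fun y => f y 0 j) x.

Lemma jacmxE f x (h : 'rV[R]_n) :
  differentiable f x -> 'd f x h = h *m jacmx f x.
Proof.
move=> df; rewrite differential_partial// mulmx_sum_row; apply: eq_bigr => i _.
by congr (_ *: _); apply/rowP => j; rewrite !mxE partial_entry.
Qed.

Lemma partial_eq0_of_min (phi : 'rV[R]_n -> R) (x : 'rV[R]_n) (r : R) i :
  0 < r -> (forall y, ball x r y -> differentiable phi y) ->
  (forall y, ball x r y -> phi x <= phi y) -> partial i phi x = 0.
Proof.
move=> r0 dphi minx.
pose e : 'rV[R]_n := delta_mx 0 i.
have inb (t : R) : t \in `]-r, r[ -> ball x r (x + t *: e).
  rewrite in_itv/= -ltr_norml => tr.
  rewrite -ball_normE /ball_/= opprD addrA subrr sub0r normrN normrZ.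
  by rewrite (le_lt_trans _ tr)// ler_piMr// norm_delta_mx.
have r0' : 0 \in `]-r, r[ by rewrite in_itv/= oppr_lt0 r0.
have d0 : differentiable phi (x + 0 *: e) by exact: dphi (inb _ r0').
have [_ H1] := is_derive_line d0.
have [|||_] := @derive1_at_min R (fun t => phi (x + t *: e)) (- r) r 0 _ _ r0'.
- by rewrite ge0_cp ?ltW.
- by move=> t tr; have [] := is_derive_line (dphi _ (inb t tr)).
- by move=> t /inb; rewrite scale0r addr0; exact: minx.
by rewrite H1 scale0r addr0 -[e]scale1r sum_delta_mx scale1r.
Qed.

Lemma sqr_norm_le (h : 'rV[R]_n) : `|h| ^+ 2 <= \sum_(i < n) h 0 i ^+ 2.
Proof.
have s0 : 0 <= \sum_(i < n) h 0 i ^+ 2 by apply: sumr_ge0 => i _; exact: sqr_ge0.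
rewrite -[leRHS]sqr_sqrtr// lerXn2r ?nnegrE ?sqrtr_ge0//.
apply: norm_mx_le => [|a k]; first exact: sqrtr_ge0.
rewrite -sqrtr_sqr ler_wsqrtr// (bigD1 k)//= ord1 lerDl.
by apply: sumr_ge0 => i _; exact: sqr_ge0.
Qed.

(* Solves f x = y near x0 by minimising the squared distance to y over a ball:
   at an interior minimum the gradient J (f x - y)^T vanishes. *)
Lemma open_map D f : open D -> (forall x, D x -> differentiable f x) ->
  {in D &, injective f} -> (forall x, D x -> jacmx f x \in unitmx) ->
  open (f @` D).
Proof.
move=> oD df injf uJ; rewrite openE => _ [x0 Dx0 <-].
have /nbhs_ballP[r' /= r'0 rD] : nbhs x0 D by exact: open_nbhs_nbhs.
pose r := r' / 2; have r0 : 0 < r by rewrite divr_gt0.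
pose B : set 'rV[R]_n := [set x | `|x - x0| <= r].
pose S : set 'rV[R]_n := [set x | `|x - x0| = r].
have BD : B `<=` D.
  move=> x Bx; apply: rD; rewrite -ball_normE /ball_/= distrC.
  by rewrite (le_lt_trans Bx)// /r ltr_pdivrMr// ltr_pMr// ltr1n.
have dist_cont : continuous (fun x : 'rV[R]_n => `|x - x0|).
  move=> x; apply: (@continuous_comp _ _ _ (fun x : 'rV[R]_n => x - x0)
    (fun x : 'rV[R]_n => `|x|)); last exact: norm_continuous.
  by apply: differentiable_continuous; apply: differentiableB.
have cB : compact B.
  apply: bounded_closed_compact.
    exists (`|x0| + r); split => [|M HM x Bx /=]; first exact: num_real.
    rewrite -(subrK x0 x) (le_trans (ler_normD _ _))// addrC ltW//.
    by apply: le_lt_trans HM; rewrite lerD2l.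
  exact: (closed_comp (fun _ _ => dist_cont _) (@closed_le R r)).
have cS : compact S.
  apply: (subclosed_compact _ cB) => [|x Sx]; last by rewrite /B/= Sx.
  exact: (closed_comp (fun _ _ => dist_cont _) (@closed_eq R r)).
have fS : closed (f @` S).
  apply: compact_closed => //; apply: continuous_compact => //.
  apply: continuous_in_subspaceT => x; rewrite inE => Sx.
  by apply: differentiable_continuous; apply: df; apply: BD; rewrite /B/= Sx.
(* Injectivity keeps [f x0] off the closed image of the sphere, hence at distance at least [e] from
   it. *)
have /nbhs_ballP[e /= e0 He] : nbhs (f x0) (~` (f @` S)).
  apply: open_nbhs_nbhs; split; first exact: closed_openC.
  move=> [x Sx] /injf; rewrite !inE => /(_ (BD x _) Dx0); rewrite /B/= Sx lexx.
  by move=> /(_ isT) xx0; move: Sx; rewrite /S/= xx0 subrr normr0 => /eqP; rewrite lt_eqF.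
(* Chosen so that [e - d] is [(n + 1) d]: on the sphere the squared distance [phi] is at least its
   square, which exceeds the bound [n d^2] for [phi x0]. The minimum is thus interior. *)
pose d := e / (n%:R + 2).
have n2 : 0 < n%:R + 2 :> R by rewrite ltr_wpDl.
have d0 : 0 < d by rewrite divr_gt0.
apply/nbhs_ballP; exists d => // y; rewrite -ball_normE /ball_/= => yd.
pose phi x := \sum_(k < n) (f x 0 k - y 0 k) ^+ 2.
have dphik k x : D x -> differentiable (fun x => f x 0 k - y 0 k) x.
  by move=> Dx; apply: differentiableB => //; apply: differentiable_entry; exact: df.
have dphi x : D x -> differentiable phi x.
  move=> Dx; apply: (@differentiable_bigsum R) => k _.
  by under eq_fun do rewrite expr2; apply: differentiableM; exact: dphik.
have [|||x1] := @EVT_min_rV R n phi B.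
- by exists x0; rewrite /B/= subrr normr0 ltW.
- exact: cB.
- apply: continuous_in_subspaceT => x; rewrite inE => /BD Dx.
  exact: differentiable_continuous (dphi x Dx).
rewrite inE => Bx1 minx1; have Dx1 := BD _ Bx1.
have phi0 : phi x0 <= n%:R * d ^+ 2.
  rewrite -[n in n%:R]card_ord mulr_natl -sumr_const; apply: ler_sum => k _.
  have H : `|f x0 0 k - y 0 k| <= d.
    by apply: le_trans (ltW yd); apply: le_trans (norm_mx_entry _ 0 k); rewrite !mxE.
  by rewrite -(real_normK (num_real (_ - _))) lerXn2r ?nnegrE// ltW.
have x1r : `|x1 - x0| < r.
  rewrite lt_neqAle [X in _ && X]Bx1 andbT; apply/negP => /eqP Sx1.
  have : e <= `|f x0 - f x1|.
    rewrite leNgt; apply/negP => lte; apply: (He (f x1)); last by exists x1.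
    by rewrite -ball_normE.
  move=> eF.
  have ed : e - d <= `|f x1 - y|.
    rewrite lerBlDr (le_trans eF)// distrC (le_trans (ler_distD y _ _))// lerD2l.
    by rewrite distrC ltW.
  have de : e = d * (n%:R + 2) by rewrite /d divfK// gt_eqF.
  have : `|f x1 - y| ^+ 2 <= phi x1.
    apply: le_trans (sqr_norm_le _) _; rewrite /phi le_eqVlt; apply/orP; left.
    by apply/eqP/eq_bigr => k _; rewrite !mxE.
  have := minx1 x0; rewrite inE /B/= subrr normr0 (ltW r0) => /(_ isT) m1 m2.
  have : (e - d) ^+ 2 <= n%:R * d ^+ 2.
    apply: le_trans (le_trans (le_trans m2 m1) phi0).
    rewrite lerXn2r// ?nnegrE// subr_ge0 de ler_pMr// -[leLHS]add0r lerD// ler1n//.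
  rewrite de -{2}[d]mulr1 -mulrBr exprMn mulrC ler_pM2r ?exprn_gt0//.
  rewrite leNgt => /negP; apply.
  have : 0 <= n%:R :> R by [].
  set N := n%:R; nra.
exists x1; first by [].
have grad i : partial i phi x1 = 0.
  have b1 z : ball x1 (r - `|x1 - x0|) z -> B z.
    rewrite -ball_normE /ball_/= /B/= => x1z.
    by rewrite (le_trans (ler_distD x1 _ _))// -lerBrDr distrC ltW.
  apply: (@partial_eq0_of_min _ _ (r - `|x1 - x0|)); first by rewrite subr_gt0.
    by move=> z /b1/BD; exact: dphi.
  by move=> z /b1 Bz; apply: minx1; rewrite inE.
have : jacmx f x1 *m (f x1 - y)^T = 0.
  apply/matrixP => i j; rewrite !mxE.
  have := grad i; rewrite /phi partial_sum => [|k _]; last first.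
    by under eq_fun do rewrite expr2; apply: differentiableM; exact: dphik.
  move=> gi; apply: (@mulIf _ 2) => //; rewrite mul0r -[RHS]gi mulr_suml.
  apply: eq_bigr => k _; under [in RHS]eq_fun do rewrite expr2.
  rewrite partialM; [|exact: dphik..].
  rewrite partialB//; last by apply: differentiable_entry; exact: df.
  by rewrite partial_cst !mxE subr0 ord1; ring.
move/(congr1 (mulmx (invmx (jacmx f x1)))); rewrite mulKmx ?uJ// mulmx0.
by move/(congr1 trmx); rewrite trmxK trmx0 => /eqP; rewrite subr_eq0 => /eqP.
Qed.

Lemma injective_of_left_inverse D f g : (forall x, D x -> g (f x) = x) ->
  {in D &, injective f}.
Proof. by move=> gK x y; rewrite !inE => Dx Dy fxy; rewrite -(gK x)// -(gK y)// fxy. Qed.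

(** With [h = y - x], the scalar product of [h] with [f] has positive derivative along the segment
    from [x] to [y], so its end values differ. The Jacobian need not be symmetric, and injectivity
    holds on all of the convex set [D]. *)
Lemma injective_of_positive D f :
  (forall x y (t : R), D x -> D y -> 0 <= t <= 1 -> D (x + t *: (y - x))) ->
  (forall x, D x -> differentiable f x) ->
  (forall x (h : 'rV[R]_n), D x -> h != 0 -> 0 < (h *m jacmx f x *m h^T) 0 0) ->
  {in D &, injective f}.
Proof.
move=> cD df pos x y; rewrite !inE => Dx Dy fxy; apply/eqP.
rewrite eq_sym -subr_eq0; apply/negPn/negP => h0.
pose h := y - x.
pose G z := \sum_(k < n) h 0 k * f z 0 k.
have dfk k z : D z -> differentiable (fun z => f z 0 k) z.
  by move=> Dz; apply: differentiable_entry; exact: df.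
have dG z : D z -> forall k, differentiable (fun z => h 0 k * f z 0 k) z.
  by move=> Dz k; apply: differentiableM => //; exact: dfk.
have [t t01|t /andP[t0 t1]] := @MVT_line _ _ G x h.
  by apply: (@differentiable_bigsum R) => k _; apply: dG; exact: cD.
have Dt : D (x + t *: h) by apply: cD => //; rewrite !ltW.
have -> : x + h = y by rewrite /h addrC subrK.
rewrite {1 2}/G fxy subrr => /esym H.
have := pos _ h Dt h0; rewrite -mulmxA mxE (eq_bigr (fun i => h 0 i * partial i G (x + t *: h))).
  by rewrite H ltxx.
move=> i _; congr (_ * _); rewrite mxE partial_sum => [|k _]; last exact: dG.
apply: eq_bigr => k _; rewrite partialM//; last exact: dfk.
by rewrite partial_cst mulr0 addr0 !mxE mulrC.
Qed.

Lemma unitmx_of_positive (A : 'M[R]_n) :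
  (forall h : 'rV[R]_n, h != 0 -> 0 < (h *m A *m h^T) 0 0) -> A \in unitmx.
Proof.
move=> pos; rewrite -row_free_unit; apply: inj_row_free => v vA.
by apply/eqP/negPn/negP => /pos; rewrite vA mul0mx mxE ltxx.
Qed.

(** The sum of squares dominates the squared sup norm of [h], while the perturbation [A - 1%:M]
    contributes at most the left-hand constant times that squared norm. *)
Lemma positive_near_id (A : 'M[R]_n) : n%:R * (n%:R * `|A - 1%:M|) < 1 ->
  forall h : 'rV[R]_n, h != 0 -> 0 < (h *m A *m h^T) 0 0.
Proof.
move=> A1 h h0.
have -> : h *m A *m h^T = h *m h^T + h *m (A - 1%:M) *m h^T.
  by rewrite mulmxBr mulmx1 mulmxBl addrC subrK.
have hT : `|h^T| <= `|h| by apply: norm_mx_le => // i j; rewrite mxE norm_mx_entry.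
have hh : `|h| ^+ 2 <= (h *m h^T) 0 0.
  rewrite mxE (eq_bigr (fun i => h 0 i ^+ 2)) ?sqr_norm_le// => i _.
  by rewrite mxE expr2.
have hp : 0 < `|h| ^+ 2 by rewrite exprn_gt0// normr_gt0.
have B : `|(h *m (A - 1%:M) *m h^T) 0 0| <= n%:R * (n%:R * `|A - 1%:M|) * `|h| ^+ 2.
  rewrite (le_trans (norm_mx_entry _ 0 0))// (le_trans (norm_mulmx _ _))//.
  rewrite -mulrA ler_wpM2l// expr2 mulrA ler_pM//.
  by rewrite (le_trans (norm_mulmx _ _))// -mulrA [`|A - _| * _]mulrC.
have Bs : n%:R * (n%:R * `|A - 1%:M|) * `|h| ^+ 2 < `|h| ^+ 2.
  by rewrite -[ltRHS]mul1r ltr_pM2r.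
rewrite mxE; move: B; rewrite ler_norml => /andP[B _].
by rewrite -ltrBlDr sub0r; apply: lt_le_trans hh; apply: le_lt_trans Bs; rewrite lerNl.
Qed.

Lemma left_inverse_exists (D : set 'rV[R]_n) (F : 'rV[R]_n -> 'rV[R]_n) :
  {in D &, injective F} -> exists G, forall x, D x -> G (F x) = x.
Proof.
move=> injF.
have /choice[G HG] y : exists x, forall z, D z -> F z = y -> x = z.
  have [[z Dz Fz]|nz] := pselect (exists2 z, D z & F z = y).
    by exists z => w Dw Fw; apply: injF; rewrite ?inE// Fz.
  by exists 0 => z Dz Fz; case: nz; exists z.
by exists G => x Dx; exact: HG.
Qed.

(** By [open_map], [f] sends small balls around [x] to neighbourhoods of [f x], and [g] sends these
    back into the balls. *)
Lemma inverse_continuous D f g : open D ->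
  (forall x, D x -> differentiable f x) -> (forall x, D x -> g (f x) = x) ->
  (forall x, D x -> jacmx f x \in unitmx) ->
  forall x, D x -> {for f x, continuous g}.
Proof.
move=> oD df gK uJ x Dx A; rewrite gK// => /nbhs_ballP[r /= r0 rA].
have oE : open (D `&` ball x r) by apply: openI => //; exact: ball_open.
have injf := injective_of_left_inverse gK.
have : open (f @` (D `&` ball x r)).
  apply: open_map => //.
  - by move=> y [Dy _]; exact: df.
  - by move=> y z; rewrite !inE => -[Dy _] [Dz _]; apply: injf; rewrite inE.
  - by move=> y [Dy _]; exact: uJ.
rewrite openE => /(_ (f x)) H.
have : nbhs (f x) (f @` (D `&` ball x r)).
  by apply: H; exists x => //; split => //; exact: ballxx.
apply: filterS => _ [z [Dz zr] <-]; rewrite /= gK//; exact: rA.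
Qed.

(** [k] and [l] are the norms of corresponding increments of [g] and of its argument, [a] the
    relative linearisation error, [b] a bound for the inverse Jacobian. As [b * a] is at most 1/2,
    the term in [k] is absorbed: [k] is at most [2 * b * l], and the error is small relative to
    [l]. *)
Let inverse_bound (b a e k l : R) :
  0 <= b -> 0 < a -> 0 <= k -> 0 <= l -> k <= b * (a * k) + b * l ->
  a * (2 * (b * b + b) + 2) <= e -> a * (2 * (b * b + b) + 2) <= 1 ->
  b * (a * k) <= e * l.
Proof.
move=> b0 a0 k0 l0 H He He1.
have abb : 0 <= a * (b * b) by rewrite mulr_ge0 ?mulr_ge0// ltW.
have ab : 0 <= a * b by rewrite mulr_ge0// ltW.
have ba1 : b * a <= 1 / 2 by nra.
have kl : k <= 2 * (b * l) by nra.
apply: (@le_trans _ _ ((b * a) * (2 * (b * l)))).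
  by rewrite mulrA ler_wpM2l// mulrC.
rewrite (_ : _ * _ = (a * (2 * (b * b))) * l); last by ring.
by rewrite ler_wpM2r//; lra.
Qed.

(** The linearisation of [f] at [x], multiplied by the inverse Jacobian [B], is read backwards as
    one of [g]. Continuity of [g] keeps the increment [k] in the range where it is valid, and
    [inverse_bound] converts an error relative to [k] into one relative to [l]. *)
Lemma inverse_differentiable D f g : open D ->
  (forall x, D x -> differentiable f x) -> (forall x, D x -> g (f x) = x) ->
  (forall x, D x -> jacmx f x \in unitmx) ->
  forall x, D x -> differentiable g (f x) /\
    forall i, partial i g (f x) = row i (invmx (jacmx f x)).
Proof.
move=> oD df gK uJ x Dx; apply: differentiable_of_expansion => e e0.
set A := jacmx f x; set B := invmx A.
have injf := injective_of_left_inverse gK.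
have ofD : open (f @` D) by exact: open_map.
have ntf : nbhs (f x) (f @` D) by apply: open_nbhs_nbhs; split=> //; exists x.
have cg := inverse_continuous oD df gK uJ Dx.
pose b := n%:R * `|B|.
have b0 : 0 <= b by rewrite mulr_ge0.
pose e1 := Num.min 1 e / (2 * (b * b + b) + 2).
have den0 : 0 < 2 * (b * b + b) + 2 by rewrite ltr_wpDl// mulr_ge0// addr_ge0// mulr_ge0.
have e10 : 0 < e1 by rewrite divr_gt0// lt_min ltr01.
have [_ E] := (diff_locallyP _ _).1 (df x Dx).
have /eqaddoP/(_ _ e10)/nbhs_ballP[s /= s0 Hs] := E.
have : nbhs (f x) (g @^-1` ball x s) by apply: cg; rewrite gK//; exact: nbhsx_ballx.
move=> /(filterI ntf)/nbhs_ballP[r /= r0 Hr].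
apply/nbhs_ballP; exists r => // l; rewrite -ball_normE /ball_/= sub0r normrN => lr.
have : ball (f x) r (l + f x) by rewrite -ball_normE /ball_/= opprD addrCA subrr addr0 normrN.
move=> /Hr[[z Dz fz]]; rewrite /= -fz gK// => xz.
pose k := z - x.
have := Hs k; rewrite -ball_normE /ball_/= sub0r normrN.
move: xz; rewrite -ball_normE /ball_/= distrC => /[swap]/[apply].
have -> : (f \o shift x - (cst (f x) + 'd f x)) k = l - k *m A.
  rewrite [LHS](_ : _ = f (k + x) - (f x + 'd f x k))//.
  by rewrite jacmxE; [rewrite /k subrK fz opprD addrA addrK|exact: df].
move=> Hk.
rewrite gK// -/k.
have -> : \sum_(i < n) l 0 i *: row i B = l *m B by rewrite mulmx_sum_row.
have kl : k - l *m B = - ((l - k *m A) *m B).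
  by rewrite mulmxBl opprB /B -mulmxA mulmxV ?uJ// mulmx1.
have H1 : `|k - l *m B| <= b * (e1 * `|k|).
  rewrite kl normrN (le_trans (norm_mulmx _ _))// /b -mulrA ler_wpM2l//.
  by rewrite mulrC ler_wpM2l.
have H2 : `|l *m B| <= b * `|l|.
  by rewrite (le_trans (norm_mulmx _ _))// /b -mulrA [`|l| * _]mulrC.
have H3 : `|k| <= b * (e1 * `|k|) + b * `|l|.
  by rewrite -{1}(subrK (l *m B) k) (le_trans (ler_normD _ _))// lerD.
have e1E : e1 * (2 * (b * b + b) + 2) <= Num.min 1 e.
  by rewrite /e1 divfK// gt_eqF.
have : e1 * (2 * (b * b + b) + 2) <= 1 by rewrite (le_trans e1E)// ge_min lexx.
have : e1 * (2 * (b * b + b) + 2) <= e by rewrite (le_trans e1E)// ge_min lexx orbT.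
move=> He He1; apply: (le_trans H1).
exact: inverse_bound b0 e10 _ _ H3 He He1.
Qed.

(** Bootstrapping: the partials of [g] are entries of the inverse Jacobian of [f] composed with [g],
    so they are as regular as [g]. *)
Lemma inverse_smooth D f g : open D -> smooth_on D f ->
  (forall x, D x -> g (f x) = x) -> (forall x, D x -> jacmx f x \in unitmx) ->
  smooth_on (f @` D) g.
Proof.
move=> oD sf gK uJ.
have df x : D x -> differentiable f x by exact: smooth_differentiable.
have injf := injective_of_left_inverse gK.
have ofD : open (f @` D) by exact: open_map.
have dg := inverse_differentiable oD df gK uJ.
have sJ i j : smooth_on D (fun x => invmx (jacmx f x) i j).
  apply: smooth_invmx => // k l; under eq_fun do rewrite mxE.
  by apply: smooth_partial; exact: smooth_entry.
apply/CkP; elim=> [|k IHk]; first by move=> _ [x Dx <-]; have [] := dg x Dx.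
split=> [_ [x Dx <-]|i]; first by have [] := dg x Dx.
apply: Ck_mx => // a j.
have : Ck k (f @` D) ((fun x => invmx (jacmx f x) i j) \o g).
  have gD y : (f @` D) y -> D (g y) by move=> [x Dx <-]; rewrite gK.
  by apply: Ck_comp ofD gD IHk _; have /CkP := sJ i j; exact.
apply: Ck_ext => // y; rewrite inE => -[x Dx <-].
by have [_ ->] := dg x Dx; rewrite /= gK// !mxE.
Qed.

End InverseFunction.

(** * Charts and tangent vectors *)

Section Charts.
Context {R : realType} {n : nat} {M : manifold R n}.
Implicit Types (phi psi : chart R n M) (U V : set M) (f : M -> R).

Lemma chart_image_open phi U :
  open U -> open (chart_map phi @` (U `&` chart_dom phi)).
Proof.
move=> oU; rewrite openE => _ [p [Up pd] <-].
have ip : (chart_map phi @` chart_dom phi) (chart_map phi p) by exists p.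
have : nbhs (chart_map phi p) (chart_map phi @` chart_dom phi).
  by apply: open_nbhs_nbhs; split=> //; exact: chart_img_open.
have : nbhs (chart_map phi p) (chart_inv phi @^-1` U).
  apply: (@chart_inv_continuous _ _ _ phi); first by rewrite inE.
  by rewrite chartK ?inE//; exact: open_nbhs_nbhs.
apply: filterS2 => y /= Uy [q qd qy]; exists q => //; split=> //.
by move: Uy; rewrite -qy chartK ?inE.
Qed.

Lemma chart_image_openS phi U :
  open U -> U `<=` chart_dom phi -> open (chart_map phi @` U).
Proof. by move=> oU Ud; rewrite -(setIidl Ud); exact: chart_image_open. Qed.

Lemma smooth_fun_sub U V f : V `<=` U -> smooth_fun U f -> smooth_fun V f.
Proof.
move=> VU sf phi aphi; apply: smooth_sub (sf phi aphi).
by apply: image_subset => p [/VU].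
Qed.

Lemma smooth_fun_ext U f f' :
  open U -> {in U, f =1 f'} -> smooth_fun U f -> smooth_fun U f'.
Proof.
move=> oU ff' sf phi aphi; apply: smooth_ext (sf phi aphi).
  exact: chart_image_open.
move=> y; rewrite inE => -[p [Up pd] <-].
by rewrite /= chartK ?inE// ff' ?inE.
Qed.

Lemma smooth_fun_cst U (c : R) : smooth_fun U (fun=> c).
Proof. by move=> phi _; exact: smooth_cst. Qed.

Lemma smooth_funD U f f' : open U -> smooth_fun U f -> smooth_fun U f' ->
  smooth_fun U (fun p => f p + f' p).
Proof.
move=> oU sf sf' phi aphi; apply: smoothD; first exact: chart_image_open.
  exact: sf.
exact: sf'.
Qed.

Lemma smooth_funM U f f' : open U -> smooth_fun U f -> smooth_fun U f' ->
  smooth_fun U (fun p => f p * f' p).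
Proof.
move=> oU sf sf' phi aphi; apply: smoothM; first exact: chart_image_open.
  exact: sf.
exact: sf'.
Qed.

Lemma atlas_coordinate phi : atlas phi -> coordinate_system phi.
Proof. by move=> ? psi ?; exact: atlas_compatible. Qed.

(** [smooth_fun] tests only charts of the atlas; near each point a smooth transition from an atlas
    chart extends the test to every chart of the maximal atlas. *)
Lemma smooth_in_chart phi U f : coordinate_system phi -> open U ->
  smooth_fun U f ->
  smooth_on (chart_map phi @` (U `&` chart_dom phi)) (f \o chart_inv phi).
Proof.
move=> cphi oU sf; apply: smooth_local => _ [p [Up pd] <-].
have [psi apsi ppsi] := atlas_cover p.
pose V := U `&` chart_dom psi.
have oV : open V by apply: openI => //; exact: chart_dom_open.
exists (chart_map phi @` (V `&` chart_dom phi)); first by exists p.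
have oD := chart_image_open (phi := phi) oV.
have s1 : smooth_on (chart_map phi @` (V `&` chart_dom phi))
            (chart_map psi \o chart_inv phi).
  apply: smooth_sub (cphi psi apsi).1.
  by apply: image_subset => q [[_ ?] ?].
have : smooth_on (chart_map phi @` (V `&` chart_dom phi))
   ((f \o chart_inv psi) \o (chart_map psi \o chart_inv phi)).
  apply: smooth_comp s1 (sf psi apsi) => // _ [q [[Uq qpsi] qphi] <-].
  by rewrite /= chartK ?inE//; exists q.
apply: smooth_ext => // y; rewrite inE => -[q [[Uq qpsi] qphi] <-].
by rewrite /= (chartK (c := phi)) ?inE// chartK ?inE.
Qed.

Lemma smooth_in_chartS phi U f : coordinate_system phi -> open U ->
  U `<=` chart_dom phi -> smooth_fun U f ->
  smooth_on (chart_map phi @` U) (f \o chart_inv phi).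
Proof. by move=> cphi oU Ud sf; rewrite -(setIidl Ud); exact: smooth_in_chart. Qed.

Lemma smooth_of_chart phi U f : coordinate_system phi -> open U ->
  U `<=` chart_dom phi ->
  smooth_on (chart_map phi @` U) (f \o chart_inv phi) -> smooth_fun U f.
Proof.
move=> cphi oU Ud sf psi apsi.
have oD := chart_image_open (phi := psi) oU.
have s1 : smooth_on (chart_map psi @` (U `&` chart_dom psi))
            (chart_map phi \o chart_inv psi).
  apply: smooth_sub (cphi psi apsi).2.
  by apply: image_subset => q [/Ud].
have : smooth_on (chart_map psi @` (U `&` chart_dom psi))
   ((f \o chart_inv phi) \o (chart_map phi \o chart_inv psi)).
  apply: smooth_comp s1 sf => // _ [q [Uq qpsi] <-].
  by rewrite /= chartK ?inE//; exists q.
apply: smooth_ext => // y; rewrite inE => -[q [Uq qpsi] <-].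
by rewrite /= (chartK (c := psi)) ?inE// chartK ?inE//; exact: Ud.
Qed.

(** The test function on which a tangent vector takes its [j]-th component as value. *)
Definition coordinate phi (j : 'I_n) : M -> R := fun q => chart_map phi q 0 j.

Lemma smooth_coordinate phi j : coordinate_system phi ->
  smooth_fun (chart_dom phi) (coordinate phi j).
Proof.
move=> cphi; apply: (smooth_of_chart cphi) => //; first exact: chart_dom_open.
have oD := @chart_img_open _ _ _ phi.
have : smooth_on (chart_map phi @` chart_dom phi) (fun y : 'rV[R]_n => y 0 j).
  by apply: smooth_entry => //; exact: smooth_id.
apply: smooth_ext => // y; rewrite inE => -[q qd <-].
by rewrite /coordinate /= chartK ?inE.
Qed.

Lemma smooth_near_open U f p : open U -> U p -> smooth_fun U f -> smooth_near p f.
Proof. by move=> oU Up sf; exists U. Qed.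

Lemma smooth_near_coordinate phi j p : coordinate_system phi ->
  chart_dom phi p -> smooth_near p (coordinate phi j).
Proof.
move=> cphi pd; apply: smooth_near_open pd (smooth_coordinate j cphi).
exact: chart_dom_open.
Qed.

Lemma smooth_near_differentiable phi f p : coordinate_system phi ->
  chart_dom phi p -> smooth_near p f ->
  differentiable (f \o chart_inv phi) (chart_map phi p).
Proof.
move=> cphi pd [U [oU Up] sf].
apply: smooth_differentiable (smooth_in_chart cphi oU sf) _.
by exists p.
Qed.

Lemma coord_fieldE phi i p f : smooth_near p f ->
  coord_field phi i p f = partial i (f \o chart_inv phi) (chart_map phi p).
Proof. by move=> sf; rewrite /coord_field asboolT. Qed.

Lemma coord_field_rough phi i p f : ~ smooth_near p f -> coord_field phi i p f = 0.
Proof. by move=> nsf; rewrite /coord_field asboolF. Qed.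

Lemma near_chart_inv phi p U : open U -> U p -> chart_dom phi p ->
  \forall y \near chart_map phi p,
    exists2 q, (U `&` chart_dom phi) q & chart_map phi q = y.
Proof.
move=> oU Up pd.
have : nbhs (chart_map phi p) (chart_map phi @` (U `&` chart_dom phi)).
  by apply: open_nbhs_nbhs; split; [exact: chart_image_open|exists p].
by apply: filterS => y [q Hq <-]; exists q.
Qed.

Lemma sum_functionalE (I : Type) (r : seq I) (c : I -> R)
    (F : I -> functional M) f :
  (\sum_(i <- r) c i *: F i) f = \sum_(i <- r) c i * F i f.
Proof. by elim: r => [|i r IH]; rewrite ?big_nil// !big_cons -IH. Qed.

Lemma coord_field_change phi psi i p :
  coordinate_system phi -> coordinate_system psi ->
  chart_dom phi p -> chart_dom psi p ->
  coord_field phi i p =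
  \sum_(j < n) coord_field phi i p (coordinate psi j) *: coord_field psi j p.
Proof.
move=> cphi cpsi pphi ppsi; apply/funext => f; rewrite sum_functionalE.
(* On functions that are not smooth near [p] both sides are 0 by the convention in [coord_field]. *)
have [sf|nsf] := pselect (smooth_near p f); last first.
  rewrite coord_field_rough// big1// => j _.
  by rewrite (coord_field_rough psi)// mulr0.
have dT : differentiable (chart_map psi \o chart_inv phi) (chart_map phi p).
  apply: differentiable_mx => a j; rewrite ord1.
  exact: (smooth_near_differentiable cphi pphi (smooth_near_coordinate j cpsi ppsi)).
have E : (chart_map psi \o chart_inv phi) (chart_map phi p) = chart_map psi p.
  by rewrite /= chartK ?inE.
rewrite coord_fieldE// (@near_eq_partial _ _ _ _ ((f \o chart_inv psi) \o (chart_map psi \o chart_inv phi))); last first.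
  have := near_chart_inv (@chart_dom_open _ _ _ psi) ppsi pphi.
  apply: filterS => y [q [qpsi qphi] <-].
  by rewrite /= (chartK (c := phi)) ?inE// chartK ?inE.
rewrite partial_comp//; last by rewrite E; exact: smooth_near_differentiable.
apply: eq_bigr => j _; rewrite E !coord_fieldE//; last exact: smooth_near_coordinate.
Qed.

Lemma coord_field_coordinate phi i j p :
  coordinate_system phi -> chart_dom phi p ->
  coord_field phi i p (coordinate phi j) = (i == j)%:R.
Proof.
move=> cphi pd; rewrite coord_fieldE; last exact: smooth_near_coordinate.
rewrite -(partial_coord i j (chart_map phi p)); apply: near_eq_partial.
have := near_chart_inv openT I pd.
by apply: filterS => y [q [_ qd] <-]; rewrite /coordinate/= chartK ?inE.
Qed.

(** Tangency only provides some unspecified chart; the change of chart rewrites its coordinate basis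
    in that of [phi], whose coefficients are values on coordinate functions. *)
Lemma tangent_coord phi p v : coordinate_system phi -> chart_dom phi p ->
  tangent p v -> v = \sum_(j < n) v (coordinate phi j) *: coord_field phi j p.
Proof.
move=> cphi pphi [psi [cpsi ppsi [a ->]]].
under [RHS]eq_bigr do rewrite sum_functionalE scaler_suml.
rewrite exchange_big; apply: eq_bigr => i _ /=.
rewrite {1}(coord_field_change _ cpsi cphi ppsi pphi) scaler_sumr.
by apply: eq_bigr => j _; rewrite scalerA.
Qed.

Lemma tangent_sum phi p (a : 'I_n -> R) : coordinate_system phi ->
  chart_dom phi p -> tangent p (\sum_(j < n) a j *: coord_field phi j p).
Proof.
move=> cphi pd; exists phi; split=> //; exists (\row_j a j).
by apply: eq_bigr => j _; rewrite mxE.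
Qed.

Lemma tangent_coord_field phi p i : coordinate_system phi ->
  chart_dom phi p -> tangent p (coord_field phi i p).
Proof.
move=> cphi pd.
have -> : coord_field phi i p = \sum_(j < n) (i == j)%:R *: coord_field phi j p.
  rewrite (bigD1 i)//= eqxx scale1r big1 ?addr0// => j ji.
  by rewrite eq_sym (negbTE ji) scale0r.
exact: tangent_sum.
Qed.

Lemma tangentD (p : M) v w : tangent p v -> tangent p w -> tangent p (v + w).
Proof.
move=> tv tw; have [phi aphi pphi] := atlas_cover p.
have cphi := atlas_coordinate aphi.
rewrite (tangent_coord cphi pphi tv) (tangent_coord cphi pphi tw) -big_split/=.
under eq_bigr do rewrite -scalerDl.
exact: tangent_sum.
Qed.

Lemma tangentZ (p : M) (a : R) v : tangent p v -> tangent p (a *: v).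
Proof.
move=> tv; have [phi aphi pphi] := atlas_cover p.
have cphi := atlas_coordinate aphi.
rewrite (tangent_coord cphi pphi tv) scaler_sumr.
under eq_bigr do rewrite scalerA.
exact: tangent_sum.
Qed.

Lemma tangent0 (p : M) : tangent p 0.
Proof.
have [phi aphi pphi] := atlas_cover p.
have := tangent_sum (fun=> 0) (atlas_coordinate aphi) pphi.
by rewrite big1// => j _; rewrite scale0r.
Qed.

Lemma vector_field_sub U V (X : vfield M) :
  V `<=` U -> vector_field U X -> vector_field V X.
Proof.
move=> VU [tX sX]; split=> [p /VU|W f oW WV]; first exact: tX.
by apply: sX => //; exact: subset_trans VU.
Qed.

Lemma vector_field0 U : vector_field U (fun=> 0 : functional M).
Proof. by split=> [p _|V f oV VU sf]; [exact: tangent0|exact: smooth_fun_cst]. Qed.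

Lemma vector_fieldD U (X Y : vfield M) :
  vector_field U X -> vector_field U Y -> vector_field U (fun p => X p + Y p).
Proof.
move=> [tX sX] [tY sY]; split=> [p Up|V f oV VU sf].
  by apply: tangentD; [exact: tX|exact: tY].
by apply: smooth_funD => //; [exact: sX|exact: sY].
Qed.

Lemma vector_fieldZ U (a : M -> R) (X : vfield M) : open U -> smooth_fun U a ->
  vector_field U X -> vector_field U (fun p => a p *: X p).
Proof.
move=> oU sa [tX sX]; split=> [p Up|V f oV VU sf]; first by apply: tangentZ; exact: tX.
by apply: smooth_funM => //; [exact: smooth_fun_sub VU sa|exact: sX].
Qed.

Lemma vector_field_sum U (I : Type) (r : seq I) (X : I -> vfield M) :
  (forall i, vector_field U (X i)) -> vector_field U (fun p => \sum_(i <- r) X i p).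
Proof.
move=> vX; elim: r => [|i r IHr].
  by under eq_fun do rewrite big_nil; exact: vector_field0.
by under eq_fun do rewrite big_cons; exact: vector_fieldD.
Qed.

Lemma vector_field_coord phi i : coordinate_system phi ->
  vector_field (chart_dom phi) (coord_field phi i).
Proof.
move=> cphi; split=> [p pd|V f oV VU sf]; first exact: tangent_coord_field.
apply: (smooth_of_chart cphi) => //.
apply: smooth_ext (smooth_partial i (smooth_in_chartS cphi oV VU sf)).
  exact: chart_image_openS.
move=> y; rewrite inE => -[q Vq <-].
rewrite /= /derive_along chartK ?inE//; last exact: VU.
by rewrite coord_fieldE//; exact: smooth_near_open Vq sf.
Qed.

Lemma smooth_component U (X : vfield M) phi j : open U -> coordinate_system phi ->
  U `<=` chart_dom phi -> vector_field U X ->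
  smooth_fun U (derive_along X (coordinate phi j)).
Proof.
move=> oU cphi Ud [_ sX]; apply: sX => //.
exact: smooth_fun_sub Ud (smooth_coordinate j cphi).
Qed.

Lemma vector_field_expand U (X : vfield M) phi : coordinate_system phi ->
  U `<=` chart_dom phi -> vector_field U X ->
  {in U, forall p, X p = \sum_(j < n) derive_along X (coordinate phi j) p *: coord_field phi j p}.
Proof.
move=> cphi Ud [tX _] p; rewrite inE => Up.
by apply: tangent_coord => //; [exact: Ud|exact: tX].
Qed.

Lemma derive_along_coord phi i f U : coordinate_system phi -> open U ->
  U `<=` chart_dom phi -> smooth_fun U f ->
  {in U, forall p, derive_along (coord_field phi i) f p =
     partial i (f \o chart_inv phi) (chart_map phi p)}.
Proof.
move=> cphi oU Ud sf p; rewrite inE => Up; rewrite /derive_along coord_fieldE//.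
exact: smooth_near_open Up sf.
Qed.

Lemma coord_field_ext phi i p V f f' : coordinate_system phi -> chart_dom phi p ->
  smooth_near p f -> open V -> V p -> {in V, f =1 f'} ->
  coord_field phi i p f = coord_field phi i p f'.
Proof.
move=> cphi pd sf oV Vp ff'; have [U [oU Up] sfU] := sf.
have oW : open (U `&` V) by exact: openI.
have sf' : smooth_near p f'.
  apply: (@smooth_near_open (U `&` V)) => //.
  apply: smooth_fun_ext oW _ (smooth_fun_sub _ sfU) => [q|q []//].
  by rewrite inE => -[_ Vq]; apply: ff'; rewrite inE.
rewrite !coord_fieldE//; apply: near_eq_partial.
have := near_chart_inv oV Vp pd.
by apply: filterS => y [q [Vq qd] <-]; rewrite /= chartK ?inE// ff' ?inE.
Qed.

(** Schwarz' theorem in the chart. Being an equality of functionals, it also covers rough functions,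
    where the bracket is 0 by definition. *)
Lemma bracket_coord phi i j p : coordinate_system phi -> chart_dom phi p ->
  bracket (coord_field phi i) (coord_field phi j) p = 0.
Proof.
move=> cphi pd; apply/funext => f; rewrite /bracket.
case: asboolP => // -[U' [oU' U'p] sf'].
pose U := U' `&` chart_dom phi.
have oU : open U by apply: openI => //; exact: chart_dom_open.
have sf : smooth_fun U f by apply: smooth_fun_sub sf' => q [].
have Ud : U `<=` chart_dom phi by move=> q [].
have Up : U p by split.
have oD := chart_image_openS oU Ud.
have sF := smooth_in_chartS cphi oU Ud sf.
have sd k : smooth_fun U (derive_along (coord_field phi k) f).
  by have [_] := vector_field_coord k cphi; apply.
have E k l : coord_field phi k p (derive_along (coord_field phi l) f) =
    partial k (partial l (f \o chart_inv phi)) (chart_map phi p).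
  rewrite coord_fieldE; last exact: smooth_near_open Up (sd l).
  apply: near_eq_partial; have := near_chart_inv oU Up pd.
  apply: filterS => y [q [Uq qd] <-].
  rewrite /= chartK ?inE//.
  by rewrite (derive_along_coord l cphi oU Ud sf)// inE.
rewrite !E (partialC (D := chart_map phi @` U) i j) ?subrr//.
- by move=> y; exact: smooth_differentiable.
- by move=> k y; apply: smooth_differentiable; exact: smooth_partial.
- move=> k l; apply: smooth_differentiable (smooth_partial _ (smooth_partial _ sF)) _.
  by exists p.
Qed.

End Charts.

(** * New charts obtained by composing a chart with a local diffeomorphism *)

Section ChartComposition.
Context {R : realType} {n : nat} {M : manifold R n}.

Lemma smooth_compV {m k} (D : set 'rV[R]_n) (E : set 'rV[R]_m)
    (g : 'rV[R]_n -> 'rV[R]_m) (f : 'rV[R]_m -> 'rV[R]_k) :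
  open D -> open E -> (forall x, D x -> E (g x)) -> smooth_on D g ->
  smooth_on E f -> smooth_on D (f \o g).
Proof.
move=> oD oE gE sg sf; apply: smooth_mx => // i j.
exact: smooth_comp oD gE sg (smooth_entry i j oE sf).
Qed.

(** [G] is any left inverse on [D]; its smoothness and the openness of the image come from the
    inverse function results. It yields the affine chart, its restriction to a ball (with [F] the
    identity) and the dual chart (with [F] a gradient). *)
Lemma chart_comp (phi : chart R n M) (D : set 'rV[R]_n)
    (F G : 'rV[R]_n -> 'rV[R]_n) :
  coordinate_system phi -> open D -> D `<=` chart_map phi @` chart_dom phi ->
  smooth_on D F -> (forall x, D x -> G (F x) = x) ->
  (forall x, D x -> jacmx F x \in unitmx) ->
  exists eta : chart R n M, [/\ coordinate_system eta,
    chart_dom eta = chart_dom phi `&` chart_map phi @^-1` D,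
    chart_map eta = F \o chart_map phi & chart_inv eta = chart_inv phi \o G].
Proof.
move=> cphi oD Dphi sF GK uJ.
have dF x : D x -> differentiable F x by exact: smooth_differentiable.
have injF := injective_of_left_inverse GK.
have sG := inverse_smooth oD sF GK uJ.
have cG := inverse_continuous oD dF GK uJ.
have oFD : open (F @` D) by exact: open_map.
pose U := chart_dom phi `&` chart_map phi @^-1` D.
have oU : open U.
  rewrite openE => p [pd Dp].
  have : nbhs p (chart_dom phi).
    by apply: open_nbhs_nbhs; split => //; exact: chart_dom_open.
  have : nbhs p (chart_map phi @^-1` D).
    by apply: (@chart_continuous _ _ _ phi); [rewrite inE|exact: open_nbhs_nbhs].
  exact: filterS2.
have img : (F \o chart_map phi) @` U = F @` D.
  apply/seteqP; split=> [_ [p [pd Dp] <-]|_ [x Dx <-]]; first by exists (chart_map phi p).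
  by have [p pd px] := Dphi x Dx; exists p; [split=> //=; rewrite px|rewrite /= px].
have oimg : open ((F \o chart_map phi) @` U) by rewrite img.
have K : {in U, cancel (F \o chart_map phi) (chart_inv phi \o G)}.
  by move=> p; rewrite inE => -[pd Dp]; rewrite /= GK// chartK ?inE.
have cmap : {in U, continuous (F \o chart_map phi)}.
  move=> p; rewrite inE => -[pd Dp]; apply: continuous_comp.
    by apply: (@chart_continuous _ _ _ phi); rewrite inE.
  by apply: differentiable_continuous; exact: dF.
have cinv : {in (F \o chart_map phi) @` U, continuous (chart_inv phi \o G)}.
  move=> y; rewrite inE => -[p [pd Dp] <-].
  apply: continuous_comp; first exact: cG.
  rewrite /= GK//; apply: (@chart_inv_continuous _ _ _ phi).
  by rewrite inE; exists p.
exists (Chart oU oimg K cmap cinv); split=> // psi apsi; split=> /=.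
- have oE : open (chart_map phi @` (chart_dom phi `&` chart_dom psi)).
    by apply: chart_image_openS => [|p []//]; apply: openI; exact: chart_dom_open.
  have oW : open ((F \o chart_map phi) @` (U `&` chart_dom psi)).
    have oUp : open (U `&` chart_dom psi) by apply: openI => //; exact: chart_dom_open.
    rewrite -image_comp; apply: open_map.
    + by apply: chart_image_openS => // p [[]].
    + by move=> _ [p [[pd Dp] _] <-]; exact: dF.
    + move=> x y; rewrite !inE => -[p [[pd Dp] _] <-] [q [[qd Dq] _] <-].
      by apply: injF; rewrite inE.
    + by move=> _ [p [[pd Dp] _] <-]; exact: uJ.
  apply: (smooth_compV oW oE (g := G) (f := chart_map psi \o chart_inv phi)).
  + by move=> _ [p [[pd Dp] pp] <-]; rewrite /= GK//; exists p.
  + apply: smooth_sub sG; rewrite -img.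
    by apply: image_subset => p [].
  + exact: (cphi psi apsi).1.
- have oW := chart_image_open (phi := psi) oU.
  apply: (smooth_compV oW oD (g := chart_map phi \o chart_inv psi) (f := F)) => //.
  + by move=> _ [p [[pd Dp] pp] <-]; rewrite /= chartK ?inE.
  + apply: smooth_sub (cphi psi apsi).2.
    by apply: image_subset => p [[]].
Qed.

End ChartComposition.

(** * Affine charts of flat connections *)

Section Connections.
Context {R : realType} {n : nat} {M : manifold R n}.
Context {nabla : vfield M -> vfield M -> vfield M} (conn : affine_connection nabla).
Implicit Types (phi : chart R n M) (U : set M) (X Y : vfield M).

Lemma nabla0l U Y : open U -> vector_field U Y ->
  {in U, forall p, nabla (fun=> 0) Y p = 0}.
Proof.
move=> oU vY p Up; have v0 := vector_field0 (M := M) U.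
have := connection_linear conn oU (smooth_fun_cst (U := U) 1) v0 v0 vY Up.
have -> : (fun p : M => 1 *: 0 + 0) = (fun=> 0) :> vfield M.
  by apply/funext => q; rewrite scaler0 addr0.
by rewrite scale1r => /esym/eqP; rewrite -subr_eq0 addrK => /eqP.
Qed.

Lemma nabla0r U X : open U -> vector_field U X ->
  {in U, forall p, nabla X (fun=> 0) p = 0}.
Proof.
move=> oU vX p Up; have v0 := vector_field0 (M := M) U.
have := connection_additive conn oU vX v0 v0 Up.
have -> : (fun p : M => 0 + 0) = (fun=> 0) :> vfield M.
  by apply/funext => q; rewrite addr0.
by move=> /esym/eqP; rewrite -subr_eq0 addrK => /eqP.
Qed.

Lemma nabla_suml U (I : Type) (r : seq I) (a : I -> M -> R) (X : I -> vfield M) Y :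
  open U -> (forall i, smooth_fun U (a i)) -> (forall i, vector_field U (X i)) ->
  vector_field U Y ->
  {in U, forall p, nabla (fun q => \sum_(i <- r) a i q *: X i q) Y p =
                   \sum_(i <- r) a i p *: nabla (X i) Y p}.
Proof.
move=> oU sa vX vY p Up; elim: r => [|i r IHr].
  by under eq_fun do rewrite big_nil; rewrite big_nil; exact: nabla0l Up.
under [X in nabla X _]eq_fun do rewrite big_cons.
rewrite big_cons -IHr.
apply: (connection_linear conn oU (sa i) (vX i) _ vY Up).
by apply: vector_field_sum => j; exact: vector_fieldZ.
Qed.

Lemma nabla_sumr U (I : Type) (r : seq I) (b : I -> M -> R) X (Y : I -> vfield M) :
  open U -> (forall i, smooth_fun U (b i)) -> vector_field U X ->
  (forall i, vector_field U (Y i)) ->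
  {in U, forall p, nabla X (fun q => \sum_(i <- r) b i q *: Y i q) p =
     \sum_(i <- r) (derive_along X (b i) p *: Y i p + b i p *: nabla X (Y i) p)}.
Proof.
move=> oU sb vX vY p Up; elim: r => [|i r IHr].
  by under eq_fun do rewrite big_nil; rewrite big_nil; exact: nabla0r Up.
under [X in nabla _ X]eq_fun do rewrite big_cons.
rewrite big_cons -IHr -(connection_Leibniz conn oU (sb i) vX (vY i) Up).
apply: (connection_additive conn oU vX _ _ Up); first exact: vector_fieldZ.
by apply: vector_field_sum => j; exact: vector_fieldZ.
Qed.

(** A connection is linear over functions in its first argument, so being parallel is tested on
    coordinate fields. *)
Lemma nabla_coord_eq0 phi U X Y : coordinate_system phi -> open U ->
  U `<=` chart_dom phi -> vector_field U Y ->
  (forall i, {in U, forall p, nabla (coord_field phi i) Y p = 0}) ->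
  vector_field U X -> {in U, forall p, nabla X Y p = 0}.
Proof.
move=> cphi oU Ud vY nY vX p Up.
rewrite (connection_local conn oU vX vY (vector_field_expand cphi Ud vX) (fun q _ => erefl))//.
rewrite (nabla_suml _ oU _ _ vY Up).
- by apply: big1 => i _; rewrite nY// scaler0.
- by move=> i; exact: smooth_component.
- by move=> i; exact: vector_field_sub Ud (vector_field_coord i cphi).
Qed.

(** The Christoffel symbol with lower indices [a], [b] and upper index [d]. *)
Definition christoffel phi (a b d : 'I_n) : M -> R :=
  derive_along (nabla (coord_field phi a) (coord_field phi b)) (coordinate phi d).

Section Coordinates.
Context {phi : chart R n M} (cphi : coordinate_system phi).
Let U := chart_dom phi.
Let E := coord_field phi.
Let oU : open U. Proof. exact: chart_dom_open. Qed.
Let vE i : vector_field U (E i). Proof. exact: vector_field_coord. Qed.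
Let vnabla a b : vector_field U (nabla (E a) (E b)).
Proof. exact: connection_field. Qed.

Lemma smooth_christoffel a b d : smooth_fun U (christoffel phi a b d).
Proof. exact: smooth_component. Qed.

Lemma christoffelE a b : {in U, forall p,
  nabla (E a) (E b) p = \sum_d christoffel phi a b d p *: E d p}.
Proof. exact: vector_field_expand. Qed.

Lemma christoffelC a b d : torsion_free nabla ->
  {in U, forall p, christoffel phi a b d p = christoffel phi b a d p}.
Proof.
move=> tor p Up; have := tor U _ _ oU (vE a) (vE b) p Up.
have pd : chart_dom phi p by rewrite inE in Up.
rewrite (bracket_coord a b cphi pd) => /eqP; rewrite subr_eq0 => /eqP E'.
by rewrite /christoffel /derive_along E'.
Qed.

Lemma nabla2_coordinate c a b e : {in U, forall p,
  nabla (E c) (nabla (E a) (E b)) p (coordinate phi e) =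
  derive_along (E c) (christoffel phi a b e) p +
    \sum_d christoffel phi a b d p * christoffel phi c d e p}.
Proof.
move=> p Up.
rewrite (connection_local conn oU (vE c) (vnabla a b) (fun q _ => erefl) (christoffelE a b))//.
rewrite (nabla_sumr _ oU _ (vE c) vE Up); last by move=> d; exact: smooth_christoffel.
rewrite big_split/= -[LHS]/(_ (coordinate phi e) + _ (coordinate phi e)) !sum_functionalE.
have EE d : E d p (coordinate phi e) = (d == e)%:R.
  by apply: coord_field_coordinate => //; rewrite inE in Up.
congr (_ + _); rewrite (bigD1 e)//= EE eqxx mulr1 big1 ?addr0// => d de.
by rewrite EE (negbTE de) mulr0.
Qed.

(** Coordinate fields commute, so the bracket term of the curvature drops out. What remains is the
    integrability condition for the system whose matrices are [christoffel phi a b d] with row [b]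
    and column [d]. *)
Lemma christoffel_flat c a b e : flat nabla -> {in U, forall p,
  derive_along (E c) (christoffel phi a b e) p +
    \sum_d christoffel phi a b d p * christoffel phi c d e p =
  derive_along (E a) (christoffel phi c b e) p +
    \sum_d christoffel phi c b d p * christoffel phi a d e p}.
Proof.
move=> fl p Up.
apply: etrans (esym (nabla2_coordinate c a b e Up)) _.
apply: etrans (nabla2_coordinate a c b e Up).
have := fl U _ _ _ oU (vE c) (vE a) (vE b) p Up.
have -> : nabla (bracket (E c) (E a)) (E b) p = 0.
  have v0 := vector_field0 (M := M) U.
  rewrite -(nabla0l oU (vE b) Up); apply/esym.
  apply: (connection_local conn oU v0 (vE b) _ _ Up) => // q; rewrite inE => Uq.
  by rewrite (bracket_coord c a cphi Uq).
by rewrite subr0 => /eqP; rewrite subr_eq0 => /eqP H; rewrite H.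
Qed.

End Coordinates.

(** Column [j] of the unknown matrix [u] holds the components of the differential of the [j]-th new
    coordinate, and the system says that this form is parallel. Duality with the coordinate fields
    then makes the latter parallel. *)
Theorem affine_chart_exists (p0 : M) : torsion_free nabla -> flat nabla ->
  exists2 eta : chart R n M, chart_dom eta p0 & affine_system nabla eta.
Proof.
move=> tor fl; have [phi aphi pphi] := atlas_cover p0.
have cphi := atlas_coordinate aphi.
pose U := chart_dom phi; pose E := coord_field phi; pose c := chart_map phi p0.
have oU : open U by exact: chart_dom_open.
have oD0 : open (chart_map phi @` U) by exact: chart_img_open.
pose Ga := christoffel phi.
pose Mx a y : 'M[R]_n := \matrix_(b, d) Ga a b d (chart_inv phi y).
have sGa a b d : smooth_on (chart_map phi @` U) (Ga a b d \o chart_inv phi).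
  by apply: smooth_in_chartS => //; exact: smooth_christoffel.
have sM a : smooth_on (chart_map phi @` U) (Mx a).
  by apply: smooth_mx => // b d; under eq_fun do rewrite mxE; exact: sGa.
have pM a b i e p : U p ->
    partial a (Mx b) (chart_map phi p) i e = derive_along (E a) (Ga b i e) p.
  move=> Up; rewrite -partial_entry; last first.
    by apply: smooth_differentiable (sM b) _; exists p.
  under eq_fun do rewrite mxE.
  by rewrite (derive_along_coord a cphi oU _ (smooth_christoffel cphi b i e)) ?inE.
have MxE a b d p : U p -> Mx a (chart_map phi p) b d = Ga a b d p.
  by move=> Up; rewrite mxE chartK ?inE.
clearbody Mx.
have MM a b i e p : U p -> (Mx b (chart_map phi p) *m Mx a (chart_map phi p)) i e =
    \sum_d Ga b i d p * Ga a d e p.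
  by move=> Up; rewrite mxE; apply: eq_bigr => d _; rewrite !MxE.
have integr a b y : (chart_map phi @` U) y ->
    partial a (Mx b) y + Mx b y *m Mx a y = partial b (Mx a) y + Mx a y *m Mx b y.
  move=> [p Up <-]; apply/matrixP => i e; rewrite [LHS]mxE [RHS]mxE.
  apply: etrans (congr2 +%R (pM a b i e p Up) (MM a b i e p Up)) _.
  apply: etrans _ (esym (congr2 +%R (pM b a i e p Up) (MM b a i e p Up))).
  exact: (christoffel_flat cphi a b i e fl (mem_set Up)).
have D0c : (chart_map phi @` U) c by exists p0.
(* The initial value 1 keeps [u], the future Jacobian, close to the identity near [c], hence with
   positive quadratic form. *)
have [r1 [u [r10 r1D uc su pu]]] := total_differential (1%:M : 'M[R]_n) oD0 D0c sM integr.
have du x : ball c r1 x -> differentiable u x by exact: smooth_differentiable.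
have obr (r : R) : open (ball c r) by exact: ball_open.
have cr1 : ball c r1 c by exact: ballxx.
have puE a b j x : ball c r1 x ->
    partial a (fun y => u y b j) x = \sum_d Mx a x b d * u x d j.
  by move=> xb; rewrite partial_entry ?pu ?mxE//; exact: du.
(* The columns of [u] are closed forms because the Christoffel symbols are symmetric in their lower
   indices. *)
have [||r2 [f [r20 r21 sf pf]]] := poincare_family (w := fun j b x => u x b j) (obr r1) cr1.
- by move=> j b; exact: smooth_entry.
- move=> j a b x xb; rewrite !puE//; apply: eq_bigr => d _; congr (_ * _).
  have [p Up <-] := r1D x xb; rewrite !MxE//.
  by apply: (christoffelC cphi) => //; rewrite inE.
pose F x : 'rV[R]_n := \row_j f j x.
have sF : smooth_on (ball c r2) F.
  by apply: smooth_mx => // i j; under eq_fun do rewrite mxE; exact: sf.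
have jF x : ball c r2 x -> jacmx F x = u x.
  move=> xb; apply/matrixP => i j; rewrite mxE; under eq_fun do rewrite mxE.
  by rewrite pf.
have [r3 r30 Hr3] : exists2 r3, 0 < r3 &
    forall x, ball c r3 x -> n%:R * (n%:R * `|u x - 1%:M|) < 1.
  have e0 : 0 < (n%:R * n%:R + 1)^-1 :> R by rewrite invr_gt0 ltr_wpDl// mulr_ge0.
  have cu := differentiable_continuous (du c cr1).
  have /nbhs_ballP[r3 /= r30 Hr3] : \forall x \near c,
      `|u c - u x| < (n%:R * n%:R + 1)^-1 by exact: (cvgrPdist_lt _ _).1 cu _ e0.
  exists r3 => // x /Hr3; rewrite uc distrC => H.
  have : (n%:R * n%:R + 1) * `|u x - 1%:M| < 1.
    by rewrite -ltr_pdivlMl ?mulr1// ltr_wpDl// mulr_ge0.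
  by apply: le_lt_trans; rewrite mulrA ler_wpM2r// lerDl.
pose r := Num.min r2 r3.
have r0 : 0 < r by rewrite lt_min r20.
have rr2 : ball c r `<=` ball c r2 by apply: le_ball; rewrite ge_min lexx.
have rr3 : ball c r `<=` ball c r3 by apply: le_ball; rewrite ge_min lexx orbT.
have pos (x h : 'rV[R]_n) : ball c r x -> h != 0 -> 0 < (h *m jacmx F x *m h^T) 0 0.
  by move=> xb; rewrite jF; [apply: positive_near_id; apply/Hr3/rr3|exact: rr2].
have sFr : smooth_on (ball c r) F by exact: smooth_sub rr2 sF.
have injF : {in (ball c r : set 'rV[R]_n) &, injective F}.
  apply: injective_of_positive pos => [x y t xb yb t01|x xb].
    by apply: ball_segment => //; rewrite addrC subrK.
  exact: smooth_differentiable sFr xb.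
have uJ x : ball c r x -> jacmx F x \in unitmx.
  by move=> xb; apply: unitmx_of_positive => h; exact: pos.
have [G GK] := left_inverse_exists injF.
have [|eta [ceta deta meta ieta]] := chart_comp cphi (obr r) _ sFr GK uJ.
  by move=> x /rr2 /r21 /r1D.
exists eta; first by rewrite deta; split=> //=; exact: ballxx.
pose V := chart_dom eta.
have oV : open V by exact: chart_dom_open.
have VU : V `<=` U by move=> p; rewrite /V deta => -[].
have Vb p : V p -> ball c r (chart_map phi p) by rewrite /V deta => -[].
pose X := coord_field eta.
have cr x : ball c r x -> ball c r1 x by move=> /rr2/r21.
pose om b j : M -> R := fun p => u (chart_map phi p) b j.
have oVD : open (chart_map phi @` V) by exact: chart_image_openS.
have VD y : (chart_map phi @` V) y -> ball c r1 y by move=> [p /Vb/cr pb <-].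
have omE b j : {in chart_map phi @` V, (fun y => u y b j) =1 om b j \o chart_inv phi}.
  by move=> _ /[!inE] -[p /VU Up <-]; rewrite /om /= chartK ?inE.
have som b j : smooth_fun V (om b j).
  apply: (smooth_of_chart cphi) => //; apply: smooth_ext (omE b j) _ => //.
  apply: smooth_sub VD _; exact: smooth_entry.
have dom a b j p : V p -> derive_along (E a) (om b j) p =
    \sum_d Ga a b d p * om d j p.
  move=> Vp; rewrite (derive_along_coord a cphi oV VU (som b j)) ?inE//.
  have Dp : (chart_map phi @` V) (chart_map phi p) by exists p.
  rewrite -(near_eq_partial a (near_open oVD (omE b j) Dp)) puE; last exact: VD.
  by apply: eq_bigr => d _; rewrite MxE//; exact: VU.
have EX b p : V p -> E b p = \sum_j om b j p *: X j p.
  move=> Vp; rewrite {1}/E (coord_field_change b cphi ceta (VU p Vp) Vp).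
  apply: eq_bigr => j _; congr (_ *: _).
  rewrite coord_fieldE; last exact: smooth_near_coordinate.
  rewrite /om -pf; last exact/rr2/Vb.
  have Dp : (chart_map phi @` V) (chart_map phi p) by exists p.
  apply: near_eq_partial; apply: (near_open oVD) Dp => _ /[!inE] -[q Vq <-].
  by rewrite /= /coordinate meta /= chartK ?inE ?mxE//; exact: VU.
have vE i : vector_field V (E i) by exact: vector_field_sub VU (vector_field_coord i cphi).
have vX i : vector_field V (X i) by exact: vector_field_coord.
(* Expanding [nabla (E a) (E b)] through the new fields [X j], the Leibniz terms already give the
   whole Christoffel sum by the equation for [u], so the remaining terms cancel. *)
have key a p : V p -> forall b, \sum_j om b j p *: nabla (E a) (X j) p = 0.
  move=> Vp b; have Vp' : p \in V by rewrite inE.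
  have : nabla (E a) (E b) p = \sum_d Ga a b d p *: E d p.
    by apply: christoffelE => //; rewrite inE; exact: VU.
  have EXV : {in V, E b =1 fun q => \sum_j om b j q *: X j q}.
    by move=> q /[!inE]; exact: EX.
  rewrite (connection_local conn oV (vE a) (vE b) (fun q _ => erefl) EXV Vp').
  rewrite (nabla_sumr _ oV (som b) (vE a) vX Vp') big_split/=.
  have -> : \sum_j derive_along (E a) (om b j) p *: X j p = \sum_d Ga a b d p *: E d p.
    under [RHS]eq_bigr do rewrite EX// scaler_sumr.
    rewrite exchange_big; apply: eq_bigr => j _ /=; rewrite dom// scaler_suml.
    by apply: eq_bigr => d _; rewrite scalerA.
  by move=> /(canRL (addKr _)); rewrite addNr.
split=> // i Y vY; apply: (nabla_coord_eq0 cphi oV VU (vX i)) => // a p /[!inE] Vp.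
have up : u (chart_map phi p) \in unitmx by rewrite -jF; [apply: uJ|apply: rr2]; exact: Vb.
(* Inverting [u] isolates a single field [X i] in the relations [key]. *)
have : \sum_b invmx (u (chart_map phi p)) i b *: (\sum_j om b j p *: nabla (E a) (X j) p) = 0.
  by apply: big1 => b _; rewrite key// scaler0.
under eq_bigr do rewrite scaler_sumr.
rewrite exchange_big /= => <-.
transitivity (\sum_j (1%:M : 'M[R]_n) i j *: nabla (E a) (X j) p).
  rewrite (bigD1 i)//= mxE eqxx scale1r big1 ?addr0// => j ji.
  by rewrite mxE eq_sym (negbTE ji) scale0r.
apply: eq_bigr => j _; rewrite -(mulVmx up) mxE scaler_suml.
by apply: eq_bigr => b _; rewrite scalerA.
Qed.

End Connections.

(** * Convexity and Legendre duality *)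

Section ConvexFunctions.
Context {R : realType} {n : nat}.

Lemma connected_ball (c : 'rV[R]_n) (r : R) : 0 < r -> connected (ball c r).
Proof.
move=> r0.
pose line (x : 'rV[R]_n) (t : R) := c + t *: (x - c).
have -> : ball c r = \bigcup_(x in ball c r) (line x @` `[0, 1]).
  apply/seteqP; split=> [x xb|_ [x xb [t /= t01 <-]]].
    exists x => //; exists 1 => /=; first by rewrite in_itv/= ler01 lexx.
    by rewrite /line scale1r addrC subrK.
  apply: ball_segment => //; first exact: ballxx.
  by rewrite addrC subrK.
apply: bigcup_connected.
  exists c => x xb; exists 0 => /=; first by rewrite in_itv/= ler01 lexx.
  by rewrite /line scale0r addr0.
move=> x xb; apply: connected_continuous_connected; first exact: segment_connected.
apply: continuous_subspaceT => t; apply: differentiable_continuous.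
by apply: differentiableD => //; exact: differentiableZl.
Qed.

(** Every matrix on the segment from the identity to [A] has a positive form, hence is invertible;
    the determinant, equal to 1 at the start, cannot change sign. Symmetry of [A] is not
    involved. *)
Lemma det_gt0_of_positive (A : 'M[R]_n) :
  (forall h : 'rV[R]_n, h != 0 -> 0 < (h *m A *m h^T) 0 0) -> 0 < \det A.
Proof.
move=> pos.
pose B (t : R) : 'M[R]_n := (1 - t) *: 1%:M + t *: A.
have hh (h : 'rV[R]_n) : h != 0 -> 0 < (h *m h^T) 0 0.
  move=> h0; apply: lt_le_trans (_ : 0 < `|h| ^+ 2) _.
    by rewrite exprn_gt0// normr_gt0.
  rewrite mxE (eq_bigr (fun i => h 0 i ^+ 2)) ?sqr_norm_le// => i _.
  by rewrite mxE expr2.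
have uB (t : R) : 0 <= t <= 1 -> B t \in unitmx.
  move=> /andP[t0 t1]; apply: unitmx_of_positive => h h0.
  rewrite mulmxDr -!scalemxAr mulmxDl -!scalemxAl mulmx1 mxE [X in X + _]mxE [X in _ + X]mxE.
  have [->|tn0] := eqVneq t 0; first by rewrite subr0 mul1r mul0r addr0 hh.
  apply: ltr_wpDl; first by rewrite mulr_ge0 ?subr_ge0//; apply/ltW/hh.
  by rewrite mulr_gt0 ?pos// lt_neqAle eq_sym tn0.
have cB : continuous (fun t => \det (B t)).
  move=> t; apply: cvg_big => [|s _]; first exact: add_continuous.
  apply: cvgM; first exact: cvg_cst.
  apply: cvg_big => [|i _]; first exact: mul_continuous.
  rewrite !mxE; under eq_fun do rewrite !mxE.
  apply: cvgD; apply: cvgM; try exact: cvg_cst; last exact: cvg_id.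
  by apply: cvgB; [exact: cvg_cst|exact: cvg_id].
have B0 : B 0 = 1%:M by rewrite /B subr0 scale1r scale0r addr0.
have B1 : B 1 = A by rewrite /B subrr scale0r scale1r add0r.
rewrite ltNge; apply/negP => dA.
have [|||t t01] := @IVT R (fun t => \det (B t)) 0 1 0.
- exact: ler01.
- exact: continuous_subspaceT.
- by rewrite B0 B1 det1 ge_min le_max dA ler01 orbT.
move=> dB; have := uB t t01; rewrite unitmxE unitfE dB eqxx //.
Qed.

Lemma quadratic_formE (A : 'M[R]_n) (h : 'rV[R]_n) :
  (h *m A *m h^T) 0 0 = \sum_(i < n) h 0 i * \sum_(k < n) h 0 k * A i k.
Proof.
rewrite -mulmxA mxE; apply: eq_bigr => i _; rewrite mxE; congr (_ * _).
by apply: eq_bigr => k _; rewrite mxE mulrC.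
Qed.

Let convex_combination (fx fy fz a b s : R) : 0 <= s -> s <= 1 ->
  fz + (1 - s) * b = fx -> fy + s * a = fz -> a <= b ->
  fz <= s * fx + (1 - s) * fy.
Proof.
move=> s0 s1 <- <- ab; rewrite -subr_ge0.
have -> : s * (fy + s * a + (1 - s) * b) + (1 - s) * fy - (fy + s * a) =
  s * (1 - s) * (b - a) by ring.
by rewrite !mulr_ge0 ?subr_ge0.
Qed.

(** The derivative of [f] along a segment is nondecreasing. Mean value steps on the two pieces cut
    by the convex combination give slopes at parameters on either side of [s], and comparing them is
    Jensen's inequality. *)
Lemma convex_on_of_hessian (D : set 'rV[R]_n) (f : 'rV[R]_n -> R) :
  (forall x, D x -> differentiable f x) ->
  (forall i x, D x -> differentiable (partial i f) x) ->
  (forall x (h : 'rV[R]_n), D x -> 0 <= (h *m hessian f x *m h^T) 0 0) ->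
  convex_on D f.
Proof.
move=> df ddf pos C cC CD t x y Cx Cy.
pose h : 'rV[R]_n := (x : 'rV[R]_n) - y.
pose s := t%:num.
have s0 : 0 <= s by rewrite /s ge0.
have s1 : s <= 1 by rewrite /s le1.
have convE (k : {i01 R}) : conv k x y = (y : 'rV[R]_n) + k%:num *: h.
  transitivity (k%:num *: (x : 'rV[R]_n) + (1 - k%:num) *: (y : 'rV[R]_n)) => //.
  by rewrite /h scalerBr scalerBl scale1r addrCA.
have seg (u : R) : 0 <= u <= 1 -> D ((y : 'rV[R]_n) + u *: h).
  move=> /andP[u0 u1]; apply: CD; rewrite -inE.
  by have := cC _ _ (Itv01 u0 u1) Cx Cy; rewrite convE.
pose G (u : R) := \sum_(i < n) h 0 i * partial i f ((y : 'rV[R]_n) + u *: h).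
have Gmono (a b : R) : 0 <= a -> a <= b -> b <= 1 -> G a <= G b.
  move=> a0 ab b1.
  pose K z := \sum_(i < n) h 0 i * partial i f z.
  have inD (u : R) : 0 <= u <= 1 -> D ((y : 'rV[R]_n) + a *: h + u *: ((b - a) *: h)).
    move=> /andP[u0 u1]; rewrite scalerA -addrA -scalerDl; apply: seg.
    apply/andP; split; first by rewrite addr_ge0 ?mulr_ge0 ?subr_ge0.
    by apply: le_trans b1; rewrite -lerBrDl ler_piMl// subr_ge0.
  have dK z : D z -> forall i, differentiable (fun z => h 0 i * partial i f z) z.
    by move=> Dz i; apply: differentiableM => //; exact: ddf.
  have [u u01|u /andP[u0 u1]] := @MVT_line _ _ K (y + a *: h) ((b - a) *: h).
    by apply: (@differentiable_bigsum R) => i _; apply: dK; exact: inD.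
  have -> : y + a *: h + (b - a) *: h = y + b *: h.
    by rewrite -addrA -scalerDl [a + _]addrC subrK.
  rewrite -[K (y + b *: h)]/(G b) -[K (y + a *: h)]/(G a) => E.
  rewrite -subr_ge0 E.
  pose z : 'rV[R]_n := y + a *: h + u *: ((b - a) *: h); rewrite -/z.
  have Dz : D z by apply: inD; rewrite !ltW.
  rewrite (eq_bigr (fun i => (b - a) * (h 0 i * \sum_(k < n) h 0 k * hessian f z i k))).
    rewrite -mulr_sumr mulr_ge0 ?subr_ge0//.
    by rewrite -quadratic_formE; exact: pos.
  move=> i _; rewrite mxE partial_sum; last by move=> k _; exact: dK.
  rewrite -mulrA; congr (_ * (_ * _)); apply: eq_bigr => k _.
  rewrite partialM//; last exact: ddf.
  by rewrite partial_cst mulr0 addr0; congr (_ * _); rewrite mxE.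
have Dy : D y by have := seg 0; rewrite scale0r addr0 lexx ler01; apply.
have [v v01|v /andP[v0 v1]] := @MVT_line _ _ f y (s *: h).
  rewrite scalerA; apply/df/seg; case/andP: v01 => v0 v1.
  by rewrite mulr_ge0//= mulr_ile1.
have [w w01|w /andP[w0 w1]] := @MVT_line _ _ f (y + s *: h) ((1 - s) *: h).
  rewrite scalerA -addrA -scalerDl; apply/df/seg; case/andP: w01 => w0 w1.
  rewrite addr_ge0 ?mulr_ge0 ?subr_ge0//= -lerBrDl ler_piMl// subr_ge0//.
have -> : (y : 'rV[R]_n) + s *: h + (1 - s) *: h = x.
  by rewrite -addrA -scalerDl [s + _]addrC subrK scale1r /h addrC subrK.
have lin (a u : R) z : z = (y : 'rV[R]_n) + u *: h ->
    \sum_(i < n) (a *: h) 0 i * partial i f z = a * G u.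
  by move=> ->; rewrite mulr_sumr; apply: eq_bigr => i _; rewrite mxE mulrA.
rewrite (lin _ (s + w * (1 - s))); last by rewrite scalerA -addrA -scalerDl.
move=> E2; rewrite (lin _ (v * s)); last by rewrite scalerA.
move=> E1; rewrite convE.
have : G (v * s) <= G (s + w * (1 - s)).
  apply: Gmono; first by rewrite mulr_ge0// ltW.
    apply: (@le_trans _ _ s); first by rewrite ler_piMl// ltW.
    by rewrite lerDl mulr_ge0 ?subr_ge0// ltW.
  by rewrite -lerBrDl ler_piMl ?subr_ge0// ltW.
have : f y + s * G (v * s) = f (y + s *: h) by rewrite -E1 addrC subrK.
have : f (y + s *: h) + (1 - s) * G (s + w * (1 - s)) = f x by rewrite -E2 addrC subrK.
rewrite -[conv _ _ _]/(s * f x + (1 - s) * f y) -/s.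
exact: convex_combination s0 s1.
Qed.

(** The form of the inverse at [h] is that of [A] at [h *m invmx A], up to transposing a 1 by 1
    matrix. *)
Lemma positive_invmx (A : 'M[R]_n) :
  (forall h : 'rV[R]_n, h != 0 -> 0 < (h *m A *m h^T) 0 0) ->
  forall h : 'rV[R]_n, h != 0 -> 0 < (h *m invmx A *m h^T) 0 0.
Proof.
move=> pos h h0; have uA := unitmx_of_positive pos.
have k0 : h *m invmx A != 0.
  by apply: contra h0 => /eqP hA; rewrite -(mulmxKV uA h) hA mul0mx.
have -> : h *m invmx A *m h^T = ((h *m invmx A) *m A *m (h *m invmx A)^T)^T.
  by rewrite trmx_mul trmxK mulmxKV.
by rewrite mxE; exact: pos.
Qed.

Lemma Monge_Ampere_of_positive (D : set 'rV[R]_n) (f : 'rV[R]_n -> R) :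
  domain D -> smooth_on D f ->
  (forall x (h : 'rV[R]_n), D x -> h != 0 -> 0 < (h *m hessian f x *m h^T) 0 0) ->
  Monge_Ampere D f (fun x => \det (hessian f x)).
Proof.
move=> domD sf pos; split=> // [|x Dx].
  apply: convex_on_of_hessian => [x|i x|x h Dx].
  - exact: smooth_differentiable.
  - by apply: smooth_differentiable; exact: smooth_partial.
  - have [->|h0] := eqVneq h 0; first by rewrite !mul0mx mxE.
    by apply: ltW; exact: pos.
by apply/ltW/det_gt0_of_positive => h; exact: pos.
Qed.

Definition gradient (f : 'rV[R]_n -> R) (x : 'rV[R]_n) : 'rV[R]_n :=
  \row_j partial j f x.

Lemma jacmx_gradient f : jacmx (gradient f) = hessian f.
Proof.
apply/funext => x; apply/matrixP => i j; rewrite !mxE.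
by congr (partial i _ x); apply/funext => y; rewrite mxE.
Qed.

Lemma smooth_gradient (D : set 'rV[R]_n) f : open D -> smooth_on D f ->
  smooth_on D (gradient f).
Proof.
move=> oD sf; apply: smooth_mx => // i j; under eq_fun do rewrite mxE.
exact: smooth_partial.
Qed.

(** [g] stands for the inverse of the gradient of [f]: the Legendre transform by its value at the
    critical point instead of as a supremum. *)
Definition legendre (f : 'rV[R]_n -> R) (g : 'rV[R]_n -> 'rV[R]_n)
    (y : 'rV[R]_n) : R :=
  \sum_(i < n) y 0 i * g y 0 i - f (g y).

Section Legendre.
Context (D : set 'rV[R]_n) (f : 'rV[R]_n -> R) (g : 'rV[R]_n -> 'rV[R]_n).
Context (oD : open D) (sf : smooth_on D f)
  (gK : forall x, D x -> g (gradient f x) = x)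
  (uH : forall x, D x -> hessian f x \in unitmx).

Let uJ x : D x -> jacmx (gradient f) x \in unitmx.
Proof. by rewrite jacmx_gradient; exact: uH. Qed.

Let dgrad x : D x -> differentiable (gradient f) x.
Proof. exact: smooth_differentiable (smooth_gradient oD sf). Qed.

Let sg : smooth_on (gradient f @` D) g. Proof. exact: inverse_smooth oD (smooth_gradient oD sf) gK uJ. Qed.

Lemma open_gradient_image : open (gradient f @` D).
Proof.
by apply: open_map => //; exact: injective_of_left_inverse gK.
Qed.

Lemma smooth_legendre : smooth_on (gradient f @` D) (legendre f g).
Proof.
have oE := open_gradient_image; apply: smoothB => //.
  apply: smooth_sum => // i _; apply: smoothM => //; last exact: smooth_entry.
  by apply: smooth_entry => //; exact: smooth_id.
by apply: smooth_comp oE _ sg sf => _ [x Dx <-]; rewrite gK.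
Qed.

(** The terms containing derivatives of [g] carry the factors [y 0 i - partial i f x], which vanish
    because [y] is the gradient at [x]. *)
Lemma partial_legendre x j : D x ->
  partial j (legendre f g) (gradient f x) = x 0 j.
Proof.
move=> Dx; set y := gradient f x.
have dg : differentiable g y by apply: smooth_differentiable sg _; exists x.
have gy : g y = x by exact: gK.
have dfg : differentiable f (g y).
  by rewrite gy; exact: smooth_differentiable sf Dx.
have dgi i : differentiable (fun y => g y 0 i) y by exact: differentiable_entry.
have dyi i : differentiable (fun y : 'rV[R]_n => y 0 i) y by exact: differentiable_entry.
have dM i : differentiable (fun y : 'rV[R]_n => y 0 i * g y 0 i) y by exact: differentiableM.
rewrite partialB; last 2 first.
- exact: differentiable_bigsum.
- exact: differentiable_comp.
rewrite partial_sum// (partial_comp _ dg dfg).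
under eq_bigr do rewrite partialM// partial_coord.
rewrite big_split/= addrAC -sumrB big1 ?add0r => [|i _].
  rewrite (bigD1 j)//= eqxx mulr1 big1 ?addr0 ?gy// => i ij.
  by rewrite eq_sym (negbTE ij) mulr0.
by rewrite gy /y mxE /GRing.scale/= mulrC subrr.
Qed.

(** The gradient of the transform is [g] on the open image, and the Jacobian of [g] is the inverse
    of that of [gradient f]. *)
Lemma hessian_legendre x : D x ->
  hessian (legendre f g) (gradient f x) = invmx (hessian f x).
Proof.
move=> Dx; apply/matrixP => i j; rewrite mxE.
have Ey : (gradient f @` D) (gradient f x) by exists x.
have dg := inverse_differentiable oD dgrad gK uJ.
rewrite (@near_eq_partial _ _ _ _ (fun y => g y 0 j)); last first.
  apply: (near_open open_gradient_image) Ey => _ /[!inE] -[z Dz <-].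
  by rewrite partial_legendre// gK.
have [dgx pg] := dg x Dx.
by rewrite partial_entry// pg mxE jacmx_gradient.
Qed.
End Legendre.

End ConvexFunctions.

(** * Dually flat manifolds *)

Section DuallyFlat.
Context {R : realType} {n : nat} {M : manifold R n} {g : metric M}.
Context (rg : riemannian g).

Lemma metric0l (p : M) w : tangent p w -> g p 0 w = 0.
Proof.
move=> tw; have := metric_linear rg 1 (tangent0 p) (tangent0 p) tw.
by rewrite scaler0 addr0 mul1r => /esym/eqP; rewrite -subr_eq0 addrK => /eqP.
Qed.

Lemma tangent_bigsum (p : M) (I : Type) (r : seq I) (a : I -> R) (v : I -> functional M) :
  (forall i, tangent p (v i)) -> tangent p (\sum_(i <- r) a i *: v i).
Proof.
move=> tv; elim: r => [|i r IHr]; first by rewrite big_nil; exact: tangent0.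
by rewrite big_cons; apply: tangentD => //; exact: tangentZ.
Qed.

Lemma metric_suml (p : M) (I : Type) (r : seq I) (a : I -> R) (v : I -> functional M) w :
  (forall i, tangent p (v i)) -> tangent p w ->
  g p (\sum_(i <- r) a i *: v i) w = \sum_(i <- r) a i * g p (v i) w.
Proof.
move=> tv tw; elim: r => [|i r IHr]; first by rewrite !big_nil metric0l.
rewrite !big_cons -IHr; apply: (metric_linear rg) => //.
exact: tangent_bigsum.
Qed.

Lemma metric_sumr (p : M) (I : Type) (r : seq I) (a : I -> R) (v : I -> functional M) w :
  (forall i, tangent p (v i)) -> tangent p w ->
  g p w (\sum_(i <- r) a i *: v i) = \sum_(i <- r) a i * g p w (v i).
Proof.
move=> tv tw; rewrite (Defs.metric_sym rg)//; last exact: tangent_bigsum.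
rewrite metric_suml//; apply: eq_bigr => i _.
by rewrite (Defs.metric_sym rg).
Qed.

(** Evaluating on the coordinate functions recovers [h] from the tangent vector it defines, so that
    vector is nonzero and positivity of [g] applies. *)
Lemma gram_positive (eta : chart R n M) (p : M) :
  coordinate_system eta -> chart_dom eta p ->
  forall h : 'rV[R]_n, h != 0 -> 0 < (h *m gram g eta p *m h^T) 0 0.
Proof.
move=> ceta pd h h0.
have tX i := tangent_coord_field i ceta pd.
pose v := \sum_(i < n) h 0 i *: coord_field eta i p.
have tv : tangent p v by exact: tangent_bigsum.
suff -> : (h *m gram g eta p *m h^T) 0 0 = g p v v.
  apply: (metric_pos rg) => //; apply: contra h0 => /eqP v0.
  apply/eqP/rowP => j; rewrite [RHS]mxE.
  have : v (coordinate eta j) = 0 by rewrite v0.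
  rewrite /v sum_functionalE (bigD1 j)//= coord_field_coordinate// eqxx mulr1.
  rewrite big1 ?addr0// => i ij.
  by rewrite coord_field_coordinate// (negbTE ij) mulr0.
rewrite quadratic_formE /v metric_suml//; apply: eq_bigr => i _; congr (_ * _).
by rewrite metric_sumr//; apply: eq_bigr => k _; rewrite mxE.
Qed.

(** Meant for the pairings of biorthogonal fields, which are known to be constant only on the chart
    domain. *)
Lemma tangent_constant (p : M) v V f (c : R) : tangent p v -> open V -> V p ->
  {in V, f =1 fun=> c} -> v f = 0.
Proof.
move=> tv oV Vp fc; have [phi aphi pphi] := atlas_cover p.
have cphi := atlas_coordinate aphi.
rewrite (tangent_coord cphi pphi tv) sum_functionalE big1// => i _.
have sc : smooth_near p (fun=> c) by apply: (smooth_near_open oV Vp); exact: smooth_fun_cst.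
rewrite -(coord_field_ext i cphi pphi sc oV Vp); last by move=> q Vq; rewrite fc.
by rewrite coord_fieldE// partial_cst mulr0.
Qed.

Context {nabla nabla' : vfield M -> vfield M -> vfield M}.
Context (conn : affine_connection nabla) (conn' : affine_connection nabla').
Context (dual : dual_connections g nabla nabla').

(* The components of the metric in nabla-affine coordinates satisfy the Codazzi
   equations: X_a g(X_b, X_c) = g(X_b, nabla'_(X_a) X_c), where nabla' is
   torsion-free. *)
Lemma gram_codazzi (eta : chart R n M) a b d : torsion_free nabla' ->
  affine_system nabla eta -> {in chart_dom eta, forall p,
  derive_along (coord_field eta a) (pairing g (coord_field eta b) (coord_field eta d)) p =
  derive_along (coord_field eta d) (pairing g (coord_field eta b) (coord_field eta a)) p}.
Proof.
move=> tor [ceta peta] p Up.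
have pd : chart_dom eta p by rewrite inE in Up.
have oU := @chart_dom_open _ _ _ eta.
have vX i := vector_field_coord i ceta.
have tX i := tangent_coord_field i ceta pd.
have half k l : derive_along (coord_field eta k)
   (pairing g (coord_field eta b) (coord_field eta l)) p =
   g p (coord_field eta b p) (nabla' (coord_field eta k) (coord_field eta l) p).
  rewrite (dual oU (vX k) (vX b) (vX l) Up) /pairing.
  by rewrite (peta b _ (vX k) p Up) metric0l// add0r.
rewrite !half; congr (g p _ _); apply/eqP; rewrite -subr_eq0.
have := tor _ _ _ oU (vX a) (vX d) p Up.
by rewrite (bracket_coord a d ceta pd) => ->.
Qed.

(** Codazzi closes each row of the metric, giving functions [h b]; symmetry of the metric then
    closes the form with components [h b], whose primitive is [psi]. The chart is cut down so that
    its image is exactly a ball, as the injectivity of the gradient of [psi] will need convexity. *)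
Lemma dual_chart_exists (eta : chart R n M) (p0 : M) : torsion_free nabla' ->
  affine_system nabla eta -> chart_dom eta p0 ->
  exists (eta1 : chart R n M) (psi : 'rV[R]_n -> R) (c : 'rV[R]_n) (r : R),
    [/\ 0 < r, chart_dom eta1 p0, affine_system nabla eta1,
        chart_map eta1 @` chart_dom eta1 = ball c r
      & smooth_on (ball c r) psi /\
        forall p, chart_dom eta1 p -> hessian psi (chart_map eta1 p) = gram g eta1 p].
Proof.
move=> tor aeta p0d; have [ceta peta] := aeta.
pose U := chart_dom eta; pose X := coord_field eta; pose c := chart_map eta p0.
have oU : open U by exact: chart_dom_open.
have vX i : vector_field U (X i) by exact: vector_field_coord.
pose D0 := chart_map eta @` U.
have oD0 : open D0 by exact: chart_img_open.
have D0c : D0 c by exists p0.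
pose G b d := pairing g (X b) (X d).
have sG b d : smooth_fun U (G b d) by exact: (metric_smooth rg).
have symG b d p : U p -> G b d p = G d b p.
  by move=> Up; apply: (Defs.metric_sym rg); exact: tangent_coord_field.
pose w b d := G b d \o chart_inv eta.
have sw b d : smooth_on D0 (w b d) by exact: smooth_in_chartS.
have wE b d p : U p -> w b d (chart_map eta p) = G b d p.
  by move=> Up; rewrite /w /= chartK ?inE.
have pw a b d y : D0 y -> partial a (w b d) y = partial d (w b a) y.
  move=> [p Up <-].
  have UU : U `<=` U by [].
  have Up' := mem_set Up.
  apply: etrans (esym (derive_along_coord a ceta oU UU (sG b d) Up')) _.
  apply: etrans _ (derive_along_coord d ceta oU UU (sG b a) Up').
  exact: gram_codazzi.
have wsym b d y : D0 y -> w b d y = w d b y.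
  by move=> [p Up <-]; exact: etrans (wE b d p Up) (etrans (symG b d p Up) (esym (wE d b p Up))).
clearbody w; clear sG.
have [r1 [h [r10 r1D sh ph]]] := poincare_family oD0 D0c sw (fun b a d y => pw a b d y).
have obr (r : R) : open (ball c r) by exact: ball_open.
have cr1 : ball c r1 c by exact: ballxx.
have [|r [psi [r0 rr1 spsi ppsi]]] := poincare (obr r1) cr1 sh.
  move=> a b y yb; apply: etrans (ph b a y yb) (etrans _ (esym (ph a b y yb))).
  exact: wsym (r1D y yb).
have jid (x : 'rV[R]_n) : jacmx id x = 1%:M.
  by apply/matrixP => i j; rewrite mxE partial_coord mxE.
have [||||eta1 [ceta1 deta1 meta1 ieta1]] := @chart_comp R n M eta (ball c r) id id ceta (obr r).
- by move=> x /rr1/r1D.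
- exact: smooth_id.
- by [].
- by move=> x _; rewrite jid unitmx1.
have V1U : chart_dom eta1 `<=` U by rewrite deta1 => p [].
have X1 : coord_field eta1 = X.
  by rewrite /X /coord_field meta1 ieta1.
have d1p0 : chart_dom eta1 p0 by rewrite deta1; split=> //; exact: ballxx.
exists eta1, psi, c, r; split=> //.
- split=> // i Y vY; rewrite X1.
  have oV := @chart_dom_open _ _ _ eta1.
  have vXi := vector_field_sub V1U (vX i).
  apply: (nabla_coord_eq0 conn ceta oV V1U vXi _ vY) => j p.
  by rewrite inE => /V1U Up; apply: (peta i _ (vX j)); rewrite inE.
- rewrite meta1 deta1; apply/seteqP; split=> [_ [p [_ pb] <-]//|y yb].
  have [p Up py] := r1D _ (rr1 _ yb).
  by exists p => //; split=> //=; rewrite py.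
- split=> // p; rewrite meta1 deta1 => -[Up pb]; apply/matrixP => i j.
  rewrite [LHS]mxE [RHS]mxE X1 -[RHS]/(G i j p) -symG// -wE//.
  apply: etrans (ph j i _ (rr1 _ pb)); apply: near_eq_partial.
  by apply: near_open (obr r) _ pb => y /[!inE] yb; exact: ppsi.
Qed.

(** Differentiating the constant pairings gives 0, and the [nabla] term vanishes since [eta] is
    affine. Hence the [nabla'] derivative of a dual field is orthogonal to a basis, and therefore to
    itself. *)
Lemma affine_of_mutually_dual (eta eta' : chart R n M) : affine_system nabla eta ->
  coordinate_system eta' -> mutually_dual g eta eta' -> affine_system nabla' eta'.
Proof.
move=> [ceta peta] ceta' [dom_eta dualE]; split=> // j X vX p Up'.
have pd' : chart_dom eta' p by rewrite inE in Up'.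
have pd : chart_dom eta p by rewrite dom_eta.
have oU' := @chart_dom_open _ _ _ eta'.
have vX' : vector_field (chart_dom eta) X by rewrite dom_eta.
have vE i : vector_field (chart_dom eta') (coord_field eta i).
  by rewrite -dom_eta; exact: vector_field_coord.
have vE' := vector_field_coord j ceta'.
pose v := nabla' X (coord_field eta' j) p; rewrite -/v.
have tv : tangent p v by exact: (connection_field conn' oU' vX vE').1.
have gv i : g p (coord_field eta i p) v = 0.
  have := dual oU' vX (vE i) vE' Up'; rewrite [X in _ = X + _]/pairing.
  rewrite (peta i X vX' p) ?inE// metric0l; last exact: tangent_coord_field.
  rewrite add0r => dE; rewrite -[LHS]/(pairing g (coord_field eta i) (nabla' X (coord_field eta' j)) p) -dE.
  apply: (tangent_constant (V := chart_dom eta') (c := (i == j)%:R)) => //.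
  - exact: vX.1.
  - exact: pd'.
  - by move=> q /[!inE] qd; apply: dualE; rewrite dom_eta.
apply: contrapT => /eqP /(metric_pos rg tv).
rewrite {1}(tangent_coord ceta pd tv) metric_suml => // [|i]; last exact: tangent_coord_field.
by rewrite big1 ?ltxx// => i _; rewrite gv mulr0.
Qed.

Lemma dual_chart_of_potential (eta : chart R n M) psi G : coordinate_system eta ->
  smooth_on (chart_map eta @` chart_dom eta) psi ->
  (forall p, chart_dom eta p -> hessian psi (chart_map eta p) = gram g eta p) ->
  (forall x, (chart_map eta @` chart_dom eta) x -> G (gradient psi x) = x) ->
  exists eta' : chart R n M, [/\ coordinate_system eta', mutually_dual g eta eta'
    & chart_map eta' = gradient psi \o chart_map eta].
Proof.
move=> ceta spsi hpsi GK; pose D := chart_map eta @` chart_dom eta.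
have oD : open D by exact: chart_img_open.
have uJ x : D x -> jacmx (gradient psi) x \in unitmx.
  move=> [p pd <-]; rewrite jacmx_gradient hpsi//.
  by apply: unitmx_of_positive; exact: gram_positive.
have [|eta' [ceta' deta' meta' ieta']] := chart_comp ceta oD _ (smooth_gradient oD spsi) GK uJ.
  by [].
have dom_eta : chart_dom eta = chart_dom eta'.
  by rewrite deta'; apply/seteqP; split=> [p pd|p []//]; split=> //; exists p.
exists eta'; split=> //; split=> // p pd i j.
have pd' : chart_dom eta' p by rewrite -dom_eta.
pose a k := coord_field eta' j p (coordinate eta k).
have tE k := tangent_coord_field k ceta pd.
have YE : coord_field eta' j p = \sum_(k < n) a k *: coord_field eta k p.
  exact: coord_field_change.
have XE k : coord_field eta k p (coordinate eta' i) =
    g p (coord_field eta i p) (coord_field eta k p).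
  rewrite coord_fieldE; last exact: smooth_near_coordinate.
  transitivity (gram g eta p k i); last first.
    by rewrite mxE; exact: (Defs.metric_sym rg).
  rewrite -hpsi// mxE; apply: near_eq_partial.
  apply: near_open oD _ _; last by exists p.
  by move=> _ /[!inE] -[q qd <-]; rewrite /= /coordinate meta' /= chartK ?inE// mxE.
(* By [XE], pairing with the [i]-th field of [eta] acts on the fields of [eta] like the derivation
   of the [i]-th coordinate of [eta']; so pairing with the [j]-th field of [eta'] gives the
   derivative of that coordinate along it, a Kronecker delta. *)
rewrite eq_sym -(coord_field_coordinate j i ceta' pd') {2}YE sum_functionalE YE metric_sumr//.
by apply: eq_bigr => k _; rewrite XE.
Qed.

End DuallyFlat.

Theorem theorem3 (R : realType) (n : nat) (M : manifold R n) (g : metric M)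
    (nabla nabla' : vfield M -> vfield M -> vfield M)
    (hM : dually_flat g nabla nabla') :
  forall p : M, exists eta eta' : chart R n M,
    [/\ chart_dom eta p,
        affine_system nabla eta,
        affine_system nabla' eta',
        mutually_dual g eta eta'
      & exists psi psi' : 'rV[R]_n -> R,
          [/\ potential_functions g eta eta' psi psi',
              exists f : 'rV[R]_n -> R,
                Monge_Ampere (chart_map eta @` chart_dom eta) psi f
            & exists f' : 'rV[R]_n -> R,
                Monge_Ampere (chart_map eta' @` chart_dom eta') psi' f']].
Proof.
move=> p; have [rg conn conn' tor tor' fl _ dual] := hM.
have [eta0 d0p a0] := affine_chart_exists conn p tor fl.
have [eta [psi [c [r [r0 dp aeta img [spsi hpsi]]]]]] :=
  dual_chart_exists rg conn dual tor' a0 d0p.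
have ceta := aeta.1.
have obr : open (ball c r) by exact: ball_open.
have pos (x h : 'rV[R]_n) : ball c r x -> h != 0 ->
    0 < (h *m hessian psi x *m h^T) 0 0.
  by rewrite -img => -[q qd <-]; rewrite hpsi//; exact: gram_positive.
have uH (x : 'rV[R]_n) : ball c r x -> hessian psi x \in unitmx.
  by move=> xb; apply: unitmx_of_positive => h; exact: pos.
have dgrad (x : 'rV[R]_n) : ball c r x -> differentiable (gradient psi) x.
  by move=> xb; exact: smooth_differentiable (smooth_gradient obr spsi) xb.
have injF : {in (ball c r : set 'rV[R]_n) &, injective (gradient psi)}.
  apply: injective_of_positive dgrad _ => [x y t xb yb t01|x h xb h0].
    by apply: ball_segment => //; rewrite addrC subrK.
  by rewrite jacmx_gradient; exact: pos.
have [G GK] := left_inverse_exists injF.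
have [||eta' [ceta' dual_eta meta']] :=
  dual_chart_of_potential (G := G) rg ceta _ hpsi.
- by rewrite img.
- by move=> x; rewrite img; exact: GK.
have etab q : chart_dom eta q -> ball c r (chart_map eta q).
  by move=> qd; rewrite -img; exists q.
exists eta, eta'; split=> //; first exact: affine_of_mutually_dual aeta ceta' dual_eta.
exists psi, (legendre psi G); split.
- split=> q qd; first by rewrite hpsi.
  rewrite meta' /= (hessian_legendre obr spsi GK uH); last exact: etab.
  by rewrite hpsi.
(* The equation holds by choice of the right-hand side; the content is smoothness, convexity and the
   sign of the determinant. *)
- exists (fun x => \det (hessian psi x)); rewrite img.
  apply: Monge_Ampere_of_positive => //; split=> //; last exact: connected_ball.
  by exists c; exact: ballxx.
exists (fun y => \det (hessian (legendre psi G) y)).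
(* This image need not be convex: its connectedness comes from the continuity of the gradient, and
   [convex_on] asks for Jensen's inequality only on convex subsets. *)
have -> : chart_map eta' @` chart_dom eta' = gradient psi @` ball c r.
  by rewrite meta' -dual_eta.1 -img image_comp.
apply: Monge_Ampere_of_positive.
- split; first by exists (gradient psi c); exists c => //; exact: ballxx.
    exact: open_gradient_image obr spsi GK uH.
  apply: connected_continuous_connected; first exact: connected_ball.
  by apply: continuous_in_subspaceT => x /[!inE] xb; exact: differentiable_continuous (dgrad x xb).
- exact: smooth_legendre.
- move=> _ h [x xb <-]; rewrite (hessian_legendre obr spsi GK uH xb).
  by apply: positive_invmx => k; exact: pos.
Qed.
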